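(* A planar orthogonal net and the coordinate lines of a Cartesian coordinate system are a confocal family of conics and the coordinate lines of the Cartesian coordinate system aligned along the principal axes of the conics if and only if the following two conditions are satisfied: 1. the 4-web formed by the net and the coordinate lines of the Cartesian coordinate system is of maximal rank, and 2. the rank quartic of the 4-web splits into a conic and 2 lines meeting at this conic (i.e. the intersection point of the two lines lies on the conic), where the lines correspond to the coordinate foliations of the Cartesian coordinate system.
   Context: All considerations are local: webs and their foliations are defined on some planar open set $U$. A net is a pair of transversal foliations by curves; it is orthogonal if the leaves of one foliation meet those of the other at right angles. A planar $d$-web $\mathcal W_d$ is a $d$-tuple of foliations $\mathcal F_1,\dots,\mathcal F_d$ of $U$ by curves, pairwise transversal; the 4-web in the claim consists of the two foliations of the orthogonal net and the two foliations $x=\mathrm{const}$, $y=\mathrm{const}$ by Cartesian coordinate lines. Abelian relation of $\mathcal W_d$: a $d$-tuple $(\omega_1,\dots,\omega_d)$ of differential 1-forms such that (i) the leaves of $\mathcal F_i$ are solutions of $\omega_i=0$ (the choice $\omega_i\equiv 0$ is allowed), (ii) $d\omega_i=0$ for all $i$, (iii) $\sum_{i=1}^d\omega_i=0$. The Abelian relations form a vector space, whose dimension is called the rank of $\mathcal W_d$. The rank is at most $\frac12(d-1)(d-2)$, so the maximal rank of a planar 4-web is $3$. Rank quartic: a planar 4-web of maximal rank is locally diffeomorphic, by a linearization unique up to projective transformations, to the web formed by the tangent lines to an algebraic curve $C$ of class 4. The dual curve $C^*$ has degree 4 and may be reducible; its projective class is called the rank curve, or rank quartic, of the web. Explicitly: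 choose a first integral $s_i$ of each $\mathcal F_i$ and write a basis of the Abelian relations as $\sum_{i=1}^4 x_i^{\alpha}(s_i)\,ds_i=0$, $\alpha=1,2,3$; then the points $[x_i^1:x_i^2:x_i^3]\in\mathbb P^2$, $i=1,\dots,4$, trace four arcs of the rank quartic. The component containing the $i$-th arc corresponds to the foliation $\mathcal F_i$; if it is a straight line, then the corresponding foliation of the linearized web is a pencil of lines. Confocal family of conics: in Cartesian coordinates aligned along the principal axes of the conics, with origin at their center, the family $\frac{x^2}{a^2-\lambda}+\frac{y^2}{b^2-\lambda}=1$ with fixed $a,b$ and parameter $\lambda$. These conics form an orthogonal net.
   Formalization: Here a confocal family of conics may also be a family of confocal parabolas with axis parallel to a coordinate axis: such nets satisfy conditions 1 and 2 as well, so the ''if'' direction fails for the central families x²/(a²−λ)+y²/(b²−λ)=1 alone. *)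

(* Defs.v *)
(* Written for the Stdlib real numbers with Coquelicot. *)
From Stdlib Require Export Reals List.
From Coquelicot Require Export Coquelicot.
Open Scope R_scope.

Definition Rsum (n : nat) (f : nat -> R) : R :=
  fold_right Rplus 0 (map f (seq 0 n)).

(** * Plane domains, smooth functions, 1-forms *)

Definition connected (U : R * R -> Prop) : Prop :=
  forall V W : R * R -> Prop, open V -> open W ->
    (forall p, U p -> V p \/ W p) ->
    (exists p, U p /\ V p) -> (exists p, U p /\ W p) ->
    exists p, U p /\ V p /\ W p.

Definition plane_domain (U : R * R -> Prop) : Prop :=
  open U /\ (exists p, U p) /\ connected U.

(* [ex_diff_n f n x y] asks for the iterated partial derivatives of [f] up to
   order [n] to exist and be continuous at (x, y); over an open [U] this is
   C^infinity. *)
Definition smooth (U : R * R -> Prop) (f : R -> R -> R) : Prop :=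
  forall x y, U (x, y) -> forall n, ex_diff_n f n x y.

(* The form [cdx dx + cdy dy].  Only values at points of the domain [U] under
   consideration are meaningful, so everything below is relative to [U]. *)
Record one_form := OneForm { cdx : R -> R -> R; cdy : R -> R -> R }.

Definition smooth_form (U : R * R -> Prop) (w : one_form) : Prop :=
  smooth U (cdx w) /\ smooth U (cdy w).

Definition function_differential (f : R -> R -> R) : one_form :=
  OneForm (fun x y => Derive (fun t => f t y) x)
          (fun x y => Derive (fun t => f x t) y).

Definition closed_form (U : R * R -> Prop) (w : one_form) : Prop :=
  forall x y, U (x, y) ->
    Derive (fun t => cdx w x t) y = Derive (fun t => cdy w t y) x.

Definition wedge (w1 w2 : one_form) (x y : R) : R :=
  cdx w1 x y * cdy w2 x y - cdy w1 x y * cdx w2 x y.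

(** * Foliations, nets and webs *)

(* A foliation by curves is given by a nowhere vanishing 1-form [th]; its leaves
   are the integral curves of [th = 0].  In the plane there is no integrability
   condition. *)
Definition foliation (U : R * R -> Prop) (th : one_form) : Prop :=
  smooth_form U th /\
  forall x y, U (x, y) -> cdx th x y <> 0 \/ cdy th x y <> 0.

Definition transversal (U : R * R -> Prop) (th1 th2 : one_form) : Prop :=
  forall x y, U (x, y) -> wedge th1 th2 x y <> 0.

Definition net (U : R * R -> Prop) (th1 th2 : one_form) : Prop :=
  foliation U th1 /\ foliation U th2 /\ transversal U th1 th2.

(* The leaves meet at right angles iff their conormals do. *)
Definition orthogonal_net (U : R * R -> Prop) (th1 th2 : one_form) : Prop :=
  net U th1 th2 /\
  forall x y, U (x, y) ->
    cdx th1 x y * cdx th2 x y + cdy th1 x y * cdy th2 x y = 0.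

Definition is_web (U : R * R -> Prop) (d : nat) (W : nat -> one_form) : Prop :=
  (forall i, (i < d)%nat -> foliation U (W i)) /\
  (forall i j, (i < j)%nat -> (j < d)%nat -> transversal U (W i) (W j)).

Definition x_const : one_form := OneForm (fun _ _ => 1) (fun _ _ => 0).
Definition y_const : one_form := OneForm (fun _ _ => 0) (fun _ _ => 1).

(* Foliations 0 and 1 form the net, foliation 2 is x = const and foliation 3 is
   y = const. *)
Definition net_with_coordinate_lines (th1 th2 : one_form) (i : nat) : one_form :=
  match i with
  | 0%nat => th1
  | 1%nat => th2
  | 2%nat => x_const
  | _ => y_const
  end.

(** * Abelian relations and rank *)

Definition abelian_relation (U : R * R -> Prop) (d : nat) (W : nat -> one_form)
    (w : nat -> one_form) : Prop :=
  (forall i, (i < d)%nat ->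
     smooth_form U (w i) /\
     (forall x y, U (x, y) -> wedge (w i) (W i) x y = 0) /\
     closed_form U (w i)) /\
  (forall x y, U (x, y) ->
     Rsum d (fun i => cdx (w i) x y) = 0 /\
     Rsum d (fun i => cdy (w i) x y) = 0).

(* [b k], for [k < n], form a basis of the space of Abelian relations on [U]:
   [b k i] is the component of the [k]-th relation along the [i]-th foliation. *)
Definition abelian_basis (U : R * R -> Prop) (d : nat) (W : nat -> one_form)
    (n : nat) (b : nat -> nat -> one_form) : Prop :=
  (forall k, (k < n)%nat -> abelian_relation U d W (b k)) /\
  (forall c : nat -> R,
     (forall i x y, (i < d)%nat -> U (x, y) ->
        Rsum n (fun k => c k * cdx (b k i) x y) = 0 /\
        Rsum n (fun k => c k * cdy (b k i) x y) = 0) ->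
     forall k, (k < n)%nat -> c k = 0) /\
  (forall w, abelian_relation U d W w ->
     exists c : nat -> R,
       forall i x y, (i < d)%nat -> U (x, y) ->
         cdx (w i) x y = Rsum n (fun k => c k * cdx (b k i) x y) /\
         cdy (w i) x y = Rsum n (fun k => c k * cdy (b k i) x y)).

Definition web_rank (U : R * R -> Prop) (d : nat) (W : nat -> one_form)
    (r : nat) : Prop :=
  exists b, abelian_basis U d W r b.

Definition maximal_rank (U : R * R -> Prop) (d : nat) (W : nat -> one_form) : Prop :=
  web_rank U d W ((d - 1) * (d - 2) / 2).

(** * Plane projective curves and the rank quartic *)

(* A curve in P^2 is given by a nonzero form in the homogeneous coordinates. *)
Definition plane_curve (d : nat) (F : R -> R -> R -> R) : Prop :=
  (exists c : nat -> nat -> R, forall X Y Z,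
     F X Y Z = Rsum (S d) (fun i => Rsum (S (d - i)) (fun j =>
                 c i j * X ^ i * Y ^ j * Z ^ (d - i - j)))) /\
  exists X Y Z, F X Y Z <> 0.

Definition is_line (L : R -> R -> R -> R) : Prop :=
  exists l m n, (l <> 0 \/ m <> 0 \/ n <> 0) /\
    forall X Y Z, L X Y Z = l * X + m * Y + n * Z.

(* The first condition is the nonvanishing of the determinant of the symmetric
   matrix of the quadratic form: the conic is irreducible. *)
Definition is_conic (Q : R -> R -> R -> R) : Prop :=
  exists a b c d e f,
    a * b * c + 2 * d * e * f - a * f ^ 2 - b * e ^ 2 - c * d ^ 2 <> 0 /\
    forall X Y Z,
      Q X Y Z = a * X ^ 2 + b * Y ^ 2 + c * Z ^ 2
                + 2 * d * X * Y + 2 * e * X * Z + 2 * f * Y * Z.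

(* With a first integral s_i of the i-th foliation, [b k i] = x_i^k(s_i) ds_i and
   ds_i = mu [W i] for some function mu without zeros, so the vector (X, Y, Z)
   below is mu (x_i^0, x_i^1, x_i^2): homogeneous coordinates of the point of the
   i-th arc attached to the leaf through (x, y). *)
Definition curve_contains_arc (U : R * R -> Prop) (W : nat -> one_form)
    (b : nat -> nat -> one_form) (i : nat) (F : R -> R -> R -> R) : Prop :=
  forall x y, U (x, y) -> forall X Y Z,
    cdx (b 0%nat i) x y = X * cdx (W i) x y ->
    cdy (b 0%nat i) x y = X * cdy (W i) x y ->
    cdx (b 1%nat i) x y = Y * cdx (W i) x y ->
    cdy (b 1%nat i) x y = Y * cdy (W i) x y ->
    cdx (b 2%nat i) x y = Z * cdx (W i) x y ->
    cdy (b 2%nat i) x y = Z * cdy (W i) x y ->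
    F X Y Z = 0.

(* The four points attached to a point of [U] are distinct and collinear, so no
   curve of degree less than 4 contains all the arcs, and at most one quartic
   does. *)
Definition rank_quartic (U : R * R -> Prop) (W : nat -> one_form)
    (b : nat -> nat -> one_form) (F : R -> R -> R -> R) : Prop :=
  plane_curve 4 F /\
  forall i, (i < 4)%nat -> curve_contains_arc U W b i F.

(* Another basis changes the rank quartic by a projective transformation, so the
   choice of [b] is immaterial.  The last line says that foliations 2 and 3
   correspond to the two lines. *)
Definition rank_quartic_is_conic_and_two_lines_through_it
    (U : R * R -> Prop) (W : nat -> one_form) : Prop :=
  exists b F, abelian_basis U 4 W 3 b /\ rank_quartic U W b F /\
  exists Q L1 L2, is_conic Q /\ is_line L1 /\ is_line L2 /\
    (forall X Y Z, F X Y Z = Q X Y Z * L1 X Y Z * L2 X Y Z) /\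
    (exists X Y Z, L1 X Y Z = 0 /\ L2 X Y Z <> 0) /\
    (exists X Y Z, (X <> 0 \/ Y <> 0 \/ Z <> 0) /\
       L1 X Y Z = 0 /\ L2 X Y Z = 0 /\ Q X Y Z = 0) /\
    curve_contains_arc U W b 2 L1 /\ curve_contains_arc U W b 3 L2.

(** * Confocal families of conics *)

(* [E lam x y] says that (x, y) lies on the conic with parameter [lam].  The
   principal axes are parallel to the coordinate axes.  Besides the families with
   center (x0, y0), confocal parabolas with focus (x0, y0) and a common axis are
   included: they are the limit in which one focus goes to infinity, and their
   rank quartic has one of the two lines tangent to the conic at the common
   point.  The case a^2 = b^2 (concentric circles) needs no exclusion: it
   provides only one foliation, hence no net. *)
Inductive confocal_family : (R -> R -> R -> Prop) -> Prop :=
| confocal_central (a b x0 y0 : R) :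
    confocal_family (fun lam x y =>
      a ^ 2 - lam <> 0 /\ b ^ 2 - lam <> 0 /\
      (x - x0) ^ 2 / (a ^ 2 - lam) + (y - y0) ^ 2 / (b ^ 2 - lam) = 1)
| confocal_parabolas_x (x0 y0 : R) :
    confocal_family (fun lam x y =>
      lam <> 0 /\ (y - y0) ^ 2 = 2 * lam * (x - x0) + lam ^ 2)
| confocal_parabolas_y (x0 y0 : R) :
    confocal_family (fun lam x y =>
      lam <> 0 /\ (x - x0) ^ 2 = 2 * lam * (y - y0) + lam ^ 2).

(* [lam] gives the conic containing the leaf.  Since its differential cannot
   vanish on [U] by the equation of the conics, it is a first integral. *)
Definition leaves_on_family (U : R * R -> Prop) (th : one_form)
    (E : R -> R -> R -> Prop) : Prop :=
  exists lam : R -> R -> R, smooth U lam /\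
    forall x y, U (x, y) ->
      E (lam x y) x y /\ wedge (function_differential lam) th x y = 0.

Definition confocal_net (U : R * R -> Prop) (th1 th2 : one_form) : Prop :=
  exists E, confocal_family E /\
    leaves_on_family U th1 E /\ leaves_on_family U th2 E.

(* Main.v *)
Require Import Defs.
From Stdlib Require Import Reals Lra Lia.
From Coquelicot Require Import Coquelicot.

(* An Abelian relation is determined by its components [u dx] and [v dy] along the
   coordinate foliations, where [u = u(x)], [v = v(y)]; the components along the
   orthogonal net are the projections of [- u dx - v dy] on the two conormals, and
   they are closed iff [u' - v' = a u + b v] for two functions [a], [b] depending
   on the net.  Hence [(u, v, u')] solves a total linear system and the rank is
   at most 3.

   For a confocal family the two conics through a point have parameters [l1], [l2]
   that are the roots of a quadratic equation; its symmetric functions, e.g.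
   [(A - l1) (A - l2) = (A - B) x^2], yield three Abelian relations, and their
   coefficients as functions of [l] parametrize the conic.

   Conversely, take as coordinates the two lines and a third form for which their
   common point is [0 : 0 : 1].  The basis then has coordinate components
   [(u1, 0)], [(0, v2)], [(u3, v3)], and [u3 / u1], [v3 / v2] are primitives of
   [ka / u1], [ka / v2] for the same constant [ka].  The conic gives a quadratic
   equation for the slopes of the net, whose product is [-1]; this separates the
   variables and forces [1 / u1] and [1 / v2] to be affine.  Substituting these
   in the quadratic equation leaves the equation of the slopes of a confocal net. *)

(** * Partial derivatives and smooth functions *)

(** For central conics two of the relations are logarithmic differentials:
    [(A - l1) (A - l2) = (A - B) (x - x0)^2] gives [dl1 / (A - l1) + dl2 / (A - l2) + 2 dx / (x -
    x0) = 0], likewise with [B], and [l1 + l2] gives the weight 1. The weights [X = 1 / (A - l)],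
    [Y = 1 / (B - l)], [Z = 1] satisfy [(A - B) X Y + X Z - Y Z = 0], a conic through the common
    point [[0 : 0 : 1]] of [X = 0] and [Y = 0]. In the converse, [m = u3 / u1] has derivative
    [ka / u1], and the separated equation [u1^2 (q11 + 2 q13 m) = const] makes the square of this
    derivative affine in [m]: the energy law of uniformly accelerated motion. So [ka / u1] is affine
    in [x]. The domain is an arbitrary connected open set, on which a function with zero
    [y]-derivative need not be a function of [x]. Dependence on [x] alone is therefore always
    expressed by a vanishing partial derivative, and a single Gronwall estimate on [U] carries local
    facts to global ones: it yields both the constancy of functions with zero partials and the bound
    on the rank. *)

Definition Dx (f : R -> R -> R) (x y : R) : R := Derive (fun t => f t y) x.
Definition Dy (f : R -> R -> R) (x y : R) : R := Derive (fun t => f x t) y.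

Lemma open_locally_2d (U : R * R -> Prop) (x y : R) :
  open U -> U (x, y) -> locally_2d (fun u v => U (u, v)) x y.
Proof.
  intros oU Uxy. apply locally_2d_locally.
  generalize (oU _ Uxy). apply filter_imp. now intros [u v].
Qed.

Lemma open_line_x (U : R * R -> Prop) (x y : R) :
  open U -> U (x, y) -> locally x (fun t => U (t, y)).
Proof.
  intros oU Uxy. apply (locally_2d_1d_const_y (fun u v => U (u, v))).
  now apply open_locally_2d.
Qed.

Lemma open_line_y (U : R * R -> Prop) (x y : R) :
  open U -> U (x, y) -> locally y (fun t => U (x, t)).
Proof.
  intros oU Uxy. apply (locally_2d_1d_const_x (fun u v => U (u, v))).
  now apply open_locally_2d.
Qed.

Definition partials (U : R * R -> Prop) (f fx fy : R -> R -> R) : Prop :=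
  forall x y, U (x, y) ->
    is_derive (fun t => f t y) x (fx x y) /\ is_derive (fun t => f x t) y (fy x y).

Lemma partials_const U c :
  partials U (fun _ _ => c) (fun _ _ => 0) (fun _ _ => 0).
Proof. intros x y _; split; apply (is_derive_const (V := R_NormedModule)). Qed.

Lemma partials_fst U : partials U (fun x _ => x) (fun _ _ => 1) (fun _ _ => 0).
Proof.
  intros x y _; split.
  - apply (is_derive_id (K := R_AbsRing)).
  - apply (is_derive_const (V := R_NormedModule)).
Qed.

Lemma partials_snd U : partials U (fun _ y => y) (fun _ _ => 0) (fun _ _ => 1).
Proof.
  intros x y _; split.
  - apply (is_derive_const (V := R_NormedModule)).
  - apply (is_derive_id (K := R_AbsRing)).
Qed.

Lemma partials_plus U f fx fy g gx gy :
  partials U f fx fy -> partials U g gx gy ->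
  partials U (fun x y => f x y + g x y)
    (fun x y => fx x y + gx x y) (fun x y => fy x y + gy x y).
Proof.
  intros Hf Hg x y Uxy; destruct (Hf x y Uxy), (Hg x y Uxy); split;
    now apply (is_derive_plus (V := R_NormedModule)).
Qed.

Lemma partials_opp U f fx fy :
  partials U f fx fy ->
  partials U (fun x y => - f x y) (fun x y => - fx x y) (fun x y => - fy x y).
Proof.
  intros Hf x y Uxy; destruct (Hf x y Uxy); split;
    now apply (is_derive_opp (V := R_NormedModule)).
Qed.

Lemma partials_minus U f fx fy g gx gy :
  partials U f fx fy -> partials U g gx gy ->
  partials U (fun x y => f x y - g x y)
    (fun x y => fx x y - gx x y) (fun x y => fy x y - gy x y).
Proof.
  intros Hf Hg x y Uxy; destruct (Hf x y Uxy), (Hg x y Uxy); split;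
    now apply (is_derive_minus (V := R_NormedModule)).
Qed.

Lemma partials_mult U f fx fy g gx gy :
  partials U f fx fy -> partials U g gx gy ->
  partials U (fun x y => f x y * g x y)
    (fun x y => fx x y * g x y + f x y * gx x y)
    (fun x y => fy x y * g x y + f x y * gy x y).
Proof.
  intros Hf Hg x y Uxy; destruct (Hf x y Uxy), (Hg x y Uxy); split.
  - apply (is_derive_mult (fun t => f t y) (fun t => g t y)); auto.
    intros; apply Rmult_comm.
  - apply (is_derive_mult (fun t => f x t) (fun t => g x t)); auto.
    intros; apply Rmult_comm.
Qed.

Lemma partials_inv U f fx fy :
  (forall x y, U (x, y) -> f x y <> 0) -> partials U f fx fy ->
  partials U (fun x y => / f x y)
    (fun x y => - fx x y / (f x y) ^ 2) (fun x y => - fy x y / (f x y) ^ 2).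
Proof.
  intros H0 Hf x y Uxy; destruct (Hf x y Uxy); split.
  - apply (is_derive_inv (fun t => f t y)); auto.
  - apply (is_derive_inv (fun t => f x t)); auto.
Qed.

Lemma partials_div U f fx fy g gx gy :
  (forall x y, U (x, y) -> g x y <> 0) ->
  partials U f fx fy -> partials U g gx gy ->
  partials U (fun x y => f x y / g x y)
    (fun x y => fx x y * / g x y + f x y * (- gx x y / (g x y) ^ 2))
    (fun x y => fy x y * / g x y + f x y * (- gy x y / (g x y) ^ 2)).
Proof. intros; apply partials_mult; [|apply partials_inv]; assumption. Qed.

Lemma partials_sqr U f fx fy :
  partials U f fx fy ->
  partials U (fun x y => f x y ^ 2)
    (fun x y => 2 * f x y * fx x y) (fun x y => 2 * f x y * fy x y).
Proof.
  intros Hf x y Uxy.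
  destruct (partials_mult _ _ _ _ _ _ _ Hf Hf x y Uxy) as [H1 H2].
  split.
  - replace (2 * _ * _) with (fx x y * f x y + f x y * fx x y) by ring.
    eapply is_derive_ext; [|exact H1]. intros; simpl; ring.
  - replace (2 * _ * _) with (fy x y * f x y + f x y * fy x y) by ring.
    eapply is_derive_ext; [|exact H2]. intros; simpl; ring.
Qed.

Lemma partials_ext_fun U f g fx fy :
  open U -> (forall x y, U (x, y) -> f x y = g x y) ->
  partials U f fx fy -> partials U g fx fy.
Proof.
  intros oU E Hf x y Uxy; destruct (Hf x y Uxy) as [H1 H2]; split.
  - eapply is_derive_ext_loc; [|exact H1].
    generalize (open_line_x U x y oU Uxy). apply filter_imp. intros; now apply E.
  - eapply is_derive_ext_loc; [|exact H2].
    generalize (open_line_y U x y oU Uxy). apply filter_imp. intros; now apply E.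
Qed.

Lemma partials_D U f fx fy x y :
  partials U f fx fy -> U (x, y) -> Dx f x y = fx x y /\ Dy f x y = fy x y.
Proof.
  intros Hf Uxy; destruct (Hf x y Uxy).
  split; now apply is_derive_unique.
Qed.

Lemma Dx_eq U f fx fy x y r :
  partials U f fx fy -> U (x, y) -> fx x y = r -> Dx f x y = r.
Proof. intros Hf Uxy <-. now apply (partials_D U f fx fy). Qed.

Lemma Dy_eq U f fx fy x y r :
  partials U f fx fy -> U (x, y) -> fy x y = r -> Dy f x y = r.
Proof. intros Hf Uxy <-. now apply (partials_D U f fx fy). Qed.

Lemma partials_eq U f g fx fy gx gy x y :
  open U -> (forall x y, U (x, y) -> f x y = g x y) ->
  partials U f fx fy -> partials U g gx gy -> U (x, y) ->
  fx x y = gx x y /\ fy x y = gy x y.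
Proof.
  intros oU E Hf Hg Uxy.
  destruct (partials_D _ _ _ _ x y (partials_ext_fun U f g fx fy oU E Hf) Uxy) as [<- <-].
  now apply partials_D with U.
Qed.

(** Follows the syntax of the function and builds the derivatives in evars; the goals left over are
    the nonvanishing of denominators. *)
Ltac solve_partials :=
  lazymatch goal with
  | |- partials _ (fun x y => @?f x y + @?g x y) _ _ =>
      eapply (partials_plus _ f _ _ g); solve_partials
  | |- partials _ (fun x y => @?f x y - @?g x y) _ _ =>
      eapply (partials_minus _ f _ _ g); solve_partials
  | |- partials _ (fun x y => @?f x y * @?g x y) _ _ =>
      eapply (partials_mult _ f _ _ g); solve_partials
  | |- partials _ (fun x y => @?f x y / @?g x y) _ _ =>
      eapply (partials_div _ f _ _ g); [|solve_partials|solve_partials]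
  | |- partials _ (fun x y => - @?f x y) _ _ =>
      eapply (partials_opp _ f); solve_partials
  | |- partials _ (fun x y => @?f x y ^ 2) _ _ =>
      eapply (partials_sqr _ f); solve_partials
  | |- partials _ (fun x y => / @?f x y) _ _ =>
      eapply (partials_inv _ f); [|solve_partials]
  | |- _ =>
      first [ match goal with
              | H : partials _ ?f _ _ |- partials _ ?f _ _ => exact H
              | H : partials _ ?f _ _ |- partials _ (fun x y => ?f x y) _ _ => exact H
              | |- partials _ (fun _ _ => ?c) _ _ => apply partials_const
              | |- partials _ (fun x _ => x) _ _ => apply partials_fst
              | |- partials _ (fun _ y => y) _ _ => apply partials_snd
              end
            | idtac ]
  end.

(** * Smooth functions: closure properties by induction on the order of differentiability *)

Definition smooth_upto (U : R * R -> Prop) (n : nat) (f : R -> R -> R) : Prop :=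
  forall x y, U (x, y) -> ex_diff_n f n x y.

Lemma smooth_upto_ext U n f g :
  open U -> (forall x y, U (x, y) -> f x y = g x y) ->
  smooth_upto U n f -> smooth_upto U n g.
Proof.
  intros oU E Hf x y Uxy. apply ex_diff_n_ext_loc with f; [|now apply Hf].
  apply locally_2d_impl with (2 := open_locally_2d U x y oU Uxy).
  apply locally_2d_forall. auto.
Qed.

(** The recursive form of [ex_diff_n] over a set, in which the induction step only has to exhibit
    the two partial derivatives. *)
Lemma smooth_upto_S U n f :
  smooth_upto U (S n) f <->
  (forall x y, U (x, y) -> continuity_2d_pt f x y) /\
  partials U f (Dx f) (Dy f) /\ smooth_upto U n (Dx f) /\ smooth_upto U n (Dy f).
Proof.
  split.
  - intros Hf. split; [|split; [|split]]; intros x y Uxy;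
      destruct (Hf x y Uxy) as (H1 & H2 & H3 & H4 & H5); auto.
    split; now apply Derive_correct.
  - intros (H1 & H2 & H3 & H4) x y Uxy. destruct (H2 x y Uxy).
    split; [|split; [|split; [|split]]]; auto; first [now eexists; eassumption | now apply H3 | now apply H4].
Qed.

Lemma smooth_upto_le U n f : smooth_upto U (S n) f -> smooth_upto U n f.
Proof. intros H x y Uxy. apply (ex_diff_n_m (S n)); auto. Qed.

Lemma smooth_upto_of_partials U n f fx fy :
  open U -> (forall x y, U (x, y) -> continuity_2d_pt f x y) ->
  partials U f fx fy -> smooth_upto U n fx -> smooth_upto U n fy ->
  smooth_upto U (S n) f.
Proof.
  intros oU Hc Hp Hx Hy. apply smooth_upto_S.
  assert (E := fun x y => partials_D U f fx fy x y Hp).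
  split; [|split; [|split]]; auto.
  - intros x y Uxy. destruct (E x y Uxy) as [-> ->]. now apply Hp.
  - apply smooth_upto_ext with fx; auto. intros; symmetry; now apply E.
  - apply smooth_upto_ext with fy; auto. intros; symmetry; now apply E.
Qed.

Lemma smooth_upto_const U n c : open U -> smooth_upto U n (fun _ _ => c).
Proof.
  intros oU. revert c. induction n as [|n IH]; intros c.
  - intros x y _. split; auto. apply continuity_2d_pt_const.
  - apply smooth_upto_of_partials with (fun _ _ => 0) (fun _ _ => 0); auto.
    + intros; apply continuity_2d_pt_const.
    + apply partials_const.
Qed.

Lemma smooth_upto_plus U n f g :
  open U -> smooth_upto U n f -> smooth_upto U n g ->
  smooth_upto U n (fun x y => f x y + g x y).
Proof.
  intros oU. revert f g. induction n as [|n IH]; intros f g Hf Hg.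
  - intros x y Uxy. split; auto. apply continuity_2d_pt_plus; now (apply Hf || apply Hg).
  - apply smooth_upto_S in Hf as (cf & pf & xf & yf).
    apply smooth_upto_S in Hg as (cg & pg & xg & yg).
    eapply (smooth_upto_of_partials U n _ _ _ oU).
    + intros; apply continuity_2d_pt_plus; auto.
    + apply partials_plus; eassumption.
    + now apply IH.
    + now apply IH.
Qed.

Lemma smooth_upto_mult U n f g :
  open U -> smooth_upto U n f -> smooth_upto U n g ->
  smooth_upto U n (fun x y => f x y * g x y).
Proof.
  intros oU. revert f g. induction n as [|n IH]; intros f g Hf Hg.
  - intros x y Uxy. split; auto. apply continuity_2d_pt_mult; now (apply Hf || apply Hg).
  - assert (Lf := smooth_upto_le _ _ _ Hf). assert (Lg := smooth_upto_le _ _ _ Hg).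
    apply smooth_upto_S in Hf as (cf & pf & xf & yf).
    apply smooth_upto_S in Hg as (cg & pg & xg & yg).
    eapply (smooth_upto_of_partials U n _ _ _ oU).
    + intros; apply continuity_2d_pt_mult; auto.
    + apply partials_mult; eassumption.
    + apply smooth_upto_plus; auto.
    + apply smooth_upto_plus; auto.
Qed.

Lemma smooth_upto_inv U n f :
  open U -> (forall x y, U (x, y) -> f x y <> 0) ->
  smooth_upto U n f -> smooth_upto U n (fun x y => / f x y).
Proof.
  intros oU H0. induction n as [|n IH]; intros Hf.
  - intros x y Uxy. split; auto. apply continuity_2d_pt_inv; auto. now apply Hf.
  (* The partials of [/ f] contain [/ f] again, but only one order lower is asked of them. *)
  - assert (Li := IH (smooth_upto_le _ _ _ Hf)).
    apply smooth_upto_S in Hf as (cf & pf & xf & yf).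
    eapply (smooth_upto_of_partials U n _ _ _ oU).
    + intros; apply continuity_2d_pt_inv; auto.
    + apply partials_inv; eassumption.
    + apply smooth_upto_ext with (fun x y => (-1 * Dx f x y) * (/ f x y * / f x y)); auto.
      * intros x y Uxy. field. auto.
      * repeat apply smooth_upto_mult; auto. now apply smooth_upto_const.
    + apply smooth_upto_ext with (fun x y => (-1 * Dy f x y) * (/ f x y * / f x y)); auto.
      * intros x y Uxy. field. auto.
      * repeat apply smooth_upto_mult; auto. now apply smooth_upto_const.
Qed.

Lemma smooth_all U f : smooth U f <-> forall n, smooth_upto U n f.
Proof. split; intros H; [intros n x y Uxy|intros x y Uxy n]; now apply H. Qed.

Lemma smooth_ext U f g :
  open U -> (forall x y, U (x, y) -> f x y = g x y) -> smooth U f -> smooth U g.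
Proof.
  rewrite !smooth_all. intros oU E H n. now apply smooth_upto_ext with f.
Qed.

Lemma smooth_const U c : open U -> smooth U (fun _ _ => c).
Proof. rewrite smooth_all. intros. now apply smooth_upto_const. Qed.

Lemma smooth_fst U : open U -> smooth U (fun x _ => x).
Proof.
  rewrite smooth_all. intros oU [|n].
  - intros x y _; split; auto. apply continuity_2d_pt_id1.
  - apply (smooth_upto_of_partials U n _ _ _ oU) with (2 := partials_fst U);
      auto using smooth_upto_const, continuity_2d_pt_id1.
Qed.

Lemma smooth_snd U : open U -> smooth U (fun _ y => y).
Proof.
  rewrite smooth_all. intros oU [|n].
  - intros x y _; split; auto. apply continuity_2d_pt_id2.
  - apply (smooth_upto_of_partials U n _ _ _ oU) with (2 := partials_snd U);
      auto using smooth_upto_const, continuity_2d_pt_id2.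
Qed.

Lemma smooth_plus U f g :
  open U -> smooth U f -> smooth U g -> smooth U (fun x y => f x y + g x y).
Proof. rewrite !smooth_all. intros. now apply smooth_upto_plus. Qed.

Lemma smooth_mult U f g :
  open U -> smooth U f -> smooth U g -> smooth U (fun x y => f x y * g x y).
Proof. rewrite !smooth_all. intros. now apply smooth_upto_mult. Qed.

Lemma smooth_opp U f : open U -> smooth U f -> smooth U (fun x y => - f x y).
Proof.
  intros. apply smooth_ext with (fun x y => -1 * f x y); auto.
  - intros; ring.
  - apply smooth_mult; auto using smooth_const.
Qed.

Lemma smooth_minus U f g :
  open U -> smooth U f -> smooth U g -> smooth U (fun x y => f x y - g x y).
Proof. intros. apply smooth_plus; auto using smooth_opp. Qed.

Lemma smooth_inv U f :
  open U -> (forall x y, U (x, y) -> f x y <> 0) ->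
  smooth U f -> smooth U (fun x y => / f x y).
Proof. rewrite !smooth_all. intros. now apply smooth_upto_inv. Qed.

Lemma smooth_div U f g :
  open U -> (forall x y, U (x, y) -> g x y <> 0) ->
  smooth U f -> smooth U g -> smooth U (fun x y => f x y / g x y).
Proof. intros. apply smooth_mult; auto using smooth_inv. Qed.

Lemma smooth_sqr U f : open U -> smooth U f -> smooth U (fun x y => f x y ^ 2).
Proof.
  intros. apply smooth_ext with (fun x y => f x y * f x y); auto.
  - intros; ring.
  - now apply smooth_mult.
Qed.

Lemma smooth_Dx U f : smooth U f -> smooth U (Dx f).
Proof.
  rewrite !smooth_all. intros H n. now apply (smooth_upto_S U n f).
Qed.

Lemma smooth_Dy U f : smooth U f -> smooth U (Dy f).
Proof.
  rewrite !smooth_all. intros H n. now apply (smooth_upto_S U n f).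
Qed.

Lemma smooth_partials U f : smooth U f -> partials U f (Dx f) (Dy f).
Proof. rewrite smooth_all. intros H. now apply (smooth_upto_S U 0 f). Qed.

Lemma smooth_continuous U f x y : smooth U f -> U (x, y) -> continuity_2d_pt f x y.
Proof. intros H Uxy. apply (H x y Uxy 0%nat). Qed.

Ltac solve_smooth :=
  lazymatch goal with
  | |- smooth _ (fun x y => @?f x y + @?g x y) =>
      apply (smooth_plus _ f g); [assumption|solve_smooth|solve_smooth]
  | |- smooth _ (fun x y => @?f x y - @?g x y) =>
      apply (smooth_minus _ f g); [assumption|solve_smooth|solve_smooth]
  | |- smooth _ (fun x y => @?f x y * @?g x y) =>
      apply (smooth_mult _ f g); [assumption|solve_smooth|solve_smooth]
  | |- smooth _ (fun x y => @?f x y / @?g x y) =>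
      apply (smooth_div _ f g); [assumption| |solve_smooth|solve_smooth]
  | |- smooth _ (fun x y => - @?f x y) =>
      apply (smooth_opp _ f); [assumption|solve_smooth]
  | |- smooth _ (fun x y => @?f x y ^ 2) =>
      apply (smooth_sqr _ f); [assumption|solve_smooth]
  | |- smooth _ (fun x y => / @?f x y) =>
      apply (smooth_inv _ f); [assumption| |solve_smooth]
  | |- _ =>
      first [ apply smooth_const; assumption | apply smooth_fst; assumption
            | apply smooth_snd; assumption | assumption
            | apply smooth_Dx; assumption | apply smooth_Dy; assumption | idtac ]
  end.

Lemma mixed_partials U f x y :
  open U -> smooth U f -> U (x, y) -> Dy (Dx f) x y = Dx (Dy f) x y.
Proof.
  intros oU Hf Uxy. symmetry. apply (Schwarz f x y).
  - apply locally_2d_impl with (2 := open_locally_2d U x y oU Uxy).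
    apply locally_2d_forall. intros u v Uuv.
    destruct (smooth_partials U f Hf u v Uuv).
    destruct (smooth_partials U _ (smooth_Dx U f Hf) u v Uuv).
    destruct (smooth_partials U _ (smooth_Dy U f Hf) u v Uuv).
    split; [|split; [|split]]; eexists; eassumption.
  - apply (smooth_continuous U (Dx (Dy f))); auto. now apply smooth_Dx, smooth_Dy.
  - apply (smooth_continuous U (Dy (Dx f))); auto. now apply smooth_Dy, smooth_Dx.
Qed.

(** * Vanishing and constancy on connected domains *)

(** With [s] the direction of travel from [c] to [d], the product of [g] and [exp (- s K t)] does
    not increase along the way, so the mean value theorem gives [g d <= 0]. *)
Lemma gronwall_segment (g dg : R -> R) (K c d : R) :
  (forall t, Rmin c d <= t <= Rmax c d ->
     is_derive g t (dg t) /\ 0 <= g t /\ Rabs (dg t) <= K * g t) ->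
  g c = 0 -> g d = 0.
Proof.
  intros H gc.
  set (s := if Rle_dec c d then 1 else -1).
  assert (Hs : Rabs (d - c) = s * (d - c)).
  { unfold s; destruct (Rle_dec c d); [rewrite Rabs_right|rewrite Rabs_left]; lra. }
  set (dh := fun t => (dg t - s * K * g t) * exp (- (s * K) * t)).
  assert (Hh : forall t, Rmin c d <= t <= Rmax c d ->
             is_derive (fun t => g t * exp (- (s * K) * t)) t (dh t)).
  { intros t Ht. destruct (H t Ht) as [D _].
    replace (dh t) with
      (dg t * exp (- (s * K) * t) + g t * (- (s * K) * exp (- (s * K) * t)))
      by (unfold dh; ring).
    apply (is_derive_mult g (fun t => exp (- (s * K) * t))); auto.
    - auto_derive; [exact I|ring].
    - intros; apply Rmult_comm. }
  destruct (MVT_gen (fun t => g t * exp (- (s * K) * t)) c d dh) as (xi & Hxi & E).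
  - intros t Ht. apply Hh. lra.
  - intros t Ht. apply continuity_pt_filterlim.
    apply (ex_derive_continuous (V := R_NormedModule) (fun t => g t * exp (- (s * K) * t))).
    eexists; now apply Hh.
  - destruct (H xi Hxi) as (_ & H0 & H1).
    assert (Hd : Rmin c d <= d <= Rmax c d) by (split; [apply Rmin_r|apply Rmax_r]).
    destruct (H d Hd) as (_ & H2 & _).
    rewrite gc in E. unfold dh in E.
    assert (dg xi * (d - c) <= s * K * g xi * (d - c)).
    { apply Rle_trans with (1 := Rle_abs _). rewrite Rabs_mult, Hs.
      replace (s * K * g xi * (d - c)) with (K * g xi * (s * (d - c))) by ring.
      apply Rmult_le_compat_r; auto. rewrite <- Hs. apply Rabs_pos. }
    assert (P := exp_pos (- (s * K) * xi)). assert (Q := exp_pos (- (s * K) * d)).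
    assert (g d * exp (- (s * K) * d) <= 0) by nra.
    nra.
Qed.

(** A property whose truth value is locally constant cuts [U] into two disjoint open parts;
    connectedness forbids that both are inhabited. *)
Lemma connected_induction (U : R * R -> Prop) (P : R -> R -> Prop) (x0 y0 : R) :
  plane_domain U -> U (x0, y0) -> P x0 y0 ->
  (forall x y, U (x, y) ->
     locally_2d (fun u v => U (u, v) -> (P u v <-> P x y)) x y) ->
  forall x y, U (x, y) -> P x y.
Proof.
  intros (oU & _ & cU) U0 P0 Hloc x y Uxy.
  destruct (Classical_Prop.classic (P x y)) as [|NP]; auto. exfalso.
  (* [Q := True] gives the part where [P] holds, [Q := False] the part where it fails. *)
  assert (HO : forall Q : Prop,
             open (fun p => U p /\ (P (fst p) (snd p) <-> Q))).
  { intros Q [u v] [Uuv HQ]. simpl in HQ.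
    assert (L := locally_2d_and _ _ _ _ (open_locally_2d U u v oU Uuv) (Hloc u v Uuv)).
    apply locally_2d_locally in L. revert L. apply filter_imp.
    intros [a b]; simpl. tauto. }
  destruct (cU (fun p => U p /\ (P (fst p) (snd p) <-> True))
               (fun p => U p /\ (P (fst p) (snd p) <-> False))) as ([a b] & _ & [_ H1] & [_ H2]).
  - apply HO.
  - apply HO.
  - intros p Up. destruct (Classical_Prop.classic (P (fst p) (snd p))); tauto.
  - exists (x0, y0); simpl; tauto.
  - exists (x, y); simpl; tauto.
  - simpl in *; tauto.
Qed.

Lemma between_close (a c d t e : R) :
  Rmin c d <= t <= Rmax c d -> Rabs (c - a) < e -> Rabs (d - a) < e -> Rabs (t - a) < e.
Proof.
  intros H Hc Hd. apply Rabs_def2 in Hc, Hd.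
  destruct (Rle_dec c d).
  - rewrite Rmin_left, Rmax_right in H by lra. apply Rabs_def1; lra.
  - rewrite Rmin_right, Rmax_left in H by lra. apply Rabs_def1; lra.
Qed.

(** The bound is only local, so the estimate on segments shows that the vanishing of [E] is a
    locally constant property, and connectedness does the rest. *)
Lemma gronwall_domain (U : R * R -> Prop) (E Ex Ey : R -> R -> R) (x0 y0 : R) :
  plane_domain U -> partials U E Ex Ey ->
  (forall x y, U (x, y) -> 0 <= E x y) ->
  (forall x y, U (x, y) -> exists K, locally_2d (fun u v =>
     Rabs (Ex u v) <= K * E u v /\ Rabs (Ey u v) <= K * E u v) x y) ->
  U (x0, y0) -> E x0 y0 = 0 -> forall x y, U (x, y) -> E x y = 0.
Proof.
  intros HU HE H0 HK U0 E0.
  apply (connected_induction U (fun x y => E x y = 0) x0 y0 HU U0 E0).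
  intros a b Uab. destruct (HK a b Uab) as [K L].
  destruct (locally_2d_and _ _ _ _ L (open_locally_2d U a b (proj1 HU) Uab)) as [e He].
  (* Two points of the box are joined inside it by a horizontal and a vertical segment. *)
  assert (box : forall x y x' y',
             Rabs (x - a) < e -> Rabs (y - b) < e -> Rabs (x' - a) < e ->
             Rabs (y' - b) < e -> E x y = 0 -> E x' y' = 0).
  { intros x y x' y' Hx Hy Hx' Hy' Exy.
    assert (E x' y = 0).
    { apply (gronwall_segment (fun t => E t y) (fun t => Ex t y) K x x'); auto.
      intros t Ht. assert (Rabs (t - a) < e) by (eapply between_close; eauto).
      destruct (He t y) as [[B _] Ut]; auto.
      split; [|split]; auto. now apply HE. }
    apply (gronwall_segment (fun t => E x' t) (fun t => Ey x' t) K y y'); auto.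
    intros t Ht. assert (Rabs (t - b) < e) by (eapply between_close; eauto).
    destruct (He x' t) as [[_ B] Ut]; auto.
    split; [|split]; auto. now apply HE. }
  exists e. intros u v Hu Hv _.
  assert (Ca : Rabs (a - a) < e) by (rewrite Rminus_diag, Rabs_R0; apply cond_pos).
  assert (Cb : Rabs (b - b) < e) by (rewrite Rminus_diag, Rabs_R0; apply cond_pos).
  split; intros; eapply box; eauto.
Qed.

(** Gronwall with [K = 0], applied to the square of [f - f x0 y0] because the estimate needs a
    nonnegative function. *)
Lemma constant_of_zero_partials (U : R * R -> Prop) (f fx fy : R -> R -> R) :
  plane_domain U -> partials U f fx fy ->
  (forall x y, U (x, y) -> fx x y = 0 /\ fy x y = 0) ->
  exists c, forall x y, U (x, y) -> f x y = c.
Proof.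
  intros HU Hf Z. destruct (proj1 (proj2 HU)) as [[x0 y0] U0].
  exists (f x0 y0). intros x y Uxy.
  assert (P : partials U (fun x y => (f x y - f x0 y0) ^ 2)
            (fun x y => 2 * (f x y - f x0 y0) * (fx x y - 0))
            (fun x y => 2 * (f x y - f x0 y0) * (fy x y - 0))).
  { solve_partials. }
  assert ((f x y - f x0 y0) ^ 2 = 0); [|nra].
  refine (gronwall_domain U _ _ _ x0 y0 HU P _ _ U0 _ x y Uxy).
  - intros; apply pow2_ge_0.
  - intros a b Uab. exists 0.
    apply locally_2d_impl with (2 := open_locally_2d U a b (proj1 HU) Uab).
    apply locally_2d_forall. intros u v Uuv. destruct (Z u v Uuv) as [-> ->].
    rewrite Rminus_0_r, Rmult_0_r, Rabs_R0; lra.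
  - ring.
Qed.

Lemma smooth_locally_bounded (U : R * R -> Prop) (f : R -> R -> R) (x y : R) :
  smooth U f -> U (x, y) ->
  exists M, 0 <= M /\ locally_2d (fun u v => Rabs (f u v) <= M) x y.
Proof.
  intros Hf Uxy. exists (Rabs (f x y) + 1). split.
  - generalize (Rabs_pos (f x y)); lra.
  - destruct (smooth_continuous U f x y Hf Uxy (mkposreal 1 Rlt_0_1)) as [d Hd].
    exists d. intros u v Hu Hv. specialize (Hd u v Hu Hv). simpl in Hd.
    generalize (Rabs_triang (f u v - f x y) (f x y)).
    replace (f u v - f x y + f x y) with (f u v) by ring. lra.
Qed.

(** * Reduction of Abelian relations *)

Definition det3 (a1 a2 a3 b1 b2 b3 c1 c2 c3 : R) : R :=
  a1 * (b2 * c3 - b3 * c2) - a2 * (b1 * c3 - b3 * c1) + a3 * (b1 * c2 - b2 * c1).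

Lemma det3_solve a1 a2 a3 b1 b2 b3 c1 c2 c3 r1 r2 r3 :
  det3 a1 a2 a3 b1 b2 b3 c1 c2 c3 <> 0 ->
  exists x1 x2 x3,
    a1 * x1 + a2 * x2 + a3 * x3 = r1 /\
    b1 * x1 + b2 * x2 + b3 * x3 = r2 /\
    c1 * x1 + c2 * x2 + c3 * x3 = r3.
Proof.
  intros H.
  exists (det3 r1 a2 a3 r2 b2 b3 r3 c2 c3 / det3 a1 a2 a3 b1 b2 b3 c1 c2 c3),
    (det3 a1 r1 a3 b1 r2 b3 c1 r3 c3 / det3 a1 a2 a3 b1 b2 b3 c1 c2 c3),
    (det3 a1 a2 r1 b1 b2 r2 c1 c2 r3 / det3 a1 a2 a3 b1 b2 b3 c1 c2 c3).
  unfold det3 in *. repeat split; field; exact H.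
Qed.

Lemma det3_unique a1 a2 a3 b1 b2 b3 c1 c2 c3 x1 x2 x3 :
  det3 a1 a2 a3 b1 b2 b3 c1 c2 c3 <> 0 ->
  a1 * x1 + a2 * x2 + a3 * x3 = 0 ->
  b1 * x1 + b2 * x2 + b3 * x3 = 0 ->
  c1 * x1 + c2 * x2 + c3 * x3 = 0 -> x1 = 0 /\ x2 = 0 /\ x3 = 0.
Proof.
  intros H E1 E2 E3. set (d := det3 a1 a2 a3 b1 b2 b3 c1 c2 c3) in H.
  assert (d * x1 = 0 /\ d * x2 = 0 /\ d * x3 = 0) as (H1 & H2 & H3).
  { unfold d, det3. split; [|split].
    - transitivity ((a1 * x1 + a2 * x2 + a3 * x3) * (b2 * c3 - b3 * c2)
        - (b1 * x1 + b2 * x2 + b3 * x3) * (a2 * c3 - a3 * c2)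
        + (c1 * x1 + c2 * x2 + c3 * x3) * (a2 * b3 - a3 * b2)); [ring|].
      rewrite E1, E2, E3; ring.
    - transitivity (- (a1 * x1 + a2 * x2 + a3 * x3) * (b1 * c3 - b3 * c1)
        + (b1 * x1 + b2 * x2 + b3 * x3) * (a1 * c3 - a3 * c1)
        - (c1 * x1 + c2 * x2 + c3 * x3) * (a1 * b3 - a3 * b1)); [ring|].
      rewrite E1, E2, E3; ring.
    - transitivity ((a1 * x1 + a2 * x2 + a3 * x3) * (b1 * c2 - b2 * c1)
        - (b1 * x1 + b2 * x2 + b3 * x3) * (a1 * c2 - a2 * c1)
        + (c1 * x1 + c2 * x2 + c3 * x3) * (a1 * b2 - a2 * b1)); [ring|].
      rewrite E1, E2, E3; ring. }
  apply Rmult_integral in H1, H2, H3. tauto.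
Qed.

(** Transversality to the coordinate lines means that no component of a conormal vanishes. This is
    the form in which the net and web hypotheses enter all later arguments. *)
Record oblique_net (U : R * R -> Prop) (th1 th2 : one_form) : Prop := {
  oblique_open : open U;
  oblique_smooth1 : smooth_form U th1;
  oblique_smooth2 : smooth_form U th2;
  oblique_nonzero : forall x y, U (x, y) ->
    cdx th1 x y <> 0 /\ cdy th1 x y <> 0 /\ cdx th2 x y <> 0 /\ cdy th2 x y <> 0;
  oblique_orthogonal : forall x y, U (x, y) ->
    cdx th1 x y * cdx th2 x y + cdy th1 x y * cdy th2 x y = 0 }.

Lemma oblique_of_web U th1 th2 :
  plane_domain U -> orthogonal_net U th1 th2 ->
  is_web U 4 (net_with_coordinate_lines th1 th2) -> oblique_net U th1 th2.
Proof.
  intros [oU _] [[[S1 _] [[S2 _] _]] O] [_ T]. constructor; auto.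
  intros x y Uxy.
  assert (T02 := T 0%nat 2%nat ltac:(lia) ltac:(lia) x y Uxy).
  assert (T03 := T 0%nat 3%nat ltac:(lia) ltac:(lia) x y Uxy).
  assert (T12 := T 1%nat 2%nat ltac:(lia) ltac:(lia) x y Uxy).
  assert (T13 := T 1%nat 3%nat ltac:(lia) ltac:(lia) x y Uxy).
  unfold wedge in *; simpl in *.
  repeat split; intros E; rewrite E in *; lra.
Qed.

Definition conormal_sq (th : one_form) (x y : R) : R := cdx th x y ^ 2 + cdy th x y ^ 2.

Lemma conormal_sq_neq_0 U th1 th2 x y :
  oblique_net U th1 th2 -> U (x, y) -> conormal_sq th1 x y <> 0.
Proof.
  intros H Uxy. destruct (oblique_nonzero _ _ _ H x y Uxy) as (H1 & _).
  unfold conormal_sq. assert (0 < cdx th1 x y ^ 2) by (apply pow2_gt_0; auto).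
  assert (0 <= cdy th1 x y ^ 2) by apply pow2_ge_0. lra.
Qed.

Lemma relation_components U th1 th2 w x y :
  oblique_net U th1 th2 ->
  abelian_relation U 4 (net_with_coordinate_lines th1 th2) w -> U (x, y) ->
  let A := cdx th1 x y in let B := cdy th1 x y in
  let u := cdx (w 2%nat) x y in let v := cdy (w 3%nat) x y in
  cdy (w 2%nat) x y = 0 /\ cdx (w 3%nat) x y = 0 /\
  cdx (w 0%nat) x y = - A * (u * A + v * B) / conormal_sq th1 x y /\
  cdy (w 0%nat) x y = - B * (u * A + v * B) / conormal_sq th1 x y /\
  cdx (w 1%nat) x y = - B * (u * B - v * A) / conormal_sq th1 x y /\
  cdy (w 1%nat) x y = A * (u * B - v * A) / conormal_sq th1 x y.
Proof.
  intros H [Hw Hs] Uxy A B u v.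
  assert (N := conormal_sq_neq_0 U th1 th2 x y H Uxy).
  destruct (oblique_nonzero _ _ _ H x y Uxy) as (HA & HB & HC & HD).
  assert (O := oblique_orthogonal _ _ _ H x y Uxy).
  destruct (Hs x y Uxy) as [Sx Sy].
  destruct (Hw 0%nat ltac:(lia)) as (_ & W0 & _). specialize (W0 x y Uxy).
  destruct (Hw 1%nat ltac:(lia)) as (_ & W1 & _). specialize (W1 x y Uxy).
  destruct (Hw 2%nat ltac:(lia)) as (_ & W2 & _). specialize (W2 x y Uxy).
  destruct (Hw 3%nat ltac:(lia)) as (_ & W3 & _). specialize (W3 x y Uxy).
  unfold Rsum, wedge in *; simpl in *.
  fold A B u v in Sx, Sy, W0, O, HA, HB |- *.
  set (C := cdx th2 x y) in *. set (D := cdy th2 x y) in *.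
  assert (E2 : cdy (w 2%nat) x y = 0) by lra.
  assert (E3 : cdx (w 3%nat) x y = 0) by lra.
  rewrite E2, E3 in *. clear W2 W3.
  set (p := cdx (w 0%nat) x y) in *. set (q := cdy (w 0%nat) x y) in *.
  set (r := cdx (w 1%nat) x y) in *. set (s := cdy (w 1%nat) x y) in *.
  (* The second component is a multiple of the second conormal, hence orthogonal to [(A, B)]; the
     factor [C] can be cancelled. *)
  assert (Or : r * A + s * B = 0).
  { assert ((r * A + s * B) * C = 0).
    { transitivity (B * - (r * D - s * C) + r * (A * C + B * D)); [ring|].
      rewrite O. rewrite W1. ring. }
    apply Rmult_integral in H0. tauto. }
  assert (Ep : p * A + q * B = - (u * A + v * B)).
  { assert (p = - r - u) by lra. assert (q = - s - v) by lra. subst.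
    rewrite H0, H1. lra. }
  (* The vector [(p, q)] is recovered from its scalar and cross products with [(A, B)]. *)
  assert (Np : p * conormal_sq th1 x y = - A * (u * A + v * B)).
  { transitivity (A * (p * A + q * B) + B * (p * B - q * A)).
    - unfold conormal_sq. fold A B. ring.
    - rewrite Ep, W0. ring. }
  assert (Nq : q * conormal_sq th1 x y = - B * (u * A + v * B)).
  { transitivity (B * (p * A + q * B) - A * (p * B - q * A)).
    - unfold conormal_sq. fold A B. ring.
    - rewrite Ep, W0. ring. }
  assert (Zp : p = - A * (u * A + v * B) / conormal_sq th1 x y) by (rewrite <- Np; field; auto).
  assert (Zq : q = - B * (u * A + v * B) / conormal_sq th1 x y) by (rewrite <- Nq; field; auto).
  repeat split; auto.
  - replace r with (- u - p) by lra. rewrite Zp.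
    revert N; unfold conormal_sq; fold A B; intros; field; auto.
  - replace s with (- v - q) by lra. rewrite Zq.
    revert N; unfold conormal_sq; fold A B; intros; field; auto.
Qed.

(* [u] and [v] are the components of an Abelian relation along the coordinate
   foliations; the equation says that its component along the first foliation of
   the net is closed. *)
Definition reduced_relation (U : R * R -> Prop) (a b u v : R -> R -> R) : Prop :=
  smooth U u /\ smooth U v /\
  forall x y, U (x, y) ->
    Dy u x y = 0 /\ Dx v x y = 0 /\
    Dx u x y - Dy v x y = a x y * u x y + b x y * v x y.

(** With [P = A^2 / N], [S = A B / N] and [1 - P = B^2 / N], the component along the first foliation
    is [- (u P + v S) dx - (u S + v (1 - P)) dy]. As [u_y = v_x = 0], its closedness reads [(u_x -
    v_y) S = (P_y - S_x) u + (S_y + P_x) v], and [S] has no zeros because the net is oblique. *)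
Lemma reduced_relation_of_abelian U th1 th2 :
  oblique_net U th1 th2 ->
  exists a b, smooth U a /\ smooth U b /\
    forall w, abelian_relation U 4 (net_with_coordinate_lines th1 th2) w ->
      reduced_relation U a b (cdx (w 2%nat)) (cdy (w 3%nat)).
Proof.
  intros H. assert (oU := oblique_open _ _ _ H).
  assert (N := fun x y => conormal_sq_neq_0 U th1 th2 x y H).
  assert (NZ := oblique_nonzero _ _ _ H).
  destruct (oblique_smooth1 _ _ _ H) as [SA SB].
  set (A := cdx th1) in *. set (B := cdy th1) in *.
  set (P := fun x y => A x y ^ 2 / conormal_sq th1 x y).
  set (S := fun x y => A x y * B x y / conormal_sq th1 x y).
  assert (SN : smooth U (conormal_sq th1)).
  { unfold conormal_sq. fold A B. change (smooth U (fun x y => A x y ^ 2 + B x y ^ 2)).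
    solve_smooth. }
  assert (SP : smooth U P) by (unfold P; solve_smooth; auto).
  assert (SS : smooth U S) by (unfold S; solve_smooth; auto).
  assert (S0 : forall x y, U (x, y) -> S x y <> 0).
  { intros x y Uxy. destruct (NZ x y Uxy) as (? & ? & _). unfold S, Rdiv.
    repeat apply Rmult_integral_contrapositive_currified; auto using Rinv_neq_0_compat. }
  exists (fun x y => (Dy P x y - Dx S x y) / S x y),
    (fun x y => (Dy S x y + Dx P x y) / S x y).
  split; [|split].
  - solve_smooth; auto.
  - solve_smooth; auto.
  - intros w Hw.
    assert (RC := fun x y => relation_components U th1 th2 w x y H Hw).
    destruct Hw as [Hw _].
    destruct (Hw 2%nat ltac:(lia)) as ((Su & _) & _ & C2).
    destruct (Hw 3%nat ltac:(lia)) as ((_ & Sv) & _ & C3).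
    destruct (Hw 0%nat ltac:(lia)) as ((Sp & Sq) & _ & C0).
    set (u := cdx (w 2%nat)) in *. set (v := cdy (w 3%nat)) in *.
    assert (Uy : forall x y, U (x, y) -> Dy u x y = 0).
    { intros x y Uxy. etransitivity; [exact (C2 x y Uxy)|].
      refine (proj1 (partials_D U (cdy (w 2%nat)) (fun _ _ => 0) (fun _ _ => 0) x y _ Uxy)).
      apply partials_ext_fun with (fun _ _ => 0); auto using partials_const.
      intros; symmetry; now apply RC. }
    assert (Vx : forall x y, U (x, y) -> Dx v x y = 0).
    { intros x y Uxy. etransitivity; [symmetry; exact (C3 x y Uxy)|].
      refine (proj2 (partials_D U (cdx (w 3%nat)) (fun _ _ => 0) (fun _ _ => 0) x y _ Uxy)).
      apply partials_ext_fun with (fun _ _ => 0); auto using partials_const.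
      intros; symmetry; now apply RC. }
    split; [|split]; auto. intros x y Uxy. split; [|split]; auto.
    assert (E := C0 x y Uxy). change (Dy (cdx (w 0%nat)) x y = Dx (cdy (w 0%nat)) x y) in E.
    assert (PP := smooth_partials _ _ SP). assert (PS := smooth_partials _ _ SS).
    assert (Pu := smooth_partials _ _ Su). assert (Pv := smooth_partials _ _ Sv).
    assert (P1 : partials U (fun x y => - (u x y * P x y + v x y * S x y))
      (fun x y => - ((Dx u x y * P x y + u x y * Dx P x y) + (Dx v x y * S x y + v x y * Dx S x y)))
      (fun x y => - ((Dy u x y * P x y + u x y * Dy P x y) + (Dy v x y * S x y + v x y * Dy S x y))))
      by solve_partials.
    assert (P2 : partials U (fun x y => - (u x y * S x y + v x y * (1 - P x y)))
      (fun x y => - ((Dx u x y * S x y + u x y * Dx S x y)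
                     + (Dx v x y * (1 - P x y) + v x y * (0 - Dx P x y))))
      (fun x y => - ((Dy u x y * S x y + u x y * Dy S x y)
                     + (Dy v x y * (1 - P x y) + v x y * (0 - Dy P x y)))))
      by solve_partials.
    apply partials_ext_fun with (g := cdx (w 0%nat)) in P1; auto.
    2:{ intros s t Ust. destruct (RC s t Ust) as (_ & _ & E1 & _). rewrite E1.
        generalize (N s t Ust). unfold P, S. intros. fold A B u v. field. auto. }
    apply partials_ext_fun with (g := cdy (w 0%nat)) in P2; auto.
    2:{ intros s t Ust. destruct (RC s t Ust) as (_ & _ & _ & E1 & _). rewrite E1.
        generalize (N s t Ust). unfold P, S, conormal_sq. fold A B u v.
        intros. field. auto. }
    destruct (partials_D _ _ _ _ x y P1 Uxy) as [_ E1].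
    destruct (partials_D _ _ _ _ x y P2 Uxy) as [E2 _].
    rewrite E1, E2, (Uy x y Uxy), (Vx x y Uxy) in E.
    apply Rmult_eq_reg_r with (S x y); auto.
    transitivity (Dx u x y * S x y - Dy v x y * S x y); [ring|].
    transitivity ((Dy P x y - Dx S x y) * u x y + (Dy S x y + Dx P x y) * v x y); [lra|].
    field. auto.
Qed.

Lemma reduced_relation_comb U a b u v u' v' c d :
  open U -> reduced_relation U a b u v -> reduced_relation U a b u' v' ->
  reduced_relation U a b (fun x y => c * u x y + d * u' x y)
    (fun x y => c * v x y + d * v' x y).
Proof.
  intros oU (Su & Sv & H) (Su' & Sv' & H').
  split; [|split]; [solve_smooth|solve_smooth|].
  intros x y Uxy. destruct (H x y Uxy) as (H1 & H2 & H3), (H' x y Uxy) as (H1' & H2' & H3').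
  assert (Pu := smooth_partials _ _ Su). assert (Pv := smooth_partials _ _ Sv).
  assert (Pu' := smooth_partials _ _ Su'). assert (Pv' := smooth_partials _ _ Sv').
  assert (Q1 : partials U (fun x y => c * u x y + d * u' x y)
    (fun x y => (0 * u x y + c * Dx u x y) + (0 * u' x y + d * Dx u' x y))
    (fun x y => (0 * u x y + c * Dy u x y) + (0 * u' x y + d * Dy u' x y))) by solve_partials.
  assert (Q2 : partials U (fun x y => c * v x y + d * v' x y)
    (fun x y => (0 * v x y + c * Dx v x y) + (0 * v' x y + d * Dx v' x y))
    (fun x y => (0 * v x y + c * Dy v x y) + (0 * v' x y + d * Dy v' x y))) by solve_partials.
  destruct (partials_D _ _ _ _ x y Q1 Uxy) as [-> ->].
  destruct (partials_D _ _ _ _ x y Q2 Uxy) as [-> ->].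
  rewrite H1, H2, H1', H2'. repeat split; try ring.
  transitivity (c * (Dx u x y - Dy v x y) + d * (Dx u' x y - Dy v' x y)); [ring|].
  rewrite H3, H3'. ring.
Qed.

(* [(u, v, u_x)] solves a total linear first-order system, so it vanishes
   identically as soon as it vanishes at one point; this bounds the rank by 3. *)
Lemma reduced_relation_zero U a b u v x0 y0 :
  plane_domain U -> smooth U a -> smooth U b -> reduced_relation U a b u v ->
  U (x0, y0) -> u x0 y0 = 0 -> v x0 y0 = 0 -> Dx u x0 y0 = 0 ->
  forall x y, U (x, y) -> u x y = 0 /\ v x y = 0.
Proof.
  intros HU Sa Sb (Su & Sv & H) U0 Hu0 Hv0 Hux0.
  assert (oU := proj1 HU).
  assert (Pu := smooth_partials _ _ Su). assert (Pv := smooth_partials _ _ Sv).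
  assert (Pux := smooth_partials _ _ (smooth_Dx _ _ Su)).
  assert (Pvy := smooth_partials _ _ (smooth_Dy _ _ Sv)).
  assert (Pa := smooth_partials _ _ Sa). assert (Pb := smooth_partials _ _ Sb).
  assert (Uyx : forall x y, U (x, y) -> Dy (Dx u) x y = 0).
  { intros x y Uxy. rewrite (mixed_partials U u); auto.
    refine (proj1 (partials_D U _ (fun _ _ => 0) (fun _ _ => 0) x y _ Uxy)).
    apply partials_ext_fun with (fun _ _ => 0); auto using partials_const.
    intros; symmetry; now apply H. }
  assert (Vxy : forall x y, U (x, y) -> Dx (Dy v) x y = 0).
  { intros x y Uxy. rewrite <- (mixed_partials U v); auto.
    refine (proj2 (partials_D U _ (fun _ _ => 0) (fun _ _ => 0) x y _ Uxy)).
    apply partials_ext_fun with (fun _ _ => 0); auto using partials_const.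
    intros; symmetry; now apply H. }
  (* Differentiating the relation in [x] kills [v_y] and the derivative of [v], so [u_xx] is again
     linear in [u], [v], [u_x] and the system closes up. *)
  assert (Uxx : forall x y, U (x, y) ->
    Dx (Dx u) x y = Dx a x y * u x y + a x y * Dx u x y + Dx b x y * v x y).
  { intros x y Uxy.
    assert (Q : partials U (fun x y => a x y * u x y + b x y * v x y + Dy v x y)
      (fun x y => ((Dx a x y * u x y + a x y * Dx u x y) + (Dx b x y * v x y + b x y * Dx v x y))
         + Dx (Dy v) x y)
      (fun x y => ((Dy a x y * u x y + a x y * Dy u x y) + (Dy b x y * v x y + b x y * Dy v x y))
         + Dy (Dy v) x y)) by solve_partials.
    apply partials_ext_fun with (g := Dx u) in Q; auto.
    2:{ intros s t Ust. destruct (H s t Ust) as (_ & _ & E). lra. }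
    destruct (partials_D _ _ _ _ x y Q Uxy) as [E _]. rewrite E, (Vxy x y Uxy).
    destruct (H x y Uxy) as (_ & -> & _). ring. }
  set (E := fun x y => u x y ^ 2 + v x y ^ 2 + Dx u x y ^ 2).
  assert (PE : partials U E
    (fun x y => 2 * u x y * Dx u x y + 2 * v x y * Dx v x y + 2 * Dx u x y * Dx (Dx u) x y)
    (fun x y => 2 * u x y * Dy u x y + 2 * v x y * Dy v x y + 2 * Dx u x y * Dy (Dx u) x y))
    by (unfold E; solve_partials).
  assert (Z : forall x y, U (x, y) -> E x y = 0).
  { refine (gronwall_domain U E _ _ x0 y0 HU PE _ _ U0 _).
    - intros x y _. unfold E. generalize (pow2_ge_0 (u x y)) (pow2_ge_0 (v x y))
        (pow2_ge_0 (Dx u x y)). lra.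
    - intros x y Uxy.
      destruct (smooth_locally_bounded U a x y Sa Uxy) as (Ma & Ma0 & La).
      destruct (smooth_locally_bounded U b x y Sb Uxy) as (Mb & Mb0 & Lb).
      destruct (smooth_locally_bounded U (Dx a) x y (smooth_Dx _ _ Sa) Uxy) as (Mc & Mc0 & Lc).
      destruct (smooth_locally_bounded U (Dx b) x y (smooth_Dx _ _ Sb) Uxy) as (Md & Md0 & Ld).
      (* A generous constant: the two bounds needed are [1 + 2 Ma + Mc + Md] in the [x] direction
         and [1 + Ma + 2 Mb] in the [y] direction. *)
      exists (2 + 4 * Ma + 4 * Mb + 4 * Mc + 4 * Md).
      assert (L := locally_2d_and _ _ _ _ (locally_2d_and _ _ _ _ La Lb)
        (locally_2d_and _ _ _ _ (locally_2d_and _ _ _ _ Lc Ld)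
           (open_locally_2d U x y oU Uxy))).
      revert L. apply locally_2d_impl, locally_2d_forall.
      intros s t ((Ba & Bb) & (Bc & Bd) & Ust).
      destruct (H s t Ust) as (E1 & E2 & E3).
      rewrite (Uyx s t Ust), (Uxx s t Ust), E1, E2.
      replace (Dy v s t) with (Dx u s t - a s t * u s t - b s t * v s t) by lra.
      unfold E. clear - Ba Bb Bc Bd Ma0 Mb0 Mc0 Md0.
      revert Ba Bb Bc Bd. generalize (u s t) (v s t) (Dx u s t) (a s t) (b s t)
        (Dx a s t) (Dx b s t).
      intros p q r A B C D BA BB BC BD.
      assert (amgm : forall m n k, Rabs (2 * m * n) <= m ^ 2 + n ^ 2 + k ^ 2).
      { intros m n k. generalize (pow2_ge_0 (m - n)) (pow2_ge_0 (m + n)) (pow2_ge_0 k).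
        intros. apply Rabs_le; nra. }
      assert (pq := amgm p q r). assert (pr := amgm p r q). assert (qr := amgm q r p).
      assert (rr : Rabs (r * r) <= p ^ 2 + q ^ 2 + r ^ 2) by (apply Rabs_le; nra).
      assert (qq : Rabs (q * q) <= p ^ 2 + q ^ 2 + r ^ 2) by (apply Rabs_le; nra).
      replace (p ^ 2 + r ^ 2 + q ^ 2) with (p ^ 2 + q ^ 2 + r ^ 2) in pr by ring.
      replace (q ^ 2 + r ^ 2 + p ^ 2) with (p ^ 2 + q ^ 2 + r ^ 2) in qr by ring.
      set (n2 := p ^ 2 + q ^ 2 + r ^ 2) in *.
      assert (n20 : 0 <= n2) by (unfold n2; nra).
      clearbody n2.
      assert (T : forall k M m, Rabs k <= M -> Rabs m <= n2 -> Rabs (k * m) <= M * n2).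
      { intros k M m Hk Hm. rewrite Rabs_mult. apply Rmult_le_compat; auto using Rabs_pos. }
      assert (TA1 := T _ _ _ BA rr). assert (TA2 := T _ _ _ BA pq).
      assert (TB1 := T _ _ _ BB qq). assert (TC1 := T _ _ _ BC pr).
      assert (TD1 := T _ _ _ BD qr).
      apply Rabs_le_between in TA1, TA2, TB1, TC1, TD1, pr, qr.
      assert (Z1 : 0 <= Ma * n2) by (apply Rmult_le_pos; auto).
      assert (Z2 : 0 <= Mb * n2) by (apply Rmult_le_pos; auto).
      assert (Z3 : 0 <= Mc * n2) by (apply Rmult_le_pos; auto).
      assert (Z4 : 0 <= Md * n2) by (apply Rmult_le_pos; auto).
      split; apply Rabs_le; split; nra.
    - unfold E. rewrite Hu0, Hv0, Hux0. ring. }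
  intros x y Uxy. assert (Zxy := Z x y Uxy). unfold E in Zxy.
  assert (H1 := pow2_ge_0 (u x y)). assert (H2 := pow2_ge_0 (v x y)).
  assert (H3 := pow2_ge_0 (Dx u x y)).
  split; nra.
Qed.

(** * Abelian relations with prescribed weights *)

(** The rows of the determinant are the initial data [u], [v], [u_x] of the three relations at one
    point. Since these data determine a relation, three relations with independent data are
    independent and span. *)
Lemma abelian_basis_of_det U th1 th2 b x0 y0 :
  plane_domain U -> oblique_net U th1 th2 ->
  (forall k, (k < 3)%nat ->
     abelian_relation U 4 (net_with_coordinate_lines th1 th2) (b k)) ->
  U (x0, y0) ->
  det3 (cdx (b 0%nat 2%nat) x0 y0) (cdx (b 1%nat 2%nat) x0 y0) (cdx (b 2%nat 2%nat) x0 y0)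
       (cdy (b 0%nat 3%nat) x0 y0) (cdy (b 1%nat 3%nat) x0 y0) (cdy (b 2%nat 3%nat) x0 y0)
       (Dx (cdx (b 0%nat 2%nat)) x0 y0) (Dx (cdx (b 1%nat 2%nat)) x0 y0) (Dx (cdx (b 2%nat 2%nat)) x0 y0) <> 0 ->
  abelian_basis U 4 (net_with_coordinate_lines th1 th2) 3 b.
Proof.
  intros HU H Hb U0 Hdet. assert (oU := proj1 HU).
  destruct (reduced_relation_of_abelian U th1 th2 H) as (a & a' & Sa & Sa' & Hred).
  assert (R0 := Hred _ (Hb 0%nat ltac:(lia))).
  assert (R1 := Hred _ (Hb 1%nat ltac:(lia))).
  assert (R2 := Hred _ (Hb 2%nat ltac:(lia))).
  assert (P0 := smooth_partials _ _ (proj1 R0)).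
  assert (P1 := smooth_partials _ _ (proj1 R1)).
  assert (P2 := smooth_partials _ _ (proj1 R2)).
  split; [exact Hb|split].
  - intros c Hc.
    assert (Pc : partials U
      (fun x y => c 0%nat * cdx (b 0%nat 2%nat) x y + c 1%nat * cdx (b 1%nat 2%nat) x y + c 2%nat * cdx (b 2%nat 2%nat) x y)
      (fun x y => (0 * cdx (b 0%nat 2%nat) x y + c 0%nat * Dx (cdx (b 0%nat 2%nat)) x y)
        + (0 * cdx (b 1%nat 2%nat) x y + c 1%nat * Dx (cdx (b 1%nat 2%nat)) x y)
        + (0 * cdx (b 2%nat 2%nat) x y + c 2%nat * Dx (cdx (b 2%nat 2%nat)) x y))
      (fun x y => (0 * cdx (b 0%nat 2%nat) x y + c 0%nat * Dy (cdx (b 0%nat 2%nat)) x y)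
        + (0 * cdx (b 1%nat 2%nat) x y + c 1%nat * Dy (cdx (b 1%nat 2%nat)) x y)
        + (0 * cdx (b 2%nat 2%nat) x y + c 2%nat * Dy (cdx (b 2%nat 2%nat)) x y))) by solve_partials.
    apply partials_ext_fun with (g := fun _ _ => 0) in Pc; auto.
    2:{ intros x y Uxy. destruct (Hc 2%nat x y ltac:(lia) Uxy) as [E _].
        unfold Rsum in E; simpl in E. lra. }
    destruct (partials_D _ _ _ _ x0 y0 Pc U0) as [E3 _].
    destruct (partials_D _ _ _ _ x0 y0 (partials_const U 0) U0) as [E3' _].
    assert (E4 := eq_trans (eq_sym E3') E3). cbv beta in E4. clear E3 E3'.
    destruct (Hc 2%nat x0 y0 ltac:(lia) U0) as [E1 _].
    destruct (Hc 3%nat x0 y0 ltac:(lia) U0) as [_ E2].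
    unfold Rsum in E1, E2; simpl in E1, E2.
    destruct (det3_unique _ _ _ _ _ _ _ _ _ (c 0%nat) (c 1%nat) (c 2%nat) Hdet)
      as (Z0 & Z1 & Z2); try lra.
    intros [|[|[|k]]] Hk; auto; lia.
  - intros w Hw.
    destruct (det3_solve _ _ _ _ _ _ _ _ _ (cdx (w 2%nat) x0 y0) (cdy (w 3%nat) x0 y0)
      (Dx (cdx (w 2%nat)) x0 y0) Hdet) as (c0 & c1 & c2 & E1 & E2 & E3).
    assert (Rw := Hred _ Hw). assert (Pw := smooth_partials _ _ (proj1 Rw)).
    (* The difference of [w] and the combination with the same initial data; it vanishes
       identically. *)
    assert (Rd := reduced_relation_comb _ _ _ _ _ _ _ 1 1 oU
      (reduced_relation_comb _ _ _ _ _ _ _ 1 (- c0) oU Rw R0)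
      (reduced_relation_comb _ _ _ _ _ _ _ (- c1) (- c2) oU R1 R2)).
    cbv beta in Rd.
    assert (Z : forall x y, U (x, y) ->
      cdx (w 2%nat) x y = c0 * cdx (b 0%nat 2%nat) x y + c1 * cdx (b 1%nat 2%nat) x y
        + c2 * cdx (b 2%nat 2%nat) x y /\
      cdy (w 3%nat) x y = c0 * cdy (b 0%nat 3%nat) x y + c1 * cdy (b 1%nat 3%nat) x y
        + c2 * cdy (b 2%nat 3%nat) x y).
    { assert (Zd := reduced_relation_zero U a a' _ _ x0 y0 HU Sa Sa' Rd U0).
      lapply Zd; [clear Zd; intros Zd|lra]. lapply Zd; [clear Zd; intros Zd|lra].
      lapply Zd; [clear Zd; intros Zd|].
      - intros x y Uxy. destruct (Zd x y Uxy). lra.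
      - eapply Dx_eq; [solve_partials|exact U0|]. cbv beta. lra. }
    exists (fun k => match k with 0%nat => c0 | 1%nat => c1 | _ => c2 end).
    intros i x y Hi Uxy. unfold Rsum; simpl.
    destruct (Z x y Uxy) as [Z1 Z2].
    assert (N := conormal_sq_neq_0 U th1 th2 x y H Uxy).
    destruct (relation_components U th1 th2 _ x y H Hw Uxy) as (w1 & w2 & w3 & w4 & w5 & w6).
    destruct (relation_components U th1 th2 _ x y H (Hb 0%nat ltac:(lia)) Uxy)
      as (a1 & a2 & a3 & a4 & a5 & a6).
    destruct (relation_components U th1 th2 _ x y H (Hb 1%nat ltac:(lia)) Uxy)
      as (b1 & b2 & b3 & b4 & b5 & b6).
    destruct (relation_components U th1 th2 _ x y H (Hb 2%nat ltac:(lia)) Uxy)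
      as (d1 & d2 & d3 & d4 & d5 & d6).
    destruct i as [|[|[|[|i]]]]; [| | | |lia].
    + rewrite w3, w4, a3, a4, b3, b4, d3, d4, Z1, Z2. split; field; auto.
    + rewrite w5, w6, a5, a6, b5, b6, d5, d6, Z1, Z2. split; field; auto.
    + rewrite w1, a1, b1, d1, Z1. split; ring.
    + rewrite w2, a2, b2, d2, Z2. split; ring.
Qed.

(** * Relations whose components along the net have the form [h dl] *)

Definition weighted_form (h l : R -> R -> R) : one_form :=
  OneForm (fun x y => h x y * Dx l x y) (fun x y => h x y * Dy l x y).

Lemma smooth_weighted_form U h l :
  open U -> smooth U h -> smooth U l -> smooth_form U (weighted_form h l).
Proof. intros oU Sh Sl. split; simpl; solve_smooth. Qed.

(** The condition [dh ^ dl = 0] stands for [h] being a function of [l] and is exactly what makes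
    [h dl] closed. *)
Definition dependent (U : R * R -> Prop) (h l : R -> R -> R) : Prop :=
  forall x y, U (x, y) -> Dx h x y * Dy l x y = Dy h x y * Dx l x y.

Lemma closed_weighted_form U h l :
  open U -> smooth U h -> smooth U l -> dependent U h l ->
  closed_form U (weighted_form h l).
Proof.
  intros oU Sh Sl Hd x y Uxy.
  change (Dy (fun x y => h x y * Dx l x y) x y = Dx (fun x y => h x y * Dy l x y) x y).
  assert (Ph := smooth_partials _ _ Sh).
  assert (Pl := smooth_partials _ _ (smooth_Dx _ _ Sl)).
  assert (Pl' := smooth_partials _ _ (smooth_Dy _ _ Sl)).
  destruct (partials_D _ _ _ _ x y (partials_mult _ _ _ _ _ _ _ Ph Pl) Uxy) as [_ E1].
  destruct (partials_D _ _ _ _ x y (partials_mult _ _ _ _ _ _ _ Ph Pl') Uxy) as [E2 _].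
  rewrite E1, E2, (mixed_partials U l), (Hd x y Uxy); auto.
Qed.

Definition weighted_relation (h1 l1 h2 l2 u v : R -> R -> R) (i : nat) : one_form :=
  match i with
  | 0%nat => weighted_form h1 l1
  | 1%nat => weighted_form h2 l2
  | 2%nat => OneForm u (fun _ _ => 0)
  | _ => OneForm (fun _ _ => 0) v
  end.

Lemma abelian_weighted_relation U th1 th2 h1 l1 h2 l2 u v :
  open U -> smooth U h1 -> smooth U h2 -> smooth U l1 -> smooth U l2 ->
  smooth U u -> smooth U v ->
  (forall x y, U (x, y) -> wedge (function_differential l1) th1 x y = 0) ->
  (forall x y, U (x, y) -> wedge (function_differential l2) th2 x y = 0) ->
  dependent U h1 l1 -> dependent U h2 l2 ->
  (forall x y, U (x, y) -> Dy u x y = 0 /\ Dx v x y = 0) ->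
  (forall x y, U (x, y) ->
     h1 x y * Dx l1 x y + h2 x y * Dx l2 x y + u x y = 0 /\
     h1 x y * Dy l1 x y + h2 x y * Dy l2 x y + v x y = 0) ->
  abelian_relation U 4 (net_with_coordinate_lines th1 th2)
    (weighted_relation h1 l1 h2 l2 u v).
Proof.
  intros oU Sh1 Sh2 Sl1 Sl2 Su Sv W1 W2 D1 D2 Huv Hs.
  assert (Z := partials_const U 0).
  split.
  - intros [|[|[|[|i]]]] Hi; [| | | |lia]; (split; [|split]); simpl.
    + now apply smooth_weighted_form.
    + intros x y Uxy. generalize (W1 x y Uxy).
      unfold wedge; simpl. fold (Dx l1 x y) (Dy l1 x y). intros E.
      transitivity (h1 x y * (Dx l1 x y * cdy th1 x y - Dy l1 x y * cdx th1 x y)); [ring|].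
      rewrite E; ring.
    + now apply closed_weighted_form.
    + now apply smooth_weighted_form.
    + intros x y Uxy. generalize (W2 x y Uxy).
      unfold wedge; simpl. fold (Dx l2 x y) (Dy l2 x y). intros E.
      transitivity (h2 x y * (Dx l2 x y * cdy th2 x y - Dy l2 x y * cdx th2 x y)); [ring|].
      rewrite E; ring.
    + now apply closed_weighted_form.
    + split; simpl; auto using smooth_const.
    + intros x y _. unfold wedge; simpl; ring.
    + intros x y Uxy. simpl. transitivity 0; [now apply Huv|].
      symmetry; now apply (partials_D U _ _ _ x y Z).
    + split; simpl; auto using smooth_const.
    + intros x y _. unfold wedge; simpl; ring.
    + intros x y Uxy. simpl. transitivity 0; [now apply (partials_D U _ _ _ x y Z)|].
      symmetry; now apply Huv.
  - intros x y Uxy. destruct (Hs x y Uxy) as [E1 E2]. unfold Rsum; simpl. lra.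
Qed.

(** Since [dl] is a multiple [t] of the conormal, the point attached to the leaf is [t] times the
    vector of weights; hence the arbitrary factor in the hypothesis on [F]. *)
Lemma curve_contains_net_arc U th1 th2 b i F h l :
  oblique_net U th1 th2 -> (i < 2)%nat ->
  (forall x y, U (x, y) ->
     wedge (function_differential l) (net_with_coordinate_lines th1 th2 i) x y = 0) ->
  (forall k, (k < 3)%nat -> b k i = weighted_form (h k) l) ->
  (forall t x y, U (x, y) -> F (t * h 0%nat x y) (t * h 1%nat x y) (t * h 2%nat x y) = 0) ->
  curve_contains_arc U (net_with_coordinate_lines th1 th2) b i F.
Proof.
  intros H Hi W Hb HF x y Uxy X Y Z.
  rewrite !Hb by lia. simpl. intros X1 _ Y1 _ Z1 _.
  destruct (oblique_nonzero _ _ _ H x y Uxy) as (HA & _ & HC & _).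
  assert (N : cdx (net_with_coordinate_lines th1 th2 i) x y <> 0).
  { destruct i as [|[|i]]; [auto|auto|lia]. }
  set (A := cdx _ x y) in *.
  replace X with (Dx l x y / A * h 0%nat x y) by (field_simplify_eq; auto; lra).
  replace Y with (Dx l x y / A * h 1%nat x y) by (field_simplify_eq; auto; lra).
  replace Z with (Dx l x y / A * h 2%nat x y) by (field_simplify_eq; auto; lra).
  now apply HF.
Qed.

(* The basis is adapted: [u 1 = 0] and [v 0 = 0] put the two coordinate arcs on
   the lines [Y = 0] and [X = 0]. *)
Lemma conic_and_two_lines_of_weighted_relations U th1 th2 l1 l2
    (h1 h2 u v : nat -> R -> R -> R) (a b d e f x0 y0 : R) :
  plane_domain U -> oblique_net U th1 th2 ->
  smooth U l1 -> smooth U l2 ->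
  (forall x y, U (x, y) -> wedge (function_differential l1) th1 x y = 0) ->
  (forall x y, U (x, y) -> wedge (function_differential l2) th2 x y = 0) ->
  (forall k, (k < 3)%nat ->
     smooth U (h1 k) /\ smooth U (h2 k) /\ smooth U (u k) /\ smooth U (v k) /\
     dependent U (h1 k) l1 /\ dependent U (h2 k) l2 /\
     (forall x y, U (x, y) -> Dy (u k) x y = 0 /\ Dx (v k) x y = 0) /\
     (forall x y, U (x, y) ->
        h1 k x y * Dx l1 x y + h2 k x y * Dx l2 x y + u k x y = 0 /\
        h1 k x y * Dy l1 x y + h2 k x y * Dy l2 x y + v k x y = 0)) ->
  (forall x y, u 1%nat x y = 0) -> (forall x y, v 0%nat x y = 0) ->
  U (x0, y0) ->
  det3 (u 0%nat x0 y0) (u 1%nat x0 y0) (u 2%nat x0 y0)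
       (v 0%nat x0 y0) (v 1%nat x0 y0) (v 2%nat x0 y0)
       (Dx (u 0%nat) x0 y0) (Dx (u 1%nat) x0 y0) (Dx (u 2%nat) x0 y0) <> 0 ->
  2 * d * e * f - a * f ^ 2 - b * e ^ 2 <> 0 ->
  (forall x y, U (x, y) -> forall h, h = h1 \/ h = h2 ->
     a * h 0%nat x y ^ 2 + b * h 1%nat x y ^ 2 + 2 * d * h 0%nat x y * h 1%nat x y
     + 2 * e * h 0%nat x y * h 2%nat x y + 2 * f * h 1%nat x y * h 2%nat x y = 0) ->
  maximal_rank U 4 (net_with_coordinate_lines th1 th2) /\
  rank_quartic_is_conic_and_two_lines_through_it U (net_with_coordinate_lines th1 th2).
Proof.
  intros HU H Sl1 Sl2 W1 W2 Hk Hu1 Hv0 U0 Hdet Hq HQ.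
  set (bb := fun k => weighted_relation (h1 k) l1 (h2 k) l2 (u k) (v k)).
  assert (Bas : abelian_basis U 4 (net_with_coordinate_lines th1 th2) 3 bb).
  { apply abelian_basis_of_det with x0 y0; auto.
    intros k Lk. destruct (Hk k Lk) as (? & ? & ? & ? & ? & ? & ? & ?).
    apply abelian_weighted_relation; auto. apply HU. }
  set (Q := fun X Y Z => a * X ^ 2 + b * Y ^ 2 + 0 * Z ^ 2
                + 2 * d * X * Y + 2 * e * X * Z + 2 * f * Y * Z).
  set (F := fun X Y Z => Q X Y Z * Y * X).
  assert (HQ' : forall t x y, U (x, y) -> forall h, h = h1 \/ h = h2 ->
     Q (t * h 0%nat x y) (t * h 1%nat x y) (t * h 2%nat x y) = 0).
  { intros t x y Uxy h Hh. generalize (HQ x y Uxy h Hh). unfold Q. intros E.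
    match type of E with ?A = 0 => transitivity (t ^ 2 * A); [ring|rewrite E; ring] end. }
  assert (L2 : curve_contains_arc U (net_with_coordinate_lines th1 th2) bb 2 (fun _ Y _ => Y)).
  { intros x y Uxy X Y Z. simpl. rewrite Hu1. intros; lra. }
  assert (L3 : curve_contains_arc U (net_with_coordinate_lines th1 th2) bb 3 (fun X _ _ => X)).
  { intros x y Uxy X Y Z. simpl. rewrite Hv0. intros; lra. }
  split; [exists bb; exact Bas|].
  exists bb, F. split; [exact Bas|split].
  - split; [split|].
    + exists (fun i j => match i, j with
        | 3%nat, 1%nat => a | 1%nat, 3%nat => b
        | 2%nat, 2%nat => 2 * d | 2%nat, 1%nat => 2 * e | 1%nat, 2%nat => 2 * f
        | _, _ => 0 end).
      intros X Y Z. unfold Rsum, F, Q; simpl. ring.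
    (* If both vanished, the conic would be degenerate. On [X = Y = 1], or on [X = 1], [Y = -1], the
       quartic is affine in [Z] with nonzero slope, and [Z] is chosen to give it the value 1, or
       -1. *)
    + assert (e + f <> 0 \/ e - f <> 0) as [N|N].
      { destruct (Req_dec (e + f) 0) as [E1|]; auto.
        destruct (Req_dec (e - f) 0) as [E2|]; auto.
        exfalso; apply Hq. replace e with 0 by lra. replace f with 0 by lra. ring. }
      * exists 1, 1, ((1 - (a + b + 2 * d)) / (2 * (e + f))).
        replace (F _ _ _) with 1; [lra|]. unfold F, Q. field. auto.
      * exists 1, (- 1), ((1 - (a + b - 2 * d)) / (2 * (e - f))).
        replace (F _ _ _) with (- 1); [lra|]. unfold F, Q. field. auto.
    + intros [|[|[|[|i]]]] Hi; [| | | |lia].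
      * apply (curve_contains_net_arc U th1 th2 bb 0 F h1 l1); auto.
        intros t x y Uxy. unfold F. rewrite HQ'; auto. ring.
      * apply (curve_contains_net_arc U th1 th2 bb 1 F h2 l2); auto.
        intros t x y Uxy. unfold F. rewrite HQ'; auto. ring.
      * intros x y Uxy X Y Z E1 E2 E3 E4 E5 E6. unfold F.
        rewrite (L2 x y Uxy X Y Z E1 E2 E3 E4 E5 E6). ring.
      * intros x y Uxy X Y Z E1 E2 E3 E4 E5 E6. unfold F.
        rewrite (L3 x y Uxy X Y Z E1 E2 E3 E4 E5 E6). ring.
  - exists Q, (fun _ Y _ => Y), (fun X _ _ => X).
    split; [|split; [|split; [|split; [|split; [|split; [|split]]]]]]; auto.
    + exists a, b, 0, d, e, f. split; [lra|reflexivity].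
    + exists 0, 1, 0. split; [lra|intros; ring].
    + exists 1, 0, 0. split; [lra|intros; ring].
    + exists 1, 0, 0. lra.
    + exists 0, 0, 1. unfold Q. repeat split; try ring. lra.
Qed.

(** * From confocal conics to the rank quartic *)

(** Separates the two conics through a point: with equal parameters both foliations would have the
    same nonzero conormal [(p, q)], although their conormals are orthogonal. *)
Lemma common_conormal_zero A B C D p q :
  A <> 0 -> B <> 0 -> C <> 0 -> D <> 0 -> A * C + B * D = 0 ->
  p * B = q * A -> p * D = q * C -> p = 0 /\ q = 0.
Proof.
  intros HA HB HC HD O E1 E2.
  assert (Z : (p ^ 2 + q ^ 2) * (B * D) = 0).
  { transitivity ((p * B) * (p * D) + q ^ 2 * (B * D)); [ring|].
    rewrite E1, E2. transitivity (q ^ 2 * (A * C + B * D)); [ring|]. rewrite O; ring. }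
  apply Rmult_integral in Z as [Z|Z].
  - generalize (pow2_ge_0 p) (pow2_ge_0 q). split; nra.
  - apply Rmult_integral in Z. tauto.
Qed.

(** For implicit differentiation: [g] is, up to a constant, the derivative of the equation of the
    conic in its parameter. The slope of the leaf is obtained without dividing by [g]. *)
Lemma leaf_slope th l x y g p q :
  wedge (function_differential l) th x y = 0 ->
  Dx l x y * g = p -> Dy l x y * g = q ->
  p * cdy th x y = q * cdx th x y.
Proof.
  unfold wedge; simpl. fold (Dx l x y) (Dy l x y). intros E <- <-.
  transitivity (g * (Dx l x y * cdy th x y)); [ring|].
  replace (Dx l x y * cdy th x y) with (Dy l x y * cdx th x y) by lra. ring.
Qed.

Lemma distinct_quadratic_roots r s t1 t2 :
  t1 <> t2 -> t1 ^ 2 - r * t1 + s = 0 -> t2 ^ 2 - r * t2 + s = 0 ->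
  t1 + t2 = r /\ t1 * t2 = s.
Proof.
  intros N E1 E2.
  assert (S : t1 + t2 = r).
  { apply Rmult_eq_reg_l with (t1 - t2); lra. }
  split; auto. subst r. lra.
Qed.

Lemma dependent_const U c l : dependent U (fun _ _ => c) l.
Proof.
  intros x y Uxy. destruct (partials_D _ _ _ _ x y (partials_const U c) Uxy) as [-> ->]. ring.
Qed.

Lemma dependent_self U l : dependent U l l.
Proof. intros x y _. ring. Qed.

Lemma dependent_inv_minus U c l :
  smooth U l -> (forall x y, U (x, y) -> c - l x y <> 0) ->
  dependent U (fun x y => / (c - l x y)) l.
Proof.
  intros Sl N x y Uxy. assert (Pl := smooth_partials _ _ Sl).
  erewrite (Dx_eq U (fun x y => / (c - l x y))), (Dy_eq U (fun x y => / (c - l x y)));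
    [|solve_partials; auto|exact Uxy|reflexivity|solve_partials; auto|exact Uxy|reflexivity].
  cbv beta. field. auto.
Qed.

Lemma dependent_inv U l :
  smooth U l -> (forall x y, U (x, y) -> l x y <> 0) ->
  dependent U (fun x y => / l x y) l.
Proof.
  intros Sl N x y Uxy. assert (Pl := smooth_partials _ _ Sl).
  erewrite (Dx_eq U (fun x y => / l x y)), (Dy_eq U (fun x y => / l x y));
    [|solve_partials; auto|exact Uxy|reflexivity|solve_partials; auto|exact Uxy|reflexivity].
  cbv beta. field. auto.
Qed.


(** Turns an identity [E] between functions on [U] into the equalities [Ex] and [Ey] of the partial
    derivatives of its sides at the point of [Uxy]. *)
Ltac differentiate oU E Uxy Ex Ey :=
  match type of E with
  | forall x y, _ -> @?f x y = @?g x y =>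
      match type of Uxy with
      | ?U (?x, ?y) =>
          let H := fresh in
          eassert (H : _ /\ _);
            [eapply (partials_eq U f g);
               [exact oU | exact E | solve_partials | solve_partials | exact Uxy]
            |cbv beta in H; destruct H as [Ex Ey]]
      end
  end.

(** [A] and [B] stand for [a ^ 2] and [b ^ 2], of which only the squares matter. *)
Definition on_conic (A B x0 y0 l x y : R) : Prop :=
  A - l <> 0 /\ B - l <> 0 /\ (x - x0) ^ 2 / (A - l) + (y - y0) ^ 2 / (B - l) = 1.

Lemma on_conic_polynomial A B x0 y0 l x y :
  on_conic A B x0 y0 l x y ->
  l ^ 2 - (A + B - (x - x0) ^ 2 - (y - y0) ^ 2) * l
    + (A * B - B * (x - x0) ^ 2 - A * (y - y0) ^ 2) = 0.
Proof.
  intros (HA & HB & E).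
  assert (F : (x - x0) ^ 2 * (B - l) + (y - y0) ^ 2 * (A - l) = (A - l) * (B - l)).
  { transitivity (((x - x0) ^ 2 / (A - l) + (y - y0) ^ 2 / (B - l)) * ((A - l) * (B - l))).
    - field; auto.
    - rewrite E; ring. }
  lra.
Qed.

Lemma confocal_leaf_slope U th A B x0 y0 l :
  open U -> smooth U l ->
  (forall x y, U (x, y) -> on_conic A B x0 y0 (l x y) x y) ->
  (forall x y, U (x, y) -> wedge (function_differential l) th x y = 0) ->
  forall x y, U (x, y) ->
    (x - x0) * (B - l x y) * cdy th x y = (y - y0) * (A - l x y) * cdx th x y.
Proof.
  intros oU Sl HE W x y Uxy. assert (Pl := smooth_partials _ _ Sl).
  assert (E := fun x y Uxy => on_conic_polynomial _ _ _ _ _ _ _ (HE x y Uxy)).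
  differentiate oU E Uxy Ex Ey.
  (* Half the derivative in [l] of the polynomial of [on_conic_polynomial]. *)
  apply (leaf_slope th l x y (((x - x0) ^ 2 + (y - y0) ^ 2 - A - B) / 2 + l x y)).
  - now apply W.
  - lra.
  - lra.
Qed.

Lemma quartic_of_confocal_central U th1 th2 A B x0 y0 l1 l2 :
  plane_domain U -> oblique_net U th1 th2 ->
  smooth U l1 -> smooth U l2 ->
  (forall x y, U (x, y) ->
     on_conic A B x0 y0 (l1 x y) x y /\ wedge (function_differential l1) th1 x y = 0) ->
  (forall x y, U (x, y) ->
     on_conic A B x0 y0 (l2 x y) x y /\ wedge (function_differential l2) th2 x y = 0) ->
  maximal_rank U 4 (net_with_coordinate_lines th1 th2) /\
  rank_quartic_is_conic_and_two_lines_through_it U (net_with_coordinate_lines th1 th2).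
Proof.
  intros HU H Sl1 Sl2 H1 H2. assert (oU := proj1 HU).
  assert (T1 := confocal_leaf_slope U th1 A B x0 y0 l1 oU Sl1
    (fun x y Uxy => proj1 (H1 x y Uxy)) (fun x y Uxy => proj2 (H1 x y Uxy))).
  assert (T2 := confocal_leaf_slope U th2 A B x0 y0 l2 oU Sl2
    (fun x y Uxy => proj1 (H2 x y Uxy)) (fun x y Uxy => proj2 (H2 x y Uxy))).
  assert (NZ := oblique_nonzero _ _ _ H).
  assert (N1 : forall x y, U (x, y) -> A - l1 x y <> 0 /\ B - l1 x y <> 0).
  { intros x y Uxy. split; apply (H1 x y Uxy). }
  assert (N2 : forall x y, U (x, y) -> A - l2 x y <> 0 /\ B - l2 x y <> 0).
  { intros x y Uxy. split; apply (H2 x y Uxy). }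
  (* The center lies on no conic of the family, the left side of the equation being 0 there. *)
  assert (C0 : forall x y, U (x, y) -> x - x0 <> 0 \/ y - y0 <> 0).
  { intros x y Uxy. destruct (Req_dec (x - x0) 0) as [Ex|]; auto.
    destruct (Req_dec (y - y0) 0) as [Ey|]; auto. exfalso.
    destruct (H1 x y Uxy) as [(_ & _ & E) _]. rewrite Ex, Ey in E.
    destruct (N1 x y Uxy). replace (0 ^ 2 / _ + _) with 0 in E; [lra|field; auto]. }
  (* On a principal axis the leaves are parallel to a coordinate line, which obliqueness
     excludes. *)
  assert (XY : forall x y, U (x, y) -> x - x0 <> 0 /\ y - y0 <> 0).
  { intros x y Uxy. generalize (T1 x y Uxy). destruct (NZ x y Uxy) as (HA & HB & _).
    destruct (N1 x y Uxy) as [NA NB]. intros E.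
    split; intros Z; rewrite Z in E; ring_simplify in E;
      destruct (C0 x y Uxy) as [C|C]; apply C; auto.
    - apply Rmult_eq_reg_r with ((A - l1 x y) * cdx th1 x y).
      + lra.
      + now apply Rmult_integral_contrapositive_currified.
    - apply Rmult_eq_reg_r with ((B - l1 x y) * cdy th1 x y).
      + lra.
      + now apply Rmult_integral_contrapositive_currified. }
  assert (N12 : forall x y, U (x, y) -> l1 x y <> l2 x y).
  { intros x y Uxy E. destruct (NZ x y Uxy) as (HA & HB & HC & HD).
    assert (E1 := T1 x y Uxy). assert (E2 := T2 x y Uxy). rewrite <- E in E2.
    destruct (common_conormal_zero _ _ _ _ _ _ HA HB HC HD
      (oblique_orthogonal _ _ _ H x y Uxy) E1 E2) as [Z _].
    apply Rmult_integral in Z. destruct (XY x y Uxy), (N1 x y Uxy). tauto. }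
  assert (V : forall x y, U (x, y) ->
    l1 x y + l2 x y = A + B - (x - x0) ^ 2 - (y - y0) ^ 2 /\
    l1 x y * l2 x y = A * B - B * (x - x0) ^ 2 - A * (y - y0) ^ 2).
  { intros x y Uxy. apply distinct_quadratic_roots; auto.
    - now apply on_conic_polynomial, H1.
    - now apply on_conic_polynomial, H2. }
  assert (VS := fun x y Uxy => proj1 (V x y Uxy)).
  assert (VA : forall x y, U (x, y) ->
    (A - l1 x y) * (A - l2 x y) = (A - B) * (x - x0) ^ 2).
  { intros x y Uxy. destruct (V x y Uxy) as [E1 E2].
    transitivity (A ^ 2 - A * (l1 x y + l2 x y) + l1 x y * l2 x y); [ring|].
    rewrite E1, E2; ring. }
  assert (VB : forall x y, U (x, y) ->
    (B - l1 x y) * (B - l2 x y) = (B - A) * (y - y0) ^ 2).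
  { intros x y Uxy. destruct (V x y Uxy) as [E1 E2].
    transitivity (B ^ 2 - B * (l1 x y + l2 x y) + l1 x y * l2 x y); [ring|].
    rewrite E1, E2; ring. }
  assert (P1 := smooth_partials _ _ Sl1). assert (P2 := smooth_partials _ _ Sl2).
  destruct (proj1 (proj2 HU)) as [[xb yb] Ub].
  (* For concentric circles [VA] would make [A - l1] or [A - l2] vanish. *)
  assert (AB : A - B <> 0).
  { intros Z. generalize (VA xb yb Ub). rewrite Z. intros E.
    destruct (N1 xb yb Ub) as [n1 _], (N2 xb yb Ub) as [n2 _].
    rewrite Rmult_0_l in E. apply Rmult_integral in E. tauto. }
  assert (NX : forall x y, U (x, y) -> x - x0 <> 0) by (intros; now apply (XY x y)).
  assert (NY : forall x y, U (x, y) -> y - y0 <> 0) by (intros; now apply (XY x y)).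
  set (h := fun (l : R -> R -> R) k => match k return R -> R -> R with
    | 0%nat => fun x y => / (A - l x y)
    | 1%nat => fun x y => / (B - l x y)
    | _ => fun _ _ => 1 end).
  set (u := fun k => match k return R -> R -> R with
    | 0%nat => fun x _ => 2 / (x - x0)
    | 1%nat => fun _ _ => 0
    | _ => fun x _ => 2 * (x - x0) end).
  set (v := fun k => match k return R -> R -> R with
    | 0%nat => fun _ _ => 0
    | 1%nat => fun _ y => 2 / (y - y0)
    | _ => fun _ y => 2 * (y - y0) end).
  assert (Hh : forall l k, smooth U l ->
    (forall x y, U (x, y) -> A - l x y <> 0 /\ B - l x y <> 0) ->
    (k < 3)%nat -> smooth U (h l k) /\ dependent U (h l k) l).
  { intros l [|[|[|k]]] Sl N Lk; [| | |lia]; simpl; split.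
    - solve_smooth. intros x y Uxy; now apply N.
    - apply dependent_inv_minus; auto. intros x y Uxy; now apply N.
    - solve_smooth. intros x y Uxy; now apply N.
    - apply dependent_inv_minus; auto. intros x y Uxy; now apply N.
    - solve_smooth.
    - apply dependent_const. }
  apply (conic_and_two_lines_of_weighted_relations U th1 th2 l1 l2 (h l1) (h l2) u v
    0 0 ((A - B) / 2) (1 / 2) (- (1 / 2)) xb yb); auto.
  - intros; now apply H1.
  - intros; now apply H2.
  - intros k Lk.
    destruct (Hh l1 k Sl1 N1 Lk) as [Sh1 Dh1], (Hh l2 k Sl2 N2 Lk) as [Sh2 Dh2].
    split; [exact Sh1|split; [exact Sh2|split; [|split; [|split; [|split; [|split]]]]]]; auto.
    + destruct k as [|[|[|k]]]; [| | |lia]; simpl; solve_smooth; auto.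
    + destruct k as [|[|[|k]]]; [| | |lia]; simpl; solve_smooth; auto.
    + intros x y Uxy. destruct k as [|[|[|k]]]; [| | |lia]; simpl; split;
        (eapply Dx_eq || eapply Dy_eq); try solve_partials; try exact Uxy; auto;
        cbv beta; field; eauto.
    + intros x y Uxy. assert (X := NX x y Uxy). assert (Y := NY x y Uxy).
      destruct (N1 x y Uxy) as [nA1 nB1], (N2 x y Uxy) as [nA2 nB2].
      destruct k as [|[|[|k]]]; [| | |lia]; simpl.
      * differentiate oU VA Uxy Ex Ey. assert (E := VA x y Uxy). split.
        -- apply Rmult_eq_reg_l with ((A - l1 x y) * (A - l2 x y) * (x - x0));
             [|repeat apply Rmult_integral_contrapositive_currified; auto].
           transitivity ((Dx l1 x y * (A - l2 x y) + (A - l1 x y) * Dx l2 x y) * (x - x0)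
             + 2 * ((A - l1 x y) * (A - l2 x y))); [field; auto|].
           rewrite E. nra.
        -- apply Rmult_eq_reg_l with ((A - l1 x y) * (A - l2 x y));
             [|repeat apply Rmult_integral_contrapositive_currified; auto].
           transitivity (Dy l1 x y * (A - l2 x y) + (A - l1 x y) * Dy l2 x y); [field; auto|].
           lra.
      * differentiate oU VB Uxy Ex Ey. assert (E := VB x y Uxy). split.
        -- apply Rmult_eq_reg_l with ((B - l1 x y) * (B - l2 x y));
             [|repeat apply Rmult_integral_contrapositive_currified; auto].
           transitivity (Dx l1 x y * (B - l2 x y) + (B - l1 x y) * Dx l2 x y); [field; auto|].
           lra.
        -- apply Rmult_eq_reg_l with ((B - l1 x y) * (B - l2 x y) * (y - y0));
             [|repeat apply Rmult_integral_contrapositive_currified; auto].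
           transitivity ((Dy l1 x y * (B - l2 x y) + (B - l1 x y) * Dy l2 x y) * (y - y0)
             + 2 * ((B - l1 x y) * (B - l2 x y))); [field; auto|].
           rewrite E. nra.
      * differentiate oU VS Uxy Ex Ey. split; lra.
  - assert (X := NX xb yb Ub). assert (Y := NY xb yb Ub). simpl.
    erewrite (Dx_eq U (fun x _ => 2 / (x - x0)) _ _ xb yb); 
      [|solve_partials; auto|exact Ub|reflexivity].
    erewrite (Dx_eq U (fun x _ => 2 * (x - x0)) _ _ xb yb);
      [|solve_partials; auto|exact Ub|reflexivity].
    erewrite (Dx_eq U (fun _ _ => 0) _ _ xb yb);
      [|solve_partials; auto|exact Ub|reflexivity].
    unfold det3. cbv beta.
    replace (_ + _) with (16 / ((xb - x0) * (yb - y0))) by (field; auto).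
    unfold Rdiv. apply Rmult_integral_contrapositive_currified; [lra|].
    apply Rinv_neq_0_compat. now apply Rmult_integral_contrapositive_currified.
  - intros Z. apply AB. lra.
  - intros x y Uxy h' [->| ->]; simpl.
    + destruct (N1 x y Uxy). field; auto.
    + destruct (N2 x y Uxy). field; auto.
Qed.

(** * Confocal parabolas: one line tangent to the conic *)

Lemma quartic_of_confocal_parabolas_x U th1 th2 x0 y0 l1 l2 :
  plane_domain U -> oblique_net U th1 th2 ->
  smooth U l1 -> smooth U l2 ->
  (forall x y, U (x, y) ->
     (l1 x y <> 0 /\ (y - y0) ^ 2 = 2 * l1 x y * (x - x0) + l1 x y ^ 2) /\
     wedge (function_differential l1) th1 x y = 0) ->
  (forall x y, U (x, y) ->
     (l2 x y <> 0 /\ (y - y0) ^ 2 = 2 * l2 x y * (x - x0) + l2 x y ^ 2) /\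
     wedge (function_differential l2) th2 x y = 0) ->
  maximal_rank U 4 (net_with_coordinate_lines th1 th2) /\
  rank_quartic_is_conic_and_two_lines_through_it U (net_with_coordinate_lines th1 th2).
Proof.
  intros HU H Sl1 Sl2 H1 H2. assert (oU := proj1 HU).
  assert (slope : forall th l, smooth U l ->
    (forall x y, U (x, y) ->
       (l x y <> 0 /\ (y - y0) ^ 2 = 2 * l x y * (x - x0) + l x y ^ 2) /\
       wedge (function_differential l) th x y = 0) ->
    forall x y, U (x, y) -> - l x y * cdy th x y = (y - y0) * cdx th x y).
  { intros th l Sl Hl x y Uxy. assert (Pl := smooth_partials _ _ Sl).
    assert (E := fun x y Uxy => proj2 (proj1 (Hl x y Uxy))).
    differentiate oU E Uxy Ex Ey.
    (* Half the derivative of [l^2 + 2 l (x - x0) - (y - y0)^2] in [l]. *)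
    apply (leaf_slope th l x y (x - x0 + l x y)); [now apply Hl|lra|lra]. }
  assert (T1 := slope th1 l1 Sl1 H1). assert (T2 := slope th2 l2 Sl2 H2).
  assert (NZ := oblique_nonzero _ _ _ H).
  assert (N1 : forall x y, U (x, y) -> l1 x y <> 0) by (intros; now apply H1).
  assert (N2 : forall x y, U (x, y) -> l2 x y <> 0) by (intros; now apply H2).
  (* On the common axis of the parabolas the conormals are parallel to a coordinate axis, which
     obliqueness excludes. *)
  assert (NY : forall x y, U (x, y) -> y - y0 <> 0).
  { intros x y Uxy Z. generalize (T1 x y Uxy). rewrite Z, Rmult_0_l. intros E.
    apply Rmult_integral in E. destruct (NZ x y Uxy) as (_ & HB & _).
    generalize (N1 x y Uxy). destruct E as [E|E]; [intros N; apply N; lra|tauto]. }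
  assert (N12 : forall x y, U (x, y) -> l1 x y <> l2 x y).
  { intros x y Uxy E. destruct (NZ x y Uxy) as (HA & HB & HC & HD).
    assert (E1 := T1 x y Uxy). assert (E2 := T2 x y Uxy). rewrite <- E in E2.
    destruct (common_conormal_zero _ _ _ _ _ _ HA HB HC HD
      (oblique_orthogonal _ _ _ H x y Uxy) E1 E2) as [_ Z].
    now apply (NY x y Uxy). }
  assert (V : forall x y, U (x, y) ->
    l1 x y + l2 x y = - 2 * (x - x0) /\ l1 x y * l2 x y = - (y - y0) ^ 2).
  { intros x y Uxy. apply distinct_quadratic_roots; auto.
    - destruct (H1 x y Uxy) as [[_ E] _]. lra.
    - destruct (H2 x y Uxy) as [[_ E] _]. lra. }
  assert (VS := fun x y Uxy => proj1 (V x y Uxy)).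
  assert (VP := fun x y Uxy => proj2 (V x y Uxy)).
  assert (VQ : forall x y, U (x, y) ->
    l1 x y ^ 2 + l2 x y ^ 2 = 4 * (x - x0) ^ 2 + 2 * (y - y0) ^ 2).
  { intros x y Uxy. destruct (V x y Uxy) as [E1 E2].
    transitivity ((l1 x y + l2 x y) ^ 2 - 2 * (l1 x y * l2 x y)); [ring|].
    rewrite E1, E2; ring. }
  assert (P1 := smooth_partials _ _ Sl1). assert (P2 := smooth_partials _ _ Sl2).
  destruct (proj1 (proj2 HU)) as [[xb yb] Ub].
  (* The relations are the differentials of [l1 + l2], of the logarithm of the absolute value of
     [l1 l2], and of half of [l1^2 + l2^2]. The weights [[1 : 1/l : l]] trace the conic [X^2 = Y Z],
     which touches the line [Y = 0] at [[0 : 0 : 1]]. *)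
  set (h := fun (l : R -> R -> R) k => match k return R -> R -> R with
    | 0%nat => fun _ _ => 1
    | 1%nat => fun x y => / l x y
    | _ => l end).
  set (u := fun k => match k return R -> R -> R with
    | 0%nat => fun _ _ => 2
    | 1%nat => fun _ _ => 0
    | _ => fun x _ => - 4 * (x - x0) end).
  set (v := fun k => match k return R -> R -> R with
    | 0%nat => fun _ _ => 0
    | 1%nat => fun _ y => - 2 / (y - y0)
    | _ => fun _ y => - 2 * (y - y0) end).
  assert (Hh : forall l k, smooth U l -> (forall x y, U (x, y) -> l x y <> 0) ->
    (k < 3)%nat -> smooth U (h l k) /\ dependent U (h l k) l).
  { intros l [|[|[|k]]] Sl N Lk; [| | |lia]; simpl; split.
    - solve_smooth.
    - apply dependent_const.
    - solve_smooth. auto.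
    - apply dependent_inv; auto.
    - assumption.
    - apply dependent_self. }
  apply (conic_and_two_lines_of_weighted_relations U th1 th2 l1 l2 (h l1) (h l2) u v
    1 0 0 0 (- (1 / 2)) xb yb); auto.
  - intros; now apply H1.
  - intros; now apply H2.
  - intros k Lk.
    destruct (Hh l1 k Sl1 N1 Lk) as [Sh1 Dh1], (Hh l2 k Sl2 N2 Lk) as [Sh2 Dh2].
    split; [exact Sh1|split; [exact Sh2|split; [|split; [|split; [|split; [|split]]]]]]; auto.
    + destruct k as [|[|[|k]]]; [| | |lia]; simpl; solve_smooth; auto.
    + destruct k as [|[|[|k]]]; [| | |lia]; simpl; solve_smooth; auto.
    + intros x y Uxy. destruct k as [|[|[|k]]]; [| | |lia]; simpl; split;
        (eapply Dx_eq || eapply Dy_eq); try solve_partials; try exact Uxy; auto;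
        cbv beta; field; eauto.
    + intros x y Uxy. assert (Y := NY x y Uxy).
      assert (n1 := N1 x y Uxy). assert (n2 := N2 x y Uxy).
      destruct k as [|[|[|k]]]; [| | |lia]; simpl.
      * differentiate oU VS Uxy Ex Ey. split; lra.
      * differentiate oU VP Uxy Ex Ey. assert (E := VP x y Uxy). split.
        -- apply Rmult_eq_reg_l with (l1 x y * l2 x y);
             [|repeat apply Rmult_integral_contrapositive_currified; auto].
           transitivity (Dx l1 x y * l2 x y + l1 x y * Dx l2 x y); [field; auto|].
           lra.
        -- apply Rmult_eq_reg_l with (l1 x y * l2 x y * (y - y0));
             [|repeat apply Rmult_integral_contrapositive_currified; auto].
           transitivity ((Dy l1 x y * l2 x y + l1 x y * Dy l2 x y) * (y - y0)
             - 2 * (l1 x y * l2 x y)); [field; auto|].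
           rewrite E. nra.
      * differentiate oU VQ Uxy Ex Ey. split; lra.
  - assert (Y := NY xb yb Ub). simpl.
    erewrite (Dx_eq U (fun _ _ => 2) _ _ xb yb); 
      [|solve_partials; auto|exact Ub|reflexivity].
    erewrite (Dx_eq U (fun x _ => - 4 * (x - x0)) _ _ xb yb);
      [|solve_partials; auto|exact Ub|reflexivity].
    erewrite (Dx_eq U (fun _ _ => 0) _ _ xb yb);
      [|solve_partials; auto|exact Ub|reflexivity].
    unfold det3. cbv beta.
    replace (_ + _) with (16 / (yb - y0)) by (field; auto).
    unfold Rdiv. apply Rmult_integral_contrapositive_currified; [lra|].
    now apply Rinv_neq_0_compat.
  - lra.
  - intros x y Uxy h' [->| ->]; simpl; field; auto.
Qed.

Lemma quartic_of_confocal_parabolas_y U th1 th2 x0 y0 l1 l2 :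
  plane_domain U -> oblique_net U th1 th2 ->
  smooth U l1 -> smooth U l2 ->
  (forall x y, U (x, y) ->
     (l1 x y <> 0 /\ (x - x0) ^ 2 = 2 * l1 x y * (y - y0) + l1 x y ^ 2) /\
     wedge (function_differential l1) th1 x y = 0) ->
  (forall x y, U (x, y) ->
     (l2 x y <> 0 /\ (x - x0) ^ 2 = 2 * l2 x y * (y - y0) + l2 x y ^ 2) /\
     wedge (function_differential l2) th2 x y = 0) ->
  maximal_rank U 4 (net_with_coordinate_lines th1 th2) /\
  rank_quartic_is_conic_and_two_lines_through_it U (net_with_coordinate_lines th1 th2).
Proof.
  intros HU H Sl1 Sl2 H1 H2. assert (oU := proj1 HU).
  assert (slope : forall th l, smooth U l ->
    (forall x y, U (x, y) ->
       (l x y <> 0 /\ (x - x0) ^ 2 = 2 * l x y * (y - y0) + l x y ^ 2) /\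
       wedge (function_differential l) th x y = 0) ->
    forall x y, U (x, y) -> (x - x0) * cdy th x y = - l x y * cdx th x y).
  { intros th l Sl Hl x y Uxy. assert (Pl := smooth_partials _ _ Sl).
    assert (E := fun x y Uxy => proj2 (proj1 (Hl x y Uxy))).
    differentiate oU E Uxy Ex Ey.
    apply (leaf_slope th l x y (y - y0 + l x y)); [now apply Hl|lra|lra]. }
  assert (T1 := slope th1 l1 Sl1 H1). assert (T2 := slope th2 l2 Sl2 H2).
  assert (NZ := oblique_nonzero _ _ _ H).
  assert (N1 : forall x y, U (x, y) -> l1 x y <> 0) by (intros; now apply H1).
  assert (N2 : forall x y, U (x, y) -> l2 x y <> 0) by (intros; now apply H2).
  assert (NX : forall x y, U (x, y) -> x - x0 <> 0).
  { intros x y Uxy Z. generalize (T1 x y Uxy). rewrite Z, Rmult_0_l. intros E.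
    symmetry in E. apply Rmult_integral in E. destruct (NZ x y Uxy) as (HA & _).
    generalize (N1 x y Uxy). destruct E as [E|E]; [intros N; apply N; lra|tauto]. }
  assert (N12 : forall x y, U (x, y) -> l1 x y <> l2 x y).
  { intros x y Uxy E. destruct (NZ x y Uxy) as (HA & HB & HC & HD).
    assert (E1 := T1 x y Uxy). assert (E2 := T2 x y Uxy). rewrite <- E in E2.
    destruct (common_conormal_zero _ _ _ _ _ _ HA HB HC HD
      (oblique_orthogonal _ _ _ H x y Uxy) E1 E2) as [Z _].
    now apply (NX x y Uxy). }
  assert (V : forall x y, U (x, y) ->
    l1 x y + l2 x y = - 2 * (y - y0) /\ l1 x y * l2 x y = - (x - x0) ^ 2).
  { intros x y Uxy. apply distinct_quadratic_roots; auto.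
    - destruct (H1 x y Uxy) as [[_ E] _]. lra.
    - destruct (H2 x y Uxy) as [[_ E] _]. lra. }
  assert (VS := fun x y Uxy => proj1 (V x y Uxy)).
  assert (VP := fun x y Uxy => proj2 (V x y Uxy)).
  assert (VQ : forall x y, U (x, y) ->
    l1 x y ^ 2 + l2 x y ^ 2 = 2 * (x - x0) ^ 2 + 4 * (y - y0) ^ 2).
  { intros x y Uxy. destruct (V x y Uxy) as [E1 E2].
    transitivity ((l1 x y + l2 x y) ^ 2 - 2 * (l1 x y * l2 x y)); [ring|].
    rewrite E1, E2; ring. }
  assert (P1 := smooth_partials _ _ Sl1). assert (P2 := smooth_partials _ _ Sl2).
  destruct (proj1 (proj2 HU)) as [[xb yb] Ub].
  (* Exchanging the coordinates exchanges the first two weights: the conic is [Y^2 = X Z] and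
     touches the line [X = 0]. *)
  set (h := fun (l : R -> R -> R) k => match k return R -> R -> R with
    | 0%nat => fun x y => / l x y
    | 1%nat => fun _ _ => 1
    | _ => l end).
  set (u := fun k => match k return R -> R -> R with
    | 0%nat => fun x _ => - 2 / (x - x0)
    | 1%nat => fun _ _ => 0
    | _ => fun x _ => - 2 * (x - x0) end).
  set (v := fun k => match k return R -> R -> R with
    | 0%nat => fun _ _ => 0
    | 1%nat => fun _ y => 2
    | _ => fun _ y => - 4 * (y - y0) end).
  assert (Hh : forall l k, smooth U l -> (forall x y, U (x, y) -> l x y <> 0) ->
    (k < 3)%nat -> smooth U (h l k) /\ dependent U (h l k) l).
  { intros l [|[|[|k]]] Sl N Lk; [| | |lia]; simpl; split.
    - solve_smooth. auto.
    - apply dependent_inv; auto.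
    - solve_smooth.
    - apply dependent_const.
    - assumption.
    - apply dependent_self. }
  apply (conic_and_two_lines_of_weighted_relations U th1 th2 l1 l2 (h l1) (h l2) u v
    0 1 0 (- (1 / 2)) 0 xb yb); auto.
  - intros; now apply H1.
  - intros; now apply H2.
  - intros k Lk.
    destruct (Hh l1 k Sl1 N1 Lk) as [Sh1 Dh1], (Hh l2 k Sl2 N2 Lk) as [Sh2 Dh2].
    split; [exact Sh1|split; [exact Sh2|split; [|split; [|split; [|split; [|split]]]]]]; auto.
    + destruct k as [|[|[|k]]]; [| | |lia]; simpl; solve_smooth; auto.
    + destruct k as [|[|[|k]]]; [| | |lia]; simpl; solve_smooth; auto.
    + intros x y Uxy. destruct k as [|[|[|k]]]; [| | |lia]; simpl; split;
        (eapply Dx_eq || eapply Dy_eq); try solve_partials; try exact Uxy; auto;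
        cbv beta; field; eauto.
    + intros x y Uxy. assert (X := NX x y Uxy).
      assert (n1 := N1 x y Uxy). assert (n2 := N2 x y Uxy).
      destruct k as [|[|[|k]]]; [| | |lia]; simpl.
      * differentiate oU VP Uxy Ex Ey. assert (E := VP x y Uxy). split.
        -- apply Rmult_eq_reg_l with (l1 x y * l2 x y * (x - x0));
             [|repeat apply Rmult_integral_contrapositive_currified; auto].
           transitivity ((Dx l1 x y * l2 x y + l1 x y * Dx l2 x y) * (x - x0)
             - 2 * (l1 x y * l2 x y)); [field; auto|].
           rewrite E. nra.
        -- apply Rmult_eq_reg_l with (l1 x y * l2 x y);
             [|repeat apply Rmult_integral_contrapositive_currified; auto].
           transitivity (Dy l1 x y * l2 x y + l1 x y * Dy l2 x y); [field; auto|].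
           lra.
      * differentiate oU VS Uxy Ex Ey. split; lra.
      * differentiate oU VQ Uxy Ex Ey. split; lra.
  - assert (X := NX xb yb Ub). simpl.
    erewrite (Dx_eq U (fun x _ => - 2 / (x - x0)) _ _ xb yb);
      [|solve_partials; auto|exact Ub|reflexivity].
    erewrite (Dx_eq U (fun x _ => - 2 * (x - x0)) _ _ xb yb);
      [|solve_partials; auto|exact Ub|reflexivity].
    erewrite (Dx_eq U (fun _ _ => 0) _ _ xb yb);
      [|solve_partials; auto|exact Ub|reflexivity].
    unfold det3. cbv beta.
    replace (_ + _) with (16 / (xb - x0)) by (field; auto).
    unfold Rdiv. apply Rmult_integral_contrapositive_currified; [lra|].
    now apply Rinv_neq_0_compat.
  - lra.
  - intros x y Uxy h' [->| ->]; simpl; field; auto.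
Qed.

Lemma quartic_of_confocal_net U th1 th2 :
  plane_domain U -> oblique_net U th1 th2 -> confocal_net U th1 th2 ->
  maximal_rank U 4 (net_with_coordinate_lines th1 th2) /\
  rank_quartic_is_conic_and_two_lines_through_it U (net_with_coordinate_lines th1 th2).
Proof.
  intros HU H (E & [a b x0 y0|x0 y0|x0 y0] & (l1 & S1 & H1) & (l2 & S2 & H2)).
  - apply (quartic_of_confocal_central U th1 th2 (a ^ 2) (b ^ 2) x0 y0 l1 l2); auto.
  - apply (quartic_of_confocal_parabolas_x U th1 th2 x0 y0 l1 l2); auto.
  - apply (quartic_of_confocal_parabolas_y U th1 th2 x0 y0 l1 l2); auto.
Qed.

(** * Recognizing leaves on confocal conics *)

Lemma partials_replace U f fx fy gx gy :
  partials U f fx fy ->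
  (forall x y, U (x, y) -> fx x y = gx x y /\ fy x y = gy x y) -> partials U f gx gy.
Proof. intros Hf E x y Uxy. destruct (E x y Uxy) as [<- <-]. now apply Hf. Qed.

Lemma Dx_zero_of_zero U f x y :
  open U -> (forall x y, U (x, y) -> f x y = 0) -> U (x, y) -> Dx f x y = 0.
Proof.
  intros oU E Uxy. apply (Dx_eq U f (fun _ _ => 0) (fun _ _ => 0)); auto.
  apply partials_ext_fun with (fun _ _ => 0); auto using partials_const.
  intros; symmetry; auto.
Qed.

Lemma Dy_zero_of_zero U f x y :
  open U -> (forall x y, U (x, y) -> f x y = 0) -> U (x, y) -> Dy f x y = 0.
Proof.
  intros oU E Uxy. apply (Dy_eq U f (fun _ _ => 0) (fun _ _ => 0)); auto.
  apply partials_ext_fun with (fun _ _ => 0); auto using partials_const.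
  intros; symmetry; auto.
Qed.

(** Up to a shift of the parameter a confocal family depends only on [a^2 - b^2]; the sign of [k]
    decides on which axis the foci lie. *)
Lemma exists_square_difference k : exists a b, a ^ 2 - b ^ 2 = k.
Proof.
  destruct (Rle_dec 0 k).
  - exists (sqrt k), 0. rewrite pow2_sqrt; lra.
  - exists 0, (sqrt (- k)). rewrite pow2_sqrt; lra.
Qed.

(** A quarter turn changes the sign of both [A^2 - B^2] and [A B], so an equation found for the
    first foliation carries over to the second. *)
Lemma orthogonal_conormal_equation A B C D al be :
  A <> 0 -> A * C + B * D = 0 -> al * (A ^ 2 - B ^ 2) = be * (A * B) ->
  al * (C ^ 2 - D ^ 2) = be * (C * D).
Proof.
  intros HA O E. apply Rmult_eq_reg_l with (A ^ 2); [|now apply pow_nonzero].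
  assert (HC : A * C = - B * D) by lra.
  transitivity (al * ((A * C) ^ 2 - A ^ 2 * D ^ 2)); [ring|].
  transitivity (be * A * (A * C) * D); [|ring].
  rewrite HC. transitivity (- D ^ 2 * (al * (A ^ 2 - B ^ 2))); [ring|].
  rewrite E; ring.
Qed.

Section Leaves.

Context (U : R * R -> Prop) (th : one_form) (oU : open U) (Sth : smooth_form U th)
  (Nth : forall x y, U (x, y) -> cdx th x y <> 0 /\ cdy th x y <> 0).

(** The converse of [leaf_slope]: here [(p, q)] is nonzero, which forces [g] to be nonzero. *)
Lemma wedge_zero_of_slope l g p q x y :
  U (x, y) -> p <> 0 \/ q <> 0 -> Dx l x y * g = p -> Dy l x y * g = q ->
  p * cdy th x y = q * cdx th x y -> wedge (function_differential l) th x y = 0.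
Proof.
  intros Uxy N <- <- E. unfold wedge; simpl. fold (Dx l x y) (Dy l x y).
  assert (G : g <> 0).
  { intros ->. rewrite !Rmult_0_r in N. lra. }
  apply Rmult_eq_reg_l with g; auto. lra.
Qed.

Lemma leaves_on_central (a b x0 y0 : R) :
  a ^ 2 - b ^ 2 <> 0 ->
  (forall x y, U (x, y) -> x - x0 <> 0 /\ y - y0 <> 0 /\
     (x - x0) * (y - y0) * (cdx th x y ^ 2 - cdy th x y ^ 2) =
     ((x - x0) ^ 2 - (y - y0) ^ 2 - (a ^ 2 - b ^ 2)) * (cdx th x y * cdy th x y)) ->
  leaves_on_family U th (fun lam x y =>
      a ^ 2 - lam <> 0 /\ b ^ 2 - lam <> 0 /\
      (x - x0) ^ 2 / (a ^ 2 - lam) + (y - y0) ^ 2 / (b ^ 2 - lam) = 1).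
Proof.
  set (A := a ^ 2). set (B := b ^ 2). clearbody A B.
  intros HAB H. destruct Sth as [SP SR].
  set (P := cdx th) in *. set (Q := cdy th) in *.
  (* With [X = x - x0] and [Y = y - y0], the equation of the net is equivalent to
     [(A - B) P Q = (X Q - Y P) (X P + Y Q)], and its left side has no zeros. *)
  assert (M0 : forall x y, U (x, y) -> (x - x0) * Q x y - (y - y0) * P x y <> 0).
  { intros x y Uxy Z. destruct (H x y Uxy) as (X & Y & E), (Nth x y Uxy) as [NP NR].
    assert (Z' : (x - x0) * Q x y = (y - y0) * P x y) by lra.
    apply HAB. apply Rmult_eq_reg_r with (P x y * Q x y);
      [|now apply Rmult_integral_contrapositive_currified].
    transitivity (((x - x0) ^ 2 - (y - y0) ^ 2) * (P x y * Q x y)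
      - (x - x0) * (y - y0) * (P x y ^ 2 - Q x y ^ 2)); [rewrite E; ring|].
    transitivity (((x - x0) * Q x y - (y - y0) * P x y)
      * ((x - x0) * P x y + (y - y0) * Q x y)); [ring|].
    rewrite Z; ring. }
  (* The relation of [confocal_leaf_slope] is linear in the parameter; this is its solution. *)
  set (l := fun x y => ((x - x0) * B * Q x y - (y - y0) * A * P x y)
                       / ((x - x0) * Q x y - (y - y0) * P x y)).
  assert (Sl : smooth U l).
  { unfold l. solve_smooth. auto. }
  assert (EA : forall x y, U (x, y) ->
    A - l x y = (A - B) * (x - x0) * Q x y / ((x - x0) * Q x y - (y - y0) * P x y)).
  { intros x y Uxy. unfold l. field. auto. }
  assert (EB : forall x y, U (x, y) ->
    B - l x y = (A - B) * (y - y0) * P x y / ((x - x0) * Q x y - (y - y0) * P x y)).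
  { intros x y Uxy. unfold l. field. auto. }
  assert (NA : forall x y, U (x, y) -> A - l x y <> 0).
  { intros x y Uxy. rewrite EA; auto. destruct (H x y Uxy) as (X & Y & _), (Nth x y Uxy).
    unfold Rdiv. repeat apply Rmult_integral_contrapositive_currified; auto.
    apply Rinv_neq_0_compat; auto. }
  assert (NB : forall x y, U (x, y) -> B - l x y <> 0).
  { intros x y Uxy. rewrite EB; auto. destruct (H x y Uxy) as (X & Y & _), (Nth x y Uxy).
    unfold Rdiv. repeat apply Rmult_integral_contrapositive_currified; auto.
    apply Rinv_neq_0_compat; auto. }
  assert (C : forall x y, U (x, y) -> on_conic A B x0 y0 (l x y) x y).
  { intros x y Uxy. split; [|split]; auto.
    rewrite EA, EB; auto. destruct (H x y Uxy) as (X & Y & E), (Nth x y Uxy) as [NP NR].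
    assert (M := M0 x y Uxy). fold P Q in NP, NR.
    apply Rmult_eq_reg_r with ((A - B) * (P x y * Q x y));
      [|now repeat apply Rmult_integral_contrapositive_currified].
    transitivity (((x - x0) * Q x y - (y - y0) * P x y)
      * ((x - x0) * P x y + (y - y0) * Q x y)); [field; auto 10|].
    transitivity (((x - x0) ^ 2 - (y - y0) ^ 2) * (P x y * Q x y)
      - (x - x0) * (y - y0) * (P x y ^ 2 - Q x y ^ 2)); [ring|].
    rewrite E; ring. }
  exists l. split; [exact Sl|]. intros x y Uxy. split; [now apply C|].
  assert (Pl := smooth_partials _ _ Sl).
  assert (E := fun x y Uxy => on_conic_polynomial _ _ _ _ _ _ _ (C x y Uxy)).
  differentiate oU E Uxy Ex Ey.
  destruct (H x y Uxy) as (X & Y & _).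
  apply (wedge_zero_of_slope l (((x - x0) ^ 2 + (y - y0) ^ 2 - A - B) / 2 + l x y)
    ((x - x0) * (B - l x y)) ((y - y0) * (A - l x y))); auto.
  - lra.
  - lra.
  - rewrite EA, EB; auto. fold P Q. field. auto.
Qed.

Lemma leaves_on_parabolas_x (x0 y0 : R) :
  (forall x y, U (x, y) -> y - y0 <> 0 /\
     (y - y0) * (cdx th x y ^ 2 - cdy th x y ^ 2) =
     2 * (x - x0) * (cdx th x y * cdy th x y)) ->
  leaves_on_family U th (fun lam x y =>
      lam <> 0 /\ (y - y0) ^ 2 = 2 * lam * (x - x0) + lam ^ 2).
Proof.
  intros H. destruct Sth as [SP SR].
  (* The solution of the slope relation of the parabolas, [- l * cdy th = (y - y0) * cdx th]. *)
  set (l := fun x y => - (y - y0) * cdx th x y / cdy th x y).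
  assert (NR : forall x y, U (x, y) -> cdy th x y <> 0) by (intros; now apply Nth).
  assert (Sl : smooth U l) by (unfold l; solve_smooth; auto).
  assert (C : forall x y, U (x, y) ->
    l x y <> 0 /\ (y - y0) ^ 2 = 2 * l x y * (x - x0) + l x y ^ 2).
  { intros x y Uxy. destruct (H x y Uxy) as (Y & E), (Nth x y Uxy) as [HP HR].
    split.
    - unfold l, Rdiv. repeat apply Rmult_integral_contrapositive_currified;
        auto using Rinv_neq_0_compat. lra.
    - unfold l. apply Rmult_eq_reg_r with (cdy th x y ^ 2); [|now apply pow_nonzero].
      transitivity ((y - y0) * ((y - y0) * cdx th x y ^ 2
        - (y - y0) * (cdx th x y ^ 2 - cdy th x y ^ 2))); [ring|].
      rewrite E. field. auto. }
  exists l. split; [exact Sl|]. intros x y Uxy. split; [now apply C|].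
  assert (Pl := smooth_partials _ _ Sl).
  assert (E := fun x y Uxy => proj2 (C x y Uxy)).
  differentiate oU E Uxy Ex Ey.
  apply (wedge_zero_of_slope l (x - x0 + l x y) (- l x y) (y - y0)); auto.
  - right. apply (H x y Uxy).
  - lra.
  - lra.
  - unfold l. field. auto.
Qed.

Lemma leaves_on_parabolas_y (x0 y0 : R) :
  (forall x y, U (x, y) -> x - x0 <> 0 /\
     (x - x0) * (cdx th x y ^ 2 - cdy th x y ^ 2) =
     - 2 * (y - y0) * (cdx th x y * cdy th x y)) ->
  leaves_on_family U th (fun lam x y =>
      lam <> 0 /\ (x - x0) ^ 2 = 2 * lam * (y - y0) + lam ^ 2).
Proof.
  intros H. destruct Sth as [SP SR].
  set (l := fun x y => - (x - x0) * cdy th x y / cdx th x y).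
  assert (NP : forall x y, U (x, y) -> cdx th x y <> 0) by (intros; now apply Nth).
  assert (Sl : smooth U l) by (unfold l; solve_smooth; auto).
  assert (C : forall x y, U (x, y) ->
    l x y <> 0 /\ (x - x0) ^ 2 = 2 * l x y * (y - y0) + l x y ^ 2).
  { intros x y Uxy. destruct (H x y Uxy) as (X & E), (Nth x y Uxy) as [HP HR].
    split.
    - unfold l, Rdiv. repeat apply Rmult_integral_contrapositive_currified;
        auto using Rinv_neq_0_compat. lra.
    - unfold l. apply Rmult_eq_reg_r with (cdx th x y ^ 2); [|now apply pow_nonzero].
      transitivity ((x - x0) * ((x - x0) * cdy th x y ^ 2
        + (x - x0) * (cdx th x y ^ 2 - cdy th x y ^ 2))); [ring|].
      rewrite E. field. auto. }
  exists l. split; [exact Sl|]. intros x y Uxy. split; [now apply C|].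
  assert (Pl := smooth_partials _ _ Sl).
  assert (E := fun x y Uxy => proj2 (C x y Uxy)).
  differentiate oU E Uxy Ex Ey.
  apply (wedge_zero_of_slope l (y - y0 + l x y) (x - x0) (- l x y)); auto.
  - left. apply (H x y Uxy).
  - lra.
  - lra.
  - unfold l. field. auto.
Qed.

End Leaves.

(** * Coordinates adapted to the rank quartic *)

Lemma sum_of_squares_zero a b c :
  a ^ 2 + b ^ 2 + c ^ 2 = 0 -> a = 0 /\ b = 0 /\ c = 0.
Proof.
  intros E. assert (Ha := pow2_ge_0 a). assert (Hb := pow2_ge_0 b).
  assert (Hc := pow2_ge_0 c). repeat split; apply Rsqr_0_uniq; unfold Rsqr; lra.
Qed.

(* For two distinct lines [L1], [L2] meeting at a point [e] of the conic [Q], take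
   [L2], [L1] and the linear form [L3] with coefficients [e] as coordinates: then
   [e] becomes [0 : 0 : 1] and the form of [Q] loses its third square. *)
Lemma adapted_coordinates a b c d e f l1 m1 n1 l2 m2 n2 X0 Y0 Z0 :
  a * b * c + 2 * d * e * f - a * f ^ 2 - b * e ^ 2 - c * d ^ 2 <> 0 ->
  l1 <> 0 \/ m1 <> 0 \/ n1 <> 0 ->
  (exists X Y Z, l1 * X + m1 * Y + n1 * Z = 0 /\ l2 * X + m2 * Y + n2 * Z <> 0) ->
  X0 <> 0 \/ Y0 <> 0 \/ Z0 <> 0 ->
  l1 * X0 + m1 * Y0 + n1 * Z0 = 0 -> l2 * X0 + m2 * Y0 + n2 * Z0 = 0 ->
  a * X0 ^ 2 + b * Y0 ^ 2 + c * Z0 ^ 2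
    + 2 * d * X0 * Y0 + 2 * e * X0 * Z0 + 2 * f * Y0 * Z0 = 0 ->
  det3 l2 m2 n2 l1 m1 n1 X0 Y0 Z0 <> 0 /\
  exists q11 q22 q12 q13 q23,
    2 * q12 * q13 * q23 - q11 * q23 ^ 2 - q22 * q13 ^ 2 <> 0 /\
    forall X Y Z,
      let S := l2 * X + m2 * Y + n2 * Z in
      let T := l1 * X + m1 * Y + n1 * Z in
      let W := X0 * X + Y0 * Y + Z0 * Z in
      a * X ^ 2 + b * Y ^ 2 + c * Z ^ 2 + 2 * d * X * Y + 2 * e * X * Z + 2 * f * Y * Z
      = q11 * S ^ 2 + q22 * T ^ 2 + 2 * q12 * S * T + 2 * q13 * S * W + 2 * q23 * T * W.
Proof.
  intros HQ HL1 (Xp & Yp & Zp & Lp1 & Lp2) HE E1 E2 EQ.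
  assert (NE : 0 < X0 ^ 2 + Y0 ^ 2 + Z0 ^ 2).
  { assert (0 <= X0 ^ 2) by apply pow2_ge_0. assert (0 <= Y0 ^ 2) by apply pow2_ge_0.
    assert (0 <= Z0 ^ 2) by apply pow2_ge_0.
    destruct HE as [N|[N|N]]; apply pow2_gt_0 in N; lra. }
  set (dd := det3 l2 m2 n2 l1 m1 n1 X0 Y0 Z0).
  assert (Hd : dd <> 0).
  { intros Z.
    (* Gram's identity, [e] being orthogonal to [L1] and [L2] *)
    assert (G : dd ^ 2 = (X0 ^ 2 + Y0 ^ 2 + Z0 ^ 2) *
      ((m1 * n2 - n1 * m2) ^ 2 + (n1 * l2 - l1 * n2) ^ 2 + (l1 * m2 - m1 * l2) ^ 2)).
    { set (s1 := l1 * X0 + m1 * Y0 + n1 * Z0) in E1.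
      set (s2 := l2 * X0 + m2 * Y0 + n2 * Z0) in E2.
      transitivity ((X0 ^ 2 + Y0 ^ 2 + Z0 ^ 2) *
        ((m1 * n2 - n1 * m2) ^ 2 + (n1 * l2 - l1 * n2) ^ 2 + (l1 * m2 - m1 * l2) ^ 2)
        - s1 ^ 2 * (l2 ^ 2 + m2 ^ 2 + n2 ^ 2) - s2 ^ 2 * (l1 ^ 2 + m1 ^ 2 + n1 ^ 2)
        + 2 * s1 * s2 * (l1 * l2 + m1 * m2 + n1 * n2)).
      - unfold dd, det3, s1, s2. ring.
      - rewrite E1, E2. ring. }
    rewrite Z in G. symmetry in G. replace (0 ^ 2) with 0 in G by ring.
    apply Rmult_integral in G as [G|G]; [lra|].
    destruct (sum_of_squares_zero _ _ _ G) as (C1 & C2 & C3).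
    assert (l1 * (l2 * Xp + m2 * Yp + n2 * Zp) = 0).
    { transitivity (l2 * (l1 * Xp + m1 * Yp + n1 * Zp) + (l1 * m2 - m1 * l2) * Yp
        - (n1 * l2 - l1 * n2) * Zp); [ring|]. rewrite Lp1, C2, C3; ring. }
    assert (m1 * (l2 * Xp + m2 * Yp + n2 * Zp) = 0).
    { transitivity (m2 * (l1 * Xp + m1 * Yp + n1 * Zp) - (l1 * m2 - m1 * l2) * Xp
        + (m1 * n2 - n1 * m2) * Zp); [ring|]. rewrite Lp1, C1, C3; ring. }
    assert (n1 * (l2 * Xp + m2 * Yp + n2 * Zp) = 0).
    { transitivity (n2 * (l1 * Xp + m1 * Yp + n1 * Zp) + (n1 * l2 - l1 * n2) * Xp
        - (m1 * n2 - n1 * m2) * Yp); [ring|]. rewrite Lp1, C1, C2; ring. }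
    repeat match goal with H : _ * _ = 0 |- _ => apply Rmult_integral in H end.
    tauto. }
  split; [exact Hd|].
  (* The columns of the inverse matrix: points whose coordinates in the linear forms [S], [T], [W]
     are the unit vectors. *)
  destruct (det3_solve _ _ _ _ _ _ _ _ _ 1 0 0 Hd) as (p1 & p2 & p3 & P1 & P2 & P3).
  destruct (det3_solve _ _ _ _ _ _ _ _ _ 0 1 0 Hd) as (r1 & r2 & r3 & R1 & R2 & R3).
  destruct (det3_solve _ _ _ _ _ _ _ _ _ 0 0 1 Hd) as (t1 & t2 & t3 & T1 & T2 & T3).
  (* The polar form of the conic; its values on the new basis are the new coefficients. *)
  set (bil := fun x1 x2 x3 y1 y2 y3 => a * x1 * y1 + b * x2 * y2 + c * x3 * y3
    + d * (x1 * y2 + x2 * y1) + e * (x1 * y3 + x3 * y1) + f * (x2 * y3 + x3 * y2)).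
  assert (dec : forall X Y Z,
    let S := l2 * X + m2 * Y + n2 * Z in
    let T := l1 * X + m1 * Y + n1 * Z in
    let W := X0 * X + Y0 * Y + Z0 * Z in
    X = S * p1 + T * r1 + W * t1 /\ Y = S * p2 + T * r2 + W * t2 /\
    Z = S * p3 + T * r3 + W * t3).
  { intros X Y Z S T W.
    destruct (det3_unique _ _ _ _ _ _ _ _ _ (X - (S * p1 + T * r1 + W * t1))
      (Y - (S * p2 + T * r2 + W * t2)) (Z - (S * p3 + T * r3 + W * t3)) Hd) as (D1 & D2 & D3).
    - transitivity (S - S * (l2 * p1 + m2 * p2 + n2 * p3) - T * (l2 * r1 + m2 * r2 + n2 * r3)
        - W * (l2 * t1 + m2 * t2 + n2 * t3)); [unfold S; ring|]. rewrite P1, R1, T1; ring.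
    - transitivity (T - S * (l1 * p1 + m1 * p2 + n1 * p3) - T * (l1 * r1 + m1 * r2 + n1 * r3)
        - W * (l1 * t1 + m1 * t2 + n1 * t3)); [unfold T; ring|]. rewrite P2, R2, T2; ring.
    - transitivity (W - S * (X0 * p1 + Y0 * p2 + Z0 * p3) - T * (X0 * r1 + Y0 * r2 + Z0 * r3)
        - W * (X0 * t1 + Y0 * t2 + Z0 * t3)); [unfold W; ring|]. rewrite P3, R3, T3; ring.
    - repeat split; lra. }
  (* The common point of the lines has [S = T = 0], so it is a nonzero multiple of [(t1, t2, t3)],
     and it lies on the conic. *)
  assert (q33 : bil t1 t2 t3 t1 t2 t3 = 0).
  { destruct (dec X0 Y0 Z0) as (D1 & D2 & D3). rewrite E1, E2 in D1, D2, D3.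
    set (n := X0 * X0 + Y0 * Y0 + Z0 * Z0) in *.
    assert (Hn : n <> 0) by (unfold n; lra).
    apply Rmult_eq_reg_l with (n ^ 2); [|now apply pow_nonzero].
    transitivity (bil (n * t1) (n * t2) (n * t3) (n * t1) (n * t2) (n * t3));
      [unfold bil; ring|].
    replace (n * t1) with X0 by lra. replace (n * t2) with Y0 by lra.
    replace (n * t3) with Z0 by lra. unfold bil. lra. }
  set (q11 := bil p1 p2 p3 p1 p2 p3). set (q22 := bil r1 r2 r3 r1 r2 r3).
  set (q12 := bil p1 p2 p3 r1 r2 r3). set (q13 := bil p1 p2 p3 t1 t2 t3).
  set (q23 := bil r1 r2 r3 t1 t2 t3).
  exists q11, q22, q12, q13, q23. split.
  (* The determinant of the form is multiplied by the square of the determinant of the change of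
     basis, so it stays nonzero. *)
  - assert (DP : det3 p1 r1 t1 p2 r2 t2 p3 r3 t3 <> 0).
    { intros Z. assert (O : dd * det3 p1 r1 t1 p2 r2 t2 p3 r3 t3 = 1).
      { transitivity (det3
          (l2 * p1 + m2 * p2 + n2 * p3) (l2 * r1 + m2 * r2 + n2 * r3) (l2 * t1 + m2 * t2 + n2 * t3)
          (l1 * p1 + m1 * p2 + n1 * p3) (l1 * r1 + m1 * r2 + n1 * r3) (l1 * t1 + m1 * t2 + n1 * t3)
          (X0 * p1 + Y0 * p2 + Z0 * p3) (X0 * r1 + Y0 * r2 + Z0 * r3) (X0 * t1 + Y0 * t2 + Z0 * t3)).
        - unfold dd, det3. ring.
        - rewrite P1, P2, P3, R1, R2, R3, T1, T2, T3. unfold det3. ring. }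
      rewrite Z in O. lra. }
    replace (2 * q12 * q13 * q23 - q11 * q23 ^ 2 - q22 * q13 ^ 2) with
      (det3 p1 r1 t1 p2 r2 t2 p3 r3 t3 ^ 2
        * (a * b * c + 2 * d * e * f - a * f ^ 2 - b * e ^ 2 - c * d ^ 2)).
    + apply Rmult_integral_contrapositive_currified; auto. now apply pow_nonzero.
    + transitivity (q11 * q22 * bil t1 t2 t3 t1 t2 t3 + 2 * q12 * q13 * q23
        - q11 * q23 ^ 2 - q22 * q13 ^ 2 - bil t1 t2 t3 t1 t2 t3 * q12 ^ 2);
        [|rewrite q33; ring].
      unfold q11, q22, q12, q13, q23, bil, det3. ring.
  - intros X Y Z S T W. destruct (dec X Y Z) as (D1 & D2 & D3). fold S T W in D1, D2, D3.
    transitivity (q11 * S ^ 2 + q22 * T ^ 2 + bil t1 t2 t3 t1 t2 t3 * W ^ 2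
      + 2 * q12 * S * T + 2 * q13 * S * W + 2 * q23 * T * W); [|rewrite q33; ring].
    clearbody S T W. rewrite D1, D2, D3. unfold q11, q22, q12, q13, q23, bil. ring.
Qed.

(* The coordinate components of a basis of Abelian relations in which the first
   has no component along [y = const] and the second none along [x = const]: they
   are [u1 dx + 0 dy], [0 dx + v2 dy] and [u3 dx + v3 dy]. The conic containing
   the arcs of the net is [q11 X^2 + q22 Y^2 + 2 q12 X Y + 2 q13 X Z + 2 q23 Y Z];
   up to factors, the points of these arcs are the projections
   [u A + v B] and [u B - v A] of the relations on the conormals [(A, B)] and
   [(B, - A)] of the two foliations. *)
Record adapted_relations (U : R * R -> Prop) (A B u1 v2 u3 v3 : R -> R -> R)
    (q11 q22 q12 q13 q23 : R) : Prop := {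
  adapted_u1 : smooth U u1;
  adapted_v2 : smooth U v2;
  adapted_u3 : smooth U u3;
  adapted_v3 : smooth U v3;
  adapted_partials : forall x y, U (x, y) ->
    Dy u1 x y = 0 /\ Dx v2 x y = 0 /\ Dy u3 x y = 0 /\ Dx v3 x y = 0;
  adapted_nonzero : forall x y, U (x, y) -> u1 x y <> 0 /\ v2 x y <> 0;
  adapted_equation : forall x y, U (x, y) ->
    Dx u3 x y - u3 x y * Dx u1 x y / u1 x y = Dy v3 x y - v3 x y * Dy v2 x y / v2 x y;
  adapted_free : forall c1 c2,
    ~ (forall x y, U (x, y) -> u3 x y = c1 * u1 x y /\ v3 x y = c2 * v2 x y);
  adapted_det : 2 * q12 * q13 * q23 - q11 * q23 ^ 2 - q22 * q13 ^ 2 <> 0;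
  adapted_arc1 : forall x y, U (x, y) ->
    let X := u1 x y * A x y in
    let Y := v2 x y * B x y in
    let Z := u3 x y * A x y + v3 x y * B x y in
    q11 * X ^ 2 + q22 * Y ^ 2 + 2 * q12 * X * Y + 2 * q13 * X * Z + 2 * q23 * Y * Z = 0;
  adapted_arc2 : forall x y, U (x, y) ->
    let X := u1 x y * B x y in
    let Y := - (v2 x y * A x y) in
    let Z := u3 x y * B x y - v3 x y * A x y in
    q11 * X ^ 2 + q22 * Y ^ 2 + 2 * q12 * X * Y + 2 * q13 * X * Z + 2 * q23 * Y * Z = 0 }.

Lemma relation_zero_of_coordinates U th1 th2 b (c : nat -> R) :
  oblique_net U th1 th2 ->
  (forall k, (k < 3)%nat ->
     abelian_relation U 4 (net_with_coordinate_lines th1 th2) (b k)) ->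
  (forall x y, U (x, y) ->
     c 0%nat * cdx (b 0%nat 2%nat) x y + c 1%nat * cdx (b 1%nat 2%nat) x y
       + c 2%nat * cdx (b 2%nat 2%nat) x y = 0 /\
     c 0%nat * cdy (b 0%nat 3%nat) x y + c 1%nat * cdy (b 1%nat 3%nat) x y
       + c 2%nat * cdy (b 2%nat 3%nat) x y = 0) ->
  forall i x y, (i < 4)%nat -> U (x, y) ->
    Rsum 3 (fun k => c k * cdx (b k i) x y) = 0 /\
    Rsum 3 (fun k => c k * cdy (b k i) x y) = 0.
Proof.
  intros H Hb Hc i x y Hi Uxy. unfold Rsum; simpl.
  destruct (Hc x y Uxy) as [Z1 Z2].
  assert (N := conormal_sq_neq_0 U th1 th2 x y H Uxy).
  destruct (relation_components U th1 th2 _ x y H (Hb 0%nat ltac:(lia)) Uxy)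
    as (a1 & a2 & a3 & a4 & a5 & a6).
  destruct (relation_components U th1 th2 _ x y H (Hb 1%nat ltac:(lia)) Uxy)
    as (b1 & b2 & b3 & b4 & b5 & b6).
  destruct (relation_components U th1 th2 _ x y H (Hb 2%nat ltac:(lia)) Uxy)
    as (d1 & d2 & d3 & d4 & d5 & d6).
  set (A := cdx th1 x y) in *. set (B := cdy th1 x y) in *.
  set (u0 := cdx (b 0%nat 2%nat) x y) in *. set (v0 := cdy (b 0%nat 3%nat) x y) in *.
  set (u1 := cdx (b 1%nat 2%nat) x y) in *. set (v1 := cdy (b 1%nat 3%nat) x y) in *.
  set (u2 := cdx (b 2%nat 2%nat) x y) in *. set (v2 := cdy (b 2%nat 3%nat) x y) in *.
  set (su := c 0%nat * u0 + c 1%nat * u1 + c 2%nat * u2) in Z1.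
  set (sv := c 0%nat * v0 + c 1%nat * v1 + c 2%nat * v2) in Z2.
  destruct i as [|[|[|[|i]]]]; [| | | |lia].
  - rewrite a3, a4, b3, b4, d3, d4. split.
    + transitivity (- A * (su * A + sv * B) / conormal_sq th1 x y);
        [unfold su, sv; field; auto|rewrite Z1, Z2; field; auto].
    + transitivity (- B * (su * A + sv * B) / conormal_sq th1 x y);
        [unfold su, sv; field; auto|rewrite Z1, Z2; field; auto].
  - rewrite a5, a6, b5, b6, d5, d6. split.
    + transitivity (- B * (su * B - sv * A) / conormal_sq th1 x y);
        [unfold su, sv; field; auto|rewrite Z1, Z2; field; auto].
    + transitivity (A * (su * B - sv * A) / conormal_sq th1 x y);
        [unfold su, sv; field; auto|rewrite Z1, Z2; field; auto].
  - rewrite a1, b1, d1. fold u0 u1 u2. unfold su in Z1. split; lra.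
  - rewrite a2, b2, d2. fold v0 v1 v2. unfold sv in Z2. split; lra.
Qed.

(** The basis is combined with the coefficients of [L2], of [L1] and of the common point
    [(X0, Y0, Z0)], the same vectors as in [adapted_coordinates]. *)
Lemma adapted_relations_of_quartic U th1 th2 :
  plane_domain U -> oblique_net U th1 th2 ->
  rank_quartic_is_conic_and_two_lines_through_it U (net_with_coordinate_lines th1 th2) ->
  exists u1 v2 u3 v3 q11 q22 q12 q13 q23,
    adapted_relations U (cdx th1) (cdy th1) u1 v2 u3 v3 q11 q22 q12 q13 q23.
Proof.
  intros HU H (bs & F & (Hb & Hind & _) & (_ & HF) & Q & L1 & L2 &
    (a & b & c & d & e & f & HQ & EQ) & (l1 & m1 & n1 & NL1 & EL1) & (l2 & m2 & n2 & NL2 & EL2) &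
    EF & (Xp & Yp & Zp & Lp1 & Lp2) & (X0 & Y0 & Z0 & N0 & L10 & L20 & Q0) & A2 & A3).
  assert (oU := proj1 HU).
  rewrite EL1 in Lp1, L10. rewrite EL2 in Lp2, L20. rewrite EQ in Q0.
  destruct (adapted_coordinates a b c d e f l1 m1 n1 l2 m2 n2 X0 Y0 Z0 HQ NL1
    (ex_intro _ Xp (ex_intro _ Yp (ex_intro _ Zp (conj Lp1 Lp2)))) N0 L10 L20 Q0)
    as (Hdet & q11 & q22 & q12 & q13 & q23 & Hq & Eq).
  destruct (reduced_relation_of_abelian U th1 th2 H) as (al & be & Sal & Sbe & Hred).
  assert (R0 := Hred _ (Hb 0%nat ltac:(lia))).
  assert (R1 := Hred _ (Hb 1%nat ltac:(lia))).
  assert (R2 := Hred _ (Hb 2%nat ltac:(lia))).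
  assert (RC := fun k Lk x y => relation_components U th1 th2 _ x y H (Hb k Lk)).
  set (u := fun k => cdx (bs k 2%nat)). set (v := fun k => cdy (bs k 3%nat)).
  fold (u 0%nat) (v 0%nat) in R0. fold (u 1%nat) (v 1%nat) in R1.
  fold (u 2%nat) (v 2%nat) in R2.
  set (comb := fun l m n (w : nat -> R -> R -> R) x y =>
    l * w 0%nat x y + 1 * (m * w 1%nat x y + n * w 2%nat x y)).
  assert (Rcomb : forall l m n, reduced_relation U al be (comb l m n u) (comb l m n v)).
  { intros l m n. apply (reduced_relation_comb U al be (u 0%nat) (v 0%nat)); auto.
    now apply reduced_relation_comb. }
  (* The arc of [x = const] consists of the points with coordinates [u 0], [u 1], [u 2]; that it
     lies on [L1] is this linear relation. *)
  assert (Z1 : forall x y, U (x, y) -> comb l1 m1 n1 u x y = 0).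
  { intros x y Uxy.
    destruct (RC 0%nat ltac:(lia) x y Uxy) as (E0 & _).
    destruct (RC 1%nat ltac:(lia) x y Uxy) as (E1 & _).
    destruct (RC 2%nat ltac:(lia) x y Uxy) as (E2 & _).
    assert (E := A2 x y Uxy (u 0%nat x y) (u 1%nat x y) (u 2%nat x y)).
    simpl in E. rewrite E0, E1, E2, EL1 in E. unfold comb.
    transitivity (l1 * u 0%nat x y + m1 * u 1%nat x y + n1 * u 2%nat x y); [ring|].
    unfold u in *. apply E; ring. }
  assert (Z2 : forall x y, U (x, y) -> comb l2 m2 n2 v x y = 0).
  { intros x y Uxy.
    destruct (RC 0%nat ltac:(lia) x y Uxy) as (_ & E0 & _).
    destruct (RC 1%nat ltac:(lia) x y Uxy) as (_ & E1 & _).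
    destruct (RC 2%nat ltac:(lia) x y Uxy) as (_ & E2 & _).
    assert (E := A3 x y Uxy (v 0%nat x y) (v 1%nat x y) (v 2%nat x y)).
    simpl in E. rewrite E0, E1, E2, EL2 in E. unfold comb.
    transitivity (l2 * v 0%nat x y + m2 * v 1%nat x y + n2 * v 2%nat x y); [ring|].
    unfold v in *. apply E; ring. }
  assert (free : forall l m n, (forall x y, U (x, y) ->
    comb l m n u x y = 0 /\ comb l m n v x y = 0) -> l = 0 /\ m = 0 /\ n = 0).
  { intros l m n Hz.
    set (k := fun i => match i with 0%nat => l | 1%nat => m | _ => n end).
    assert (Hk := fun E => Hind k (relation_zero_of_coordinates U th1 th2 bs k H Hb E)).
    lapply Hk; [clear Hk; intros Hk|].
    2:{ intros x y Uxy. destruct (Hz x y Uxy) as [G1 G2]. split.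
        - rewrite <- G1. unfold comb, u, k. ring.
        - rewrite <- G2. unfold comb, v, k. ring. }
    split; [apply (Hk 0%nat); lia|split; [apply (Hk 1%nat); lia|apply (Hk 2%nat); lia]]. }
  destruct (Rcomb l1 m1 n1) as (S1u & S1v & E1).
  destruct (Rcomb l2 m2 n2) as (S2u & S2v & E2).
  destruct (Rcomb X0 Y0 Z0) as (S3u & S3v & E3).
  assert (D1 := fun x y Uxy => Dx_zero_of_zero U _ x y oU Z1 Uxy).
  assert (D2 := fun x y Uxy => Dy_zero_of_zero U _ x y oU Z2 Uxy).
  (* As the [v] component is identically zero, the relation gives [u_x = al u]. At a zero of [u] all
     initial data would vanish, hence the whole relation, against the independence of the basis. *)
  assert (Nu : forall x y, U (x, y) -> comb l2 m2 n2 u x y <> 0).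
  { intros x y Uxy E. destruct (E2 x y Uxy) as (_ & _ & E').
    assert (Dz : Dx (comb l2 m2 n2 u) x y = 0).
    { rewrite D2, E, (Z2 x y Uxy) in E' by auto. lra. }
    assert (Hz := reduced_relation_zero U al be _ _ x y HU Sal Sbe (Rcomb l2 m2 n2) Uxy
      E (Z2 x y Uxy) Dz).
    destruct (free l2 m2 n2 Hz) as (? & ? & ?). lra. }
  assert (Nv : forall x y, U (x, y) -> comb l1 m1 n1 v x y <> 0).
  { intros x y Uxy E.
    assert (Hz := reduced_relation_zero U al be _ _ x y HU Sal Sbe (Rcomb l1 m1 n1) Uxy
      (Z1 x y Uxy) E (D1 x y Uxy)).
    destruct (free l1 m1 n1 Hz) as (? & ? & ?). lra. }
  assert (NZ := oblique_nonzero _ _ _ H).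
  assert (NC := fun x y => conormal_sq_neq_0 U th1 th2 x y H).
  exists (comb l2 m2 n2 u), (comb l1 m1 n1 v), (comb X0 Y0 Z0 u), (comb X0 Y0 Z0 v),
    q11, q22, q12, q13, q23.
  constructor; auto.
  - intros x y Uxy. destruct (E1 x y Uxy), (E2 x y Uxy), (E3 x y Uxy). tauto.
  - intros x y Uxy. destruct (E1 x y Uxy) as (_ & _ & F1), (E2 x y Uxy) as (_ & _ & F2),
      (E3 x y Uxy) as (_ & _ & F3).
    (* The two degenerate relations determine [al] and [be] as logarithmic derivatives, which
       eliminates the net from the equation of the third. *)
    rewrite D1, Z1 in F1 by auto. rewrite D2, Z2 in F2 by auto.
    replace (Dx (comb l2 m2 n2 u) x y) with (al x y * comb l2 m2 n2 u x y) by lra.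
    replace (Dy (comb l1 m1 n1 v) x y) with (- be x y * comb l1 m1 n1 v x y) by lra.
    assert (Nu' := Nu x y Uxy). assert (Nv' := Nv x y Uxy).
    field_simplify_eq; auto. lra.
  - intros c1 c2 Hz.
    destruct (free (- c1 * l2 - c2 * l1 + X0) (- c1 * m2 - c2 * m1 + Y0)
      (- c1 * n2 - c2 * n1 + Z0)) as (F1 & F2 & F3).
    { intros x y Uxy. destruct (Hz x y Uxy) as [G1 G2].
      assert (K1 := Z1 x y Uxy). assert (K2 := Z2 x y Uxy). split.
      - transitivity (- c1 * comb l2 m2 n2 u x y - c2 * comb l1 m1 n1 u x y
          + comb X0 Y0 Z0 u x y); [unfold comb; ring|]. rewrite G1, K1; ring.
      - transitivity (- c1 * comb l2 m2 n2 v x y - c2 * comb l1 m1 n1 v x y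
          + comb X0 Y0 Z0 v x y); [unfold comb; ring|]. rewrite G2, K2; ring. }
    destruct (det3_unique l2 l1 X0 m2 m1 Y0 n2 n1 Z0 (- c1) (- c2) 1) as (_ & _ & O); try lra.
    intros Z. apply Hdet. rewrite <- Z. unfold det3. ring.
  - intros x y Uxy X Y Z. destruct (NZ x y Uxy) as (HA & HB & HC & HD).
    set (A := cdx th1 x y) in *. set (B := cdy th1 x y) in *.
    (* The factors of the components along [th1] with respect to its conormal, that is, the point of
       the arc. *)
    set (g := fun k => - (u k x y * A + v k x y * B) / conormal_sq th1 x y).
    assert (N := NC x y Uxy).
    destruct (RC 0%nat ltac:(lia) x y Uxy) as (_ & _ & a0 & b0 & _).
    destruct (RC 1%nat ltac:(lia) x y Uxy) as (_ & _ & a1 & b1 & _).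
    destruct (RC 2%nat ltac:(lia) x y Uxy) as (_ & _ & a2 & b2 & _).
    assert (FF := HF 0%nat ltac:(lia) x y Uxy (g 0%nat) (g 1%nat) (g 2%nat)).
    simpl in FF. rewrite a0, a1, a2, b0, b1, b2 in FF. fold A B in FF.
    assert (FZ : F (g 0%nat) (g 1%nat) (g 2%nat) = 0).
    { apply FF; unfold g, u, v; field; auto. }
    rewrite EF, EL1, EL2, EQ, (Eq (g 0%nat) (g 1%nat) (g 2%nat)) in FZ.
    assert (GS : l2 * g 0%nat + m2 * g 1%nat + n2 * g 2%nat = - X / conormal_sq th1 x y).
    { transitivity (- (comb l2 m2 n2 u x y * A + comb l2 m2 n2 v x y * B)
        / conormal_sq th1 x y); [unfold g, comb; field; auto|].
      rewrite Z2; auto. unfold X. field; auto. }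
    assert (GT : l1 * g 0%nat + m1 * g 1%nat + n1 * g 2%nat = - Y / conormal_sq th1 x y).
    { transitivity (- (comb l1 m1 n1 u x y * A + comb l1 m1 n1 v x y * B)
        / conormal_sq th1 x y); [unfold g, comb; field; auto|].
      rewrite Z1; auto. unfold Y. field; auto. }
    assert (GW : X0 * g 0%nat + Y0 * g 1%nat + Z0 * g 2%nat = - Z / conormal_sq th1 x y).
    { unfold g, Z, comb. field; auto. }
    rewrite GS, GT, GW in FZ.
    assert (NX : X <> 0) by (unfold X; apply Rmult_integral_contrapositive_currified; auto).
    assert (NY : Y <> 0) by (unfold Y; apply Rmult_integral_contrapositive_currified; auto).
    (* The quartic vanishes at this point, and the two lines do not because [X] and [Y] are nonzero;
       what remains is the conic. The fourth power comes from homogeneity. *)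
    apply Rmult_eq_reg_r with (X * Y / conormal_sq th1 x y ^ 4).
    + rewrite Rmult_0_l, <- FZ. field. auto.
    + unfold Rdiv. repeat apply Rmult_integral_contrapositive_currified; auto.
      apply Rinv_neq_0_compat. now apply pow_nonzero.
  - intros x y Uxy X Y Z. destruct (NZ x y Uxy) as (HA & HB & HC & HD).
    assert (O := oblique_orthogonal _ _ _ H x y Uxy).
    set (A := cdx th1 x y) in *. set (B := cdy th1 x y) in *.
    set (C := cdx th2 x y) in *. set (D := cdy th2 x y) in *.
    (* The conormal [(C, D)] is parallel to [(B, - A)]; [r] rescales it to [(- B, A)] divided by
       [conormal_sq]. *)
    assert (N := NC x y Uxy). set (r := - B / (C * conormal_sq th1 x y)).
    assert (rC : r * C = - B / conormal_sq th1 x y) by (unfold r; field; auto).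
    assert (rD : r * D = A / conormal_sq th1 x y).
    { unfold r. transitivity (- (B * D) / (C * conormal_sq th1 x y)); [field; auto|].
      replace (B * D) with (- (A * C)) by lra. field; auto. }
    assert (Nr : r <> 0).
    { intros Zr. rewrite Zr, Rmult_0_l in rD. apply HA.
      transitivity (A / conormal_sq th1 x y * conormal_sq th1 x y); [field; auto|].
      rewrite <- rD; ring. }
    set (g := fun k => (u k x y * B - v k x y * A) * r).
    destruct (RC 0%nat ltac:(lia) x y Uxy) as (_ & _ & _ & _ & a0 & b0).
    destruct (RC 1%nat ltac:(lia) x y Uxy) as (_ & _ & _ & _ & a1 & b1).
    destruct (RC 2%nat ltac:(lia) x y Uxy) as (_ & _ & _ & _ & a2 & b2).
    assert (FF := HF 1%nat ltac:(lia) x y Uxy (g 0%nat) (g 1%nat) (g 2%nat)).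
    simpl in FF. rewrite a0, a1, a2, b0, b1, b2 in FF. fold A B C D in FF.
    assert (gC : forall k, g k * C = - B * (u k x y * B - v k x y * A) / conormal_sq th1 x y).
    { intros k. unfold g. rewrite Rmult_assoc, rC. field; auto. }
    assert (gD : forall k, g k * D = A * (u k x y * B - v k x y * A) / conormal_sq th1 x y).
    { intros k. unfold g. rewrite Rmult_assoc, rD. field; auto. }
    assert (FZ : F (g 0%nat) (g 1%nat) (g 2%nat) = 0).
    { apply FF; rewrite ?gC, ?gD; reflexivity. }
    rewrite EF, EL1, EL2, EQ, (Eq (g 0%nat) (g 1%nat) (g 2%nat)) in FZ.
    assert (GS : l2 * g 0%nat + m2 * g 1%nat + n2 * g 2%nat = X * r).
    { transitivity ((comb l2 m2 n2 u x y * B - comb l2 m2 n2 v x y * A) * r);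
        [unfold g, comb; ring|].
      rewrite Z2; auto. unfold X. ring. }
    assert (GT : l1 * g 0%nat + m1 * g 1%nat + n1 * g 2%nat = Y * r).
    { transitivity ((comb l1 m1 n1 u x y * B - comb l1 m1 n1 v x y * A) * r);
        [unfold g, comb; ring|].
      rewrite Z1; auto. unfold Y. ring. }
    assert (GW : X0 * g 0%nat + Y0 * g 1%nat + Z0 * g 2%nat = Z * r).
    { unfold g, Z, comb. ring. }
    rewrite GS, GT, GW in FZ.
    assert (NX : X <> 0) by (unfold X; apply Rmult_integral_contrapositive_currified; auto).
    assert (NY : Y <> 0).
    { unfold Y. apply Ropp_neq_0_compat.
      apply Rmult_integral_contrapositive_currified; auto. }
    apply Rmult_eq_reg_r with (X * Y * r ^ 4).
    + rewrite Rmult_0_l, <- FZ. ring.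
    + apply Rmult_integral_contrapositive_currified; [|now apply pow_nonzero].
      now apply Rmult_integral_contrapositive_currified.
Qed.

(** * From the adapted relations to the equation of the net *)

Section Adapted.

Context (U : R * R -> Prop) (A B u1 v2 u3 v3 : R -> R -> R) (q11 q22 q12 q13 q23 : R)
  (HU : plane_domain U)
  (HAB : forall x y, U (x, y) -> A x y <> 0 /\ B x y <> 0)
  (Had : adapted_relations U A B u1 v2 u3 v3 q11 q22 q12 q13 q23).

(** In [adapted_equation] the left side has zero [y]-derivative and the right side zero
    [x]-derivative; their common value is the constant [ka]. The left side is [u1] times the
    derivative of [u3 / u1], the right side [v2] times that of [v3 / v2]. If [ka] were 0, both
    quotients would be constant, against [adapted_free]. *)
Lemma adapted_potentials : exists ka, ka <> 0 /\
  partials U (fun x y => u3 x y / u1 x y) (fun x y => ka / u1 x y) (fun _ _ => 0) /\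
  partials U (fun x y => v3 x y / v2 x y) (fun _ _ => 0) (fun x y => ka / v2 x y).
Proof.
  assert (oU := proj1 HU). destruct Had as [S1 S2 S3 S4 HP HN HE Hfree _ _ _].
  assert (N1 : forall x y, U (x, y) -> u1 x y <> 0) by (intros x y Uxy; apply (HN x y Uxy)).
  assert (N2 : forall x y, U (x, y) -> v2 x y <> 0) by (intros x y Uxy; apply (HN x y Uxy)).
  set (g := fun x y => Dx u3 x y - u3 x y * Dx u1 x y / u1 x y).
  assert (mixed_x : forall w, smooth U w -> (forall x y, U (x, y) -> Dy w x y = 0) ->
    forall x y, U (x, y) -> Dy (Dx w) x y = 0).
  { intros w Sw Hw x y Uxy. rewrite (mixed_partials U w); auto.
    now apply (Dx_zero_of_zero U). }
  assert (mixed_y : forall w, smooth U w -> (forall x y, U (x, y) -> Dx w x y = 0) ->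
    forall x y, U (x, y) -> Dx (Dy w) x y = 0).
  { intros w Sw Hw x y Uxy. rewrite <- (mixed_partials U w); auto.
    now apply (Dy_zero_of_zero U). }
  assert (P1 := smooth_partials _ _ S1). assert (P2 := smooth_partials _ _ S2).
  assert (P3 := smooth_partials _ _ S3). assert (P4 := smooth_partials _ _ S4).
  assert (P1' := smooth_partials _ _ (smooth_Dx _ _ S1)).
  assert (P2' := smooth_partials _ _ (smooth_Dy _ _ S2)).
  assert (P3' := smooth_partials _ _ (smooth_Dx _ _ S3)).
  assert (P4' := smooth_partials _ _ (smooth_Dy _ _ S4)).
  assert (Sg : smooth U g) by (unfold g; solve_smooth; auto).
  destruct (constant_of_zero_partials U g (Dx g) (Dy g) HU (smooth_partials _ _ Sg)) as [ka Hka].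
  { intros x y Uxy. split.
    - eapply Dx_eq.
      + eapply partials_ext_fun with
          (f := fun x y => Dy v3 x y - v3 x y * Dy v2 x y / v2 x y);
          [exact oU|intros; symmetry; now apply HE|solve_partials; auto].
      + exact Uxy.
      + cbv beta. destruct (HP x y Uxy) as (_ & -> & _ & ->).
        rewrite (mixed_y v2), (mixed_y v3); auto; try (intros; now apply HP).
        field. auto.
    - unfold g. eapply Dy_eq; [solve_partials; auto|exact Uxy|]. cbv beta.
      destruct (HP x y Uxy) as (-> & _ & -> & _).
      rewrite (mixed_x u1), (mixed_x u3); auto; try (intros; now apply HP).
      field. auto. }
  assert (Pm : partials U (fun x y => u3 x y / u1 x y) (fun x y => ka / u1 x y) (fun _ _ => 0)).
  { eapply partials_replace; [solve_partials; auto|].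
    intros x y Uxy; cbv beta. destruct (HP x y Uxy) as (-> & _ & -> & _).
    rewrite <- (Hka x y Uxy). unfold g. split; field; auto. }
  assert (Pn : partials U (fun x y => v3 x y / v2 x y) (fun _ _ => 0) (fun x y => ka / v2 x y)).
  { eapply partials_replace; [solve_partials; auto|].
    intros x y Uxy; cbv beta. destruct (HP x y Uxy) as (_ & -> & _ & ->).
    rewrite <- (Hka x y Uxy). unfold g. rewrite HE; auto. split; field; auto. }
  exists ka. split; [|split; assumption].
  intros ->.
  destruct (constant_of_zero_partials U _ _ _ HU Pm) as [c1 Hc1].
  { intros x y Uxy. split; [field; auto|reflexivity]. }
  destruct (constant_of_zero_partials U _ _ _ HU Pn) as [c2 Hc2].
  { intros x y Uxy. split; [reflexivity|field; auto]. }
  apply (Hfree c1 c2). intros x y Uxy.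
  rewrite <- (Hc1 x y Uxy), <- (Hc2 x y Uxy). split; field; auto.
Qed.

(* The slopes [A/B] and [-B/A] of the two foliations are the roots of the quadratic
   equation expressing that the arcs lie on the conic; as their product is [-1], its
   extreme coefficients are opposite. One depends on [x] only and the other on [y]
   only, so both are constant. *)
Lemma adapted_separation : exists c, c <> 0 /\ forall x y, U (x, y) ->
  u1 x y ^ 2 * (q11 + 2 * q13 * (u3 x y / u1 x y)) = - c /\
  v2 x y ^ 2 * (q22 + 2 * q23 * (v3 x y / v2 x y)) = c /\
  c * (A x y ^ 2 - B x y ^ 2) =
    2 * (q12 + q13 * (v3 x y / v2 x y) + q23 * (u3 x y / u1 x y))
      * (u1 x y * v2 x y) * (A x y * B x y).
Proof.
  destruct adapted_potentials as (ka & Nka & Pm & Pn).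
  assert (oU := proj1 HU). destruct Had as [S1 S2 S3 S4 HP HN _ _ Hdet Ha1 Ha2].
  assert (N1 : forall x y, U (x, y) -> u1 x y <> 0) by (intros x y Uxy; apply (HN x y Uxy)).
  assert (N2 : forall x y, U (x, y) -> v2 x y <> 0) by (intros x y Uxy; apply (HN x y Uxy)).
  set (m := fun x y => u3 x y / u1 x y). set (n := fun x y => v3 x y / v2 x y).
  change (partials U m (fun x y => ka / u1 x y) (fun _ _ => 0)) in Pm.
  change (partials U n (fun _ _ => 0) (fun x y => ka / v2 x y)) in Pn.
  (* With [u3 = m u1] and [v3 = n v2] substituted, [p], [k], [r] are the coefficients of [A^2],
     [A B], [B^2] in the equation of the arc. *)
  set (p := fun x y => u1 x y ^ 2 * (q11 + 2 * q13 * m x y)).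
  set (r := fun x y => v2 x y ^ 2 * (q22 + 2 * q23 * n x y)).
  set (k := fun x y => 2 * (q12 + q13 * n x y + q23 * m x y) * (u1 x y * v2 x y)).
  assert (F1 : forall x y, U (x, y) ->
    p x y * A x y ^ 2 + k x y * (A x y * B x y) + r x y * B x y ^ 2 = 0).
  { intros x y Uxy. rewrite <- (Ha1 x y Uxy). unfold p, k, r, m, n. field. auto. }
  assert (F2 : forall x y, U (x, y) ->
    p x y * B x y ^ 2 - k x y * (A x y * B x y) + r x y * A x y ^ 2 = 0).
  { intros x y Uxy. rewrite <- (Ha2 x y Uxy). unfold p, k, r, m, n. field. auto. }
  (* The sum of the equations of the two arcs is [(p + r) (A^2 + B^2) = 0]. *)
  assert (PR : forall x y, U (x, y) -> r x y = - p x y).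
  { intros x y Uxy. assert (E1 := F1 x y Uxy). assert (E2 := F2 x y Uxy).
    destruct (HAB x y Uxy) as [HA HB].
    assert (0 < A x y ^ 2) by (apply pow2_gt_0; auto).
    assert (0 < B x y ^ 2) by (apply pow2_gt_0; auto).
    apply Rmult_eq_reg_r with (A x y ^ 2 + B x y ^ 2); lra. }
  assert (P1 := smooth_partials _ _ S1). assert (P2 := smooth_partials _ _ S2).
  assert (Pr : partials U r (fun _ _ => 0) (fun _ _ => 0)).
  { assert (Pr : exists rx ry, partials U r rx ry /\ forall x y, U (x, y) -> rx x y = 0).
    { unfold r. do 2 eexists. split; [solve_partials|].
      intros x y Uxy; cbv beta. destruct (HP x y Uxy) as (_ & -> & _). ring. }
    assert (Pr' : exists rx ry, partials U r rx ry /\ forall x y, U (x, y) -> ry x y = 0).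
    { assert (Q : exists rx ry, partials U (fun x y => - p x y) rx ry /\
        forall x y, U (x, y) -> ry x y = 0).
      { unfold p. do 2 eexists. split; [solve_partials|].
        intros x y Uxy; cbv beta. destruct (HP x y Uxy) as (-> & _). ring. }
      destruct Q as (rx & ry & Q & Q0). exists rx, ry. split; auto.
      eapply partials_ext_fun; [exact oU| |exact Q]. intros; symmetry; auto. }
    destruct Pr as (rx & ry & Pr & R0), Pr' as (rx' & ry' & Pr' & R0').
    intros x y Uxy. destruct (Pr x y Uxy) as [H1 _], (Pr' x y Uxy) as [_ H2].
    rewrite R0 in H1 by auto. rewrite R0' in H2 by auto. auto. }
  destruct (constant_of_zero_partials U r _ _ HU Pr) as [c Hc]; [auto|].
  exists c. split.
  (* With [c = 0] the function [q11 + 2 q13 m] would vanish; as [m] has nonzero derivative,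
     [q13 = q11 = 0] and the conic would be degenerate. *)
  - intros ->.
    assert (Em : forall x y, U (x, y) -> q11 + 2 * q13 * m x y = 0).
    { intros x y Uxy. assert (E := PR x y Uxy). rewrite Hc in E by auto.
      apply Rmult_eq_reg_l with (u1 x y ^ 2); [unfold p in E; lra|].
      apply pow_nonzero; auto. }
    destruct (proj1 (proj2 HU)) as [[xb yb] Ub].
    assert (N := N1 xb yb Ub).
    differentiate oU Em Ub Ex Ey.
    assert (Z13 : q13 = 0).
    { apply Rmult_eq_reg_r with (2 * (ka / u1 xb yb)); [lra|].
      unfold Rdiv. apply Rmult_integral_contrapositive_currified; [lra|].
      apply Rmult_integral_contrapositive_currified; auto using Rinv_neq_0_compat. }
    assert (Z11 := Em xb yb Ub). rewrite Z13 in Z11.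
    apply Hdet. rewrite Z13. replace q11 with 0 by lra. ring.
  - intros x y Uxy. assert (E := PR x y Uxy). assert (E1 := F1 x y Uxy).
    assert (Ec := Hc x y Uxy).
    split; [|split].
    + change (p x y = - c). lra.
    + exact Ec.
    + change (c * (A x y ^ 2 - B x y ^ 2) = k x y * (A x y * B x y)).
      rewrite Ec in E, E1. replace (p x y) with (- c) in E1 by lra. lra.
Qed.

(** For [mu = ka / u1], the derivative of [m], the separated equation becomes
    [c mu^2 = - ka^2 (q11 + 2 q13 m)]; differentiating and cancelling [2 mu] leaves
    [c mu_x = - ka^2 q13]. The same argument applies to [nu = ka / v2]. *)
Lemma adapted_first_integrals : exists ka c s t mu0 nu0, ka <> 0 /\ c <> 0 /\
  c * s = - ka ^ 2 * q13 /\ c * t = ka ^ 2 * q23 /\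
  partials U (fun x y => u3 x y / u1 x y) (fun x y => s * x + mu0) (fun _ _ => 0) /\
  partials U (fun x y => v3 x y / v2 x y) (fun _ _ => 0) (fun x y => t * y + nu0) /\
  forall x y, U (x, y) ->
    let m := u3 x y / u1 x y in
    let n := v3 x y / v2 x y in
    let mu := s * x + mu0 in
    let nu := t * y + nu0 in
    mu <> 0 /\ nu <> 0 /\
    c * mu ^ 2 = - ka ^ 2 * (q11 + 2 * q13 * m) /\
    c * nu ^ 2 = ka ^ 2 * (q22 + 2 * q23 * n) /\
    c * (mu * nu) * (A x y ^ 2 - B x y ^ 2) =
      2 * ka ^ 2 * (q12 + q13 * n + q23 * m) * (A x y * B x y).
Proof.
  destruct adapted_potentials as (ka & Nka & Pm & Pn).
  destruct adapted_separation as (c & Nc & Hc).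
  assert (oU := proj1 HU). destruct Had as [S1 S2 S3 S4 HP HN _ _ _ _ _].
  assert (N1 : forall x y, U (x, y) -> u1 x y <> 0) by (intros x y Uxy; apply (HN x y Uxy)).
  assert (N2 : forall x y, U (x, y) -> v2 x y <> 0) by (intros x y Uxy; apply (HN x y Uxy)).
  set (m := fun x y => u3 x y / u1 x y). set (n := fun x y => v3 x y / v2 x y).
  change (partials U m (fun x y => ka / u1 x y) (fun _ _ => 0)) in Pm.
  change (partials U n (fun _ _ => 0) (fun x y => ka / v2 x y)) in Pn.
  assert (P1 := smooth_partials _ _ S1). assert (P2 := smooth_partials _ _ S2).
  set (mu := fun x y => ka / u1 x y). set (nu := fun x y => ka / v2 x y).
  assert (Smu : smooth U mu) by (unfold mu; solve_smooth; auto).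
  assert (Snu : smooth U nu) by (unfold nu; solve_smooth; auto).
  assert (Nmu : forall x y, U (x, y) -> mu x y <> 0).
  { intros x y Uxy. unfold mu, Rdiv.
    apply Rmult_integral_contrapositive_currified; auto using Rinv_neq_0_compat. }
  assert (Nnu : forall x y, U (x, y) -> nu x y <> 0).
  { intros x y Uxy. unfold nu, Rdiv.
    apply Rmult_integral_contrapositive_currified; auto using Rinv_neq_0_compat. }
  assert (Emu : forall x y, U (x, y) -> c * mu x y ^ 2 = - ka ^ 2 * (q11 + 2 * q13 * m x y)).
  { intros x y Uxy. destruct (Hc x y Uxy) as (E & _). change (u3 x y / u1 x y) with (m x y) in E.
    replace c with (- (u1 x y ^ 2 * (q11 + 2 * q13 * m x y))) by lra.
    unfold mu. field. auto. }
  assert (Enu : forall x y, U (x, y) -> c * nu x y ^ 2 = ka ^ 2 * (q22 + 2 * q23 * n x y)).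
  { intros x y Uxy. destruct (Hc x y Uxy) as (_ & E & _).
    change (v3 x y / v2 x y) with (n x y) in E.
    rewrite <- E at 1. unfold nu. field. auto. }
  assert (Pmu := smooth_partials _ _ Smu). assert (Pnu := smooth_partials _ _ Snu).
  set (s := - ka ^ 2 * q13 / c). set (t := ka ^ 2 * q23 / c).
  destruct (constant_of_zero_partials U (fun x y => mu x y - s * x)
    (fun x y => Dx mu x y - (0 * x + s * 1)) (fun x y => Dy mu x y - (0 * x + s * 0)) HU)
    as [mu0 Hmu0]; [solve_partials| |].
  { intros x y Uxy. 
    assert (N : 2 * c * mu x y <> 0).
    { apply Rmult_integral_contrapositive_currified; auto. }
    differentiate oU Emu Uxy Ex Ey. split.
    - apply Rmult_eq_reg_l with (2 * c * mu x y); auto.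
      transitivity (0 * mu x y ^ 2 + c * (2 * mu x y * Dx mu x y)
        + 2 * ka ^ 2 * q13 * mu x y); [unfold s; field; auto|].
      rewrite Ex. change (ka / u1 x y) with (mu x y). ring.
    - apply Rmult_eq_reg_l with (2 * c * mu x y); auto.
      lra. }
  destruct (constant_of_zero_partials U (fun x y => nu x y - t * y)
    (fun x y => Dx nu x y - (0 * y + t * 0)) (fun x y => Dy nu x y - (0 * y + t * 1)) HU)
    as [nu0 Hnu0]; [solve_partials| |].
  { intros x y Uxy. 
    assert (N : 2 * c * nu x y <> 0).
    { apply Rmult_integral_contrapositive_currified; auto. }
    differentiate oU Enu Uxy Ex Ey. split.
    - apply Rmult_eq_reg_l with (2 * c * nu x y); auto.
      lra.
    - apply Rmult_eq_reg_l with (2 * c * nu x y); auto.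
      transitivity (0 * nu x y ^ 2 + c * (2 * nu x y * Dy nu x y)
        - 2 * ka ^ 2 * q23 * nu x y); [unfold t; field; auto|].
      rewrite Ey. change (ka / v2 x y) with (nu x y). ring. }
  assert (Vmu : forall x y, U (x, y) -> mu x y = s * x + mu0).
  { intros x y Uxy. rewrite <- (Hmu0 x y Uxy). ring. }
  assert (Vnu : forall x y, U (x, y) -> nu x y = t * y + nu0).
  { intros x y Uxy. rewrite <- (Hnu0 x y Uxy). ring. }
  exists ka, c, s, t, mu0, nu0. split; [exact Nka|split; [exact Nc|]].
  split; [unfold s; field; auto|split; [unfold t; field; auto|]].
  split; [|split].
  - eapply partials_replace; [exact Pm|]. intros x y Uxy.
    split; [exact (Vmu x y Uxy)|reflexivity].
  - eapply partials_replace; [exact Pn|]. intros x y Uxy.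
    split; [reflexivity|exact (Vnu x y Uxy)].
  - intros x y Uxy; cbv zeta. rewrite <- (Vmu x y Uxy), <- (Vnu x y Uxy).
    split; [|split; [|split; [|split]]]; auto.
    destruct (Hc x y Uxy) as (_ & _ & E).
    transitivity (mu x y * nu x y * (c * (A x y ^ 2 - B x y ^ 2))); [ring|].
    rewrite E. unfold mu, nu. field. auto.
Qed.

(** The tangent of the conic at [[0 : 0 : 1]] is [q13 X + q23 Y = 0]. If [q13] or [q23] vanishes,
    one of the two lines is this tangent, and the conics are parabolas; both cannot vanish, the
    conic being irreducible. *)
Lemma adapted_net_equation :
  (exists k x0 y0, k <> 0 /\ forall x y, U (x, y) -> x - x0 <> 0 /\ y - y0 <> 0 /\
     (x - x0) * (y - y0) * (A x y ^ 2 - B x y ^ 2) =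
     ((x - x0) ^ 2 - (y - y0) ^ 2 - k) * (A x y * B x y)) \/
  (exists x0 y0, forall x y, U (x, y) -> y - y0 <> 0 /\
     (y - y0) * (A x y ^ 2 - B x y ^ 2) = 2 * (x - x0) * (A x y * B x y)) \/
  (exists x0 y0, forall x y, U (x, y) -> x - x0 <> 0 /\
     (x - x0) * (A x y ^ 2 - B x y ^ 2) = - 2 * (y - y0) * (A x y * B x y)).
Proof.
  destruct adapted_first_integrals as
    (ka & c & s & t & mu0 & nu0 & Nka & Nc & Es & Et & Pm & Pn & H).
  assert (Hdet := adapted_det _ _ _ _ _ _ _ _ _ _ _ _ Had).
  destruct (proj1 (proj2 HU)) as [[xb yb] Ub].
  set (m := fun x y => u3 x y / u1 x y). set (n := fun x y => v3 x y / v2 x y).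
  change (partials U m (fun x y => s * x + mu0) (fun _ _ => 0)) in Pm.
  change (partials U n (fun _ _ => 0) (fun x y => t * y + nu0)) in Pn.
  assert (Nka2 : ka ^ 2 <> 0) by now apply pow_nonzero.
  assert (Z13 : q13 = 0 <-> s = 0).
  { split; intros Z; rewrite Z in Es; rewrite Rmult_0_r in Es.
    - apply Rmult_integral in Es. tauto.
    - symmetry in Es. apply Rmult_integral in Es as [Es|Es]; auto. lra. }
  assert (Z23 : q23 = 0 <-> t = 0).
  { split; intros Z; rewrite Z in Et; rewrite Rmult_0_r in Et.
    - apply Rmult_integral in Et. tauto.
    - symmetry in Et. apply Rmult_integral in Et. tauto. }
  destruct (Req_dec q13 0) as [E13|N13], (Req_dec q23 0) as [E23|N23].
  - exfalso. apply Hdet. rewrite E13, E23. ring.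
  - right; left. assert (S0 : s = 0) by tauto. assert (T0 : t <> 0) by tauto.
    destruct (H xb yb Ub) as (M0 & _). rewrite S0, Rmult_0_l, Rplus_0_l in M0.
    destruct (constant_of_zero_partials U (fun x y => m x y - mu0 * x)
      (fun x y => (s * x + mu0) - (0 * x + mu0 * 1)) (fun x y => 0 - (0 * x + mu0 * 0)) HU)
      as [m0 Hm0]; [solve_partials| |].
    { intros x y Uxy. rewrite S0. split; ring. }
    (* The focus: [x0] is the zero of the affine function [q12 + q23 m], and [y0] that of [nu]. *)
    exists (- (m0 + q12 / q23) / mu0), (- nu0 / t).
    intros x y Uxy. destruct (H x y Uxy) as (_ & Nn & _ & _ & E).
    replace (s * x + mu0) with mu0 in E by (rewrite S0; ring).
    replace (t * y + nu0) with (t * (y - - nu0 / t)) in E, Nn by (field; auto).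
    change (v3 x y / v2 x y) with (n x y) in E.
    change (u3 x y / u1 x y) with (m x y) in E. rewrite E13 in E.
    replace (m x y) with (mu0 * x + m0) in E by (rewrite <- (Hm0 x y Uxy); ring).
    split.
    + intros Z. apply Nn. rewrite Z; ring.
    + apply Rmult_eq_reg_l with (c * mu0 * t);
        [|repeat apply Rmult_integral_contrapositive_currified; auto].
      transitivity (c * (mu0 * (t * (y - - nu0 / t))) * (A x y ^ 2 - B x y ^ 2)); [ring|].
      rewrite E. transitivity (2 * (c * t) * (mu0 * x + m0 + q12 / q23) * (A x y * B x y)).
      * rewrite Et. field. auto.
      * field. auto.
  - right; right. assert (S0 : s <> 0) by tauto. assert (T0 : t = 0) by tauto.
    destruct (H xb yb Ub) as (_ & M0 & _). rewrite T0, Rmult_0_l, Rplus_0_l in M0.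
    destruct (constant_of_zero_partials U (fun x y => n x y - nu0 * y)
      (fun x y => 0 - (0 * y + nu0 * 0)) (fun x y => (t * y + nu0) - (0 * y + nu0 * 1)) HU)
      as [n0 Hn0]; [solve_partials| |].
    { intros x y Uxy. rewrite T0. split; ring. }
    exists (- mu0 / s), (- (n0 + q12 / q13) / nu0).
    intros x y Uxy. destruct (H x y Uxy) as (Nm & _ & _ & _ & E).
    replace (t * y + nu0) with nu0 in E by (rewrite T0; ring).
    replace (s * x + mu0) with (s * (x - - mu0 / s)) in E, Nm by (field; auto).
    change (u3 x y / u1 x y) with (m x y) in E.
    change (v3 x y / v2 x y) with (n x y) in E. rewrite E23 in E.
    replace (n x y) with (nu0 * y + n0) in E by (rewrite <- (Hn0 x y Uxy); ring).
    split.
    + intros Z. apply Nm. rewrite Z; ring.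
    + apply Rmult_eq_reg_l with (c * nu0 * s);
        [|repeat apply Rmult_integral_contrapositive_currified; auto].
      transitivity (c * (s * (x - - mu0 / s) * nu0) * (A x y ^ 2 - B x y ^ 2)); [ring|].
      rewrite E. transitivity (- 2 * (c * s) * (nu0 * y + n0 + q12 / q13) * (A x y * B x y)).
      * rewrite Es. field. auto.
      * field. auto.
  - left. assert (S0 : s <> 0) by tauto. assert (T0 : t <> 0) by tauto.
    (* The determinant of the conic divided by [q13 q23]; it becomes a nonzero multiple of
       [a^2 - b^2]. The center is the common zero of [mu] and [nu]. *)
    set (K := 2 * q12 - q13 / q23 * q22 - q23 / q13 * q11).
    assert (NK : K <> 0).
    { intros Z. apply Hdet. transitivity (q13 * q23 * K); [unfold K; field; auto|].
      rewrite Z; ring. }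
    exists (- ka ^ 2 * K / (c * s * t)), (- mu0 / s), (- nu0 / t).
    split.
    { unfold Rdiv. repeat apply Rmult_integral_contrapositive_currified; auto; try lra.
      apply Rinv_neq_0_compat.
      repeat apply Rmult_integral_contrapositive_currified; auto. }
    intros x y Uxy. destruct (H x y Uxy) as (Nm & Nn & Em & En & E).
    change (u3 x y / u1 x y) with (m x y) in Em, E.
    change (v3 x y / v2 x y) with (n x y) in En, E.
    replace (s * x + mu0) with (s * (x - - mu0 / s)) in E, Nm, Em by (field; auto).
    replace (t * y + nu0) with (t * (y - - nu0 / t)) in E, Nn, En by (field; auto).
    set (X := x - - mu0 / s) in *. set (Y := y - - nu0 / t) in *.
    split; [intros Z; apply Nm; rewrite Z; ring|].
    split; [intros Z; apply Nn; rewrite Z; ring|].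
    (* [Em] and [En] express [m] and [n], which enter linearly, by the squares of [X] and [Y]. *)
    assert (E' : 2 * ka ^ 2 * (q12 + q13 * n x y + q23 * m x y)
      = c * s * t * (X ^ 2 - Y ^ 2) + ka ^ 2 * K).
    { apply Rmult_eq_reg_l with (q13 * q23);
        [|now apply Rmult_integral_contrapositive_currified].
      transitivity (q13 ^ 2 * (c * (t * Y) ^ 2) - q23 ^ 2 * (c * (s * X) ^ 2)
        + ka ^ 2 * (2 * q12 * q13 * q23 - q11 * q23 ^ 2 - q22 * q13 ^ 2)).
      - rewrite Em, En. ring.
      - transitivity (q13 ^ 2 * (c * t) * t * Y ^ 2 - q23 ^ 2 * (c * s) * s * X ^ 2
          + ka ^ 2 * (q13 * q23 * K)); [unfold K; field; auto|].
        transitivity (q13 * q23 * ((c * t) * s * X ^ 2 - (c * s) * t * Y ^ 2 + ka ^ 2 * K)).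
        + rewrite Es, Et. ring.
        + ring. }
    apply Rmult_eq_reg_l with (c * s * t);
      [|repeat apply Rmult_integral_contrapositive_currified; auto].
    transitivity (c * (s * X * (t * Y)) * (A x y ^ 2 - B x y ^ 2)); [ring|].
    rewrite E, E'. field. auto.
Qed.

End Adapted.

Lemma confocal_net_of_quartic U th1 th2 :
  plane_domain U -> oblique_net U th1 th2 ->
  rank_quartic_is_conic_and_two_lines_through_it U (net_with_coordinate_lines th1 th2) ->
  confocal_net U th1 th2.
Proof.
  intros HU H HQ. assert (oU := proj1 HU).
  destruct (adapted_relations_of_quartic U th1 th2 HU H HQ)
    as (u1 & v2 & u3 & v3 & q11 & q22 & q12 & q13 & q23 & Had).
  assert (NZ := oblique_nonzero _ _ _ H). assert (O := oblique_orthogonal _ _ _ H).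
  assert (Sth1 := oblique_smooth1 _ _ _ H). assert (Sth2 := oblique_smooth2 _ _ _ H).
  assert (NZ1 : forall x y, U (x, y) -> cdx th1 x y <> 0 /\ cdy th1 x y <> 0).
  { intros x y Uxy. destruct (NZ x y Uxy) as (? & ? & _). auto. }
  assert (NZ2 : forall x y, U (x, y) -> cdx th2 x y <> 0 /\ cdy th2 x y <> 0).
  { intros x y Uxy. destruct (NZ x y Uxy) as (_ & _ & ?). auto. }
  destruct (adapted_net_equation U _ _ _ _ _ _ _ _ _ _ _ HU NZ1 Had)
    as [(k & x0 & y0 & Nk & E)|[(x0 & y0 & E)|(x0 & y0 & E)]].
  - destruct (exists_square_difference k) as (a & b & Hk). subst k.
    eexists. split; [apply (confocal_central a b x0 y0)|].
    split; apply leaves_on_central; auto.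
    (* The equation was derived for [th1]; for [th2] it follows by a quarter turn. *)
    intros x y Uxy. destruct (E x y Uxy) as (X & Y & F). repeat split; auto.
    now apply (orthogonal_conormal_equation (cdx th1 x y) (cdy th1 x y)); auto; apply NZ1.
  - eexists. split; [apply (confocal_parabolas_x x0 y0)|].
    split; apply leaves_on_parabolas_x; auto.
    intros x y Uxy. destruct (E x y Uxy) as (Y & F). split; auto.
    now apply (orthogonal_conormal_equation (cdx th1 x y) (cdy th1 x y)); auto; apply NZ1.
  - eexists. split; [apply (confocal_parabolas_y x0 y0)|].
    split; apply leaves_on_parabolas_y; auto.
    intros x y Uxy. destruct (E x y Uxy) as (X & F). split; auto.
    now apply (orthogonal_conormal_equation (cdx th1 x y) (cdy th1 x y)); auto; apply NZ1.
Qed.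

Theorem theorem1 (U : R * R -> Prop) (th1 th2 : one_form)
    (hU : plane_domain U) (hnet : orthogonal_net U th1 th2)
    (hweb : is_web U 4 (net_with_coordinate_lines th1 th2)) :
  confocal_net U th1 th2 <->
  (maximal_rank U 4 (net_with_coordinate_lines th1 th2) /\
   rank_quartic_is_conic_and_two_lines_through_it U
     (net_with_coordinate_lines th1 th2)).
Proof.
  assert (H := oblique_of_web U th1 th2 hU hnet hweb). split.
  - now apply quartic_of_confocal_net.
  - intros [_ HQ]. now apply confocal_net_of_quartic.
Qed.
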